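(* Let $m,n$ be integers with $\min(m,n)\ge 3$, and let $\mathbf p=(p_1,\dots,p_m;\,q_1,\dots,q_n)$ be a $\mathbb P^2$-non-overlapping spherical $(m,n)$-framework. Then $\mathbf p$ is flexible if and only if it satisfies (SD1) or one of the following two conditions: (PD2) $\mathbf p$ satisfies (SD2) after applying the antipodal involution to some of its joints; (CDA) $m=n=3$ and, after numbering the joints as $\mathbf p=(p_0,p_1,p_2;\,q_0,q_1,q_2)$ in a suitable way, $\langle p_1,q_1\rangle=\langle q_1,p_2\rangle=\langle p_2,q_2\rangle=-\langle q_2,p_1\rangle$ and $\langle p_0,q_k\rangle=\langle q_0,p_k\rangle=0$ for $k=1,2$.
   Context: $S^2=\{x^2+y^2+z^2=1\}\subset\mathbb R^3$, $\langle\,,\,\rangle$ is the scalar product of $\mathbb R^3$, and $d_S(p,q)=\arccos\langle p,q\rangle$. A spherical $(m,n)$-framework is a collection of points $\mathbf p=(p_1,\dots,p_m;\,q_1,\dots,q_n)$ of $S^2$ such that $p_i\ne\pm q_j$ for all $i,j$; the $p_i,q_j$ are its joints, and the two parts are $(p_1,\dots,p_m)$ and $(q_1,\dots,q_n)$. It is $\mathbb P^2$-non-overlapping if $p_i\ne\pm p_j$ and $q_i\ne\pm q_j$ when $i\ne j$. It is flexible if there is a continuous non-constant motion of its joints $\mathbf p(t)=(p_1(t),\dots,q_n(t))$ on $S^2$, $t\in[0,1]$, such that $\mathbf p(0)=\mathbf p$, $d_S(p_i(t),q_j(t))$ does not depend on $t$ for each $i,j$, and some two joints from different parts do not move. The antipodal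 involution is $p\mapsto -p$. (SD1): $p_1,\dots,p_m$ lie on one plane, $q_1,\dots,q_n$ lie on another plane, and these planes are orthogonal to each other and pass through the origin. (SD2): there are two orthogonal planes passing through the origin and two rectangles symmetric with respect to each of these planes and with vertices not belonging to these planes, such that $p_1,\dots,p_m$ are at the vertices of one rectangle and $q_1,\dots,q_n$ are at the vertices of the other one. *)

(* Defs.v *)
From HB Require Import structures.
From mathcomp Require Import all_boot all_order all_algebra.
From mathcomp Require Import all_classical all_reals all_analysis.

Set Implicit Arguments.
Unset Strict Implicit.
Unset Printing Implicit Defensive.

Import Order.TTheory GRing.Theory Num.Theory.
Import numFieldNormedType.Exports.

Local Open Scope classical_set_scope.
Local Open Scope ring_scope.

Definition dot (R : realType) (u v : 'rV[R]_3) : R :=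
  \sum_(i < 3) u 0 i * v 0 i.

Definition S2 (R : realType) : set 'rV[R]_3 := [set x | dot x x = 1].

Definition dS (R : realType) (x y : 'rV[R]_3) : R := acos (dot x y).

(* The two parts are finite families: p for (p_1, ..., p_m) and q for
   (q_1, ..., q_n), both indexed from 0. *)
Definition spherical_framework (R : realType) (m n : nat)
    (p : 'I_m -> 'rV[R]_3) (q : 'I_n -> 'rV[R]_3) : Prop :=
  [/\ forall i, S2 (p i),
      forall j, S2 (q j)
    & forall i j, p i <> q j /\ p i <> - q j].

Definition P2_non_overlapping (R : realType) (m n : nat)
    (p : 'I_m -> 'rV[R]_3) (q : 'I_n -> 'rV[R]_3) : Prop :=
  (forall i j, i <> j -> p i <> p j /\ p i <> - p j) /\
  (forall i j, i <> j -> q i <> q j /\ q i <> - q j).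

(* P i t and Q j t are the positions of the joints at time t; their values for
   t outside [0, 1] are irrelevant. *)
Definition is_flex (R : realType) (m n : nat)
    (p : 'I_m -> 'rV[R]_3) (q : 'I_n -> 'rV[R]_3)
    (P : 'I_m -> R -> 'rV[R]_3) (Q : 'I_n -> R -> 'rV[R]_3) : Prop :=
  [/\ (forall i, {within `[0, 1], continuous (P i)}) /\
      (forall j, {within `[0, 1], continuous (Q j)}),
      forall t : R, t \in `[0, 1] ->
        (forall i, S2 (P i t)) /\ (forall j, S2 (Q j t)),
      (forall i, P i 0 = p i) /\ (forall j, Q j 0 = q j),
      forall i j (t : R), t \in `[0, 1] -> dS (P i t) (Q j t) = dS (P i 0) (Q j 0)
    & (exists i j, forall t : R, t \in `[0, 1] -> P i t = P i 0 /\ Q j t = Q j 0) /\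
      (exists2 t : R, t \in `[0, 1] &
        (exists i, P i t <> P i 0) \/ (exists j, Q j t <> Q j 0))].

Definition flexible (R : realType) (m n : nat)
    (p : 'I_m -> 'rV[R]_3) (q : 'I_n -> 'rV[R]_3) : Prop :=
  exists P Q, is_flex p q P Q.

(* For u != 0, the plane through the origin with normal vector u. *)
Definition plane (R : realType) (u : 'rV[R]_3) : set 'rV[R]_3 :=
  [set x | dot u x = 0].

(* u and v are normals of two orthogonal planes through the origin. *)
Definition orthogonal_planes (R : realType) (u v : 'rV[R]_3) : Prop :=
  [/\ u <> 0, v <> 0 & dot u v = 0].

(* Orthogonal reflection in plane u, for u != 0. *)
Definition reflection (R : realType) (u x : 'rV[R]_3) : 'rV[R]_3 :=
  x - (2 * dot u x / dot u u) *: u.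

(* V is the set of vertices of a nondegenerate rectangle abcd. *)
Definition rectangle (R : realType) (V : set 'rV[R]_3) : Prop :=
  exists a b c d : 'rV[R]_3,
    [/\ V = [set a; b; c; d],
        a <> b, a <> d,
        b - a = c - d
      & dot (b - a) (d - a) = 0].

(* A rectangle is symmetric with respect to a plane iff its vertex set is
   mapped onto itself by the reflection. *)
Definition symmetric_rectangle (R : realType) (u v : 'rV[R]_3)
    (V : set 'rV[R]_3) : Prop :=
  [/\ rectangle V,
      reflection u @` V = V,
      reflection v @` V = V
    & forall x, V x -> ~ plane u x /\ ~ plane v x].

Definition SD1 (R : realType) (m n : nat)
    (p : 'I_m -> 'rV[R]_3) (q : 'I_n -> 'rV[R]_3) : Prop :=
  exists u v : 'rV[R]_3,
    [/\ orthogonal_planes u v,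
        forall i, plane u (p i)
      & forall j, plane v (q j)].

(* With m < 4 or n < 4 some vertices of the rectangles are not occupied. *)
Definition SD2 (R : realType) (m n : nat)
    (p : 'I_m -> 'rV[R]_3) (q : 'I_n -> 'rV[R]_3) : Prop :=
  exists (u v : 'rV[R]_3) (V W : set 'rV[R]_3),
    [/\ orthogonal_planes u v,
        symmetric_rectangle u v V,
        symmetric_rectangle u v W,
        forall i, V (p i)
      & forall j, W (q j)].

(* The antipodal involution applied to the members of f selected by s. *)
Definition antipode_some (R : realType) (k : nat) (s : 'I_k -> bool)
    (f : 'I_k -> 'rV[R]_3) (i : 'I_k) : 'rV[R]_3 :=
  if s i then - f i else f i.

Definition PD2 (R : realType) (m n : nat)
    (p : 'I_m -> 'rV[R]_3) (q : 'I_n -> 'rV[R]_3) : Prop :=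
  exists (s : 'I_m -> bool) (t : 'I_n -> bool),
    SD2 (antipode_some s p) (antipode_some t q).

(* For m = n = 3, a renumbering of the joints is a triple of distinct indices
   for each part. *)
Definition CDA (R : realType) (m n : nat)
    (p : 'I_m -> 'rV[R]_3) (q : 'I_n -> 'rV[R]_3) : Prop :=
  [/\ m = 3%N, n = 3%N
    & exists (i0 i1 i2 : 'I_m) (j0 j1 j2 : 'I_n),
      [/\ uniq [:: i0; i1; i2], uniq [:: j0; j1; j2],
          [/\ dot (p i1) (q j1) = dot (q j1) (p i2),
              dot (q j1) (p i2) = dot (p i2) (q j2)
            & dot (p i2) (q j2) = - dot (q j2) (p i1)],
          dot (p i0) (q j1) = 0 /\ dot (q j0) (p i1) = 0
        & dot (p i0) (q j2) = 0 /\ dot (q j0) (p i2) = 0]].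

(* Main.v *)
(** Necessity. Fix two joints and look at the first time at which something moves. If all the [P_i]
    or all the [Q_j] are coplanar there, the constancy of the products [<P_i, Q_j>] leaves only (SD1).
    Otherwise take independent triples [P_1, P_2, P_3] and [Q_1, Q_2, Q_3] and let [a = <P_1, P_2>].
    Then [w_j = det(P_1, P_2, Q_j)] satisfies [w_j ^ 2 = h_j(a)] with quadratic polynomials [h_j], and
    [|P_3| = 1] becomes a relation [A(a) + sum_(j < l) B_jl(a) w_j w_l = 0]. As [a] takes infinitely
    many values, this relation is formal. If the [h_j] are distinct, the square roots of the
    [h_j h_l] are independent, all [B_jl] vanish, and this is (CDA). If two of the [h_j] coincide, then
    [Q_1] and [Q_2] are, up to sign, exchanged or mirrored by a symmetry of [P_1, P_2], and comparing
    coefficients gives (CDA) or an affine relation between [<P_1, P_2>], [<P_1, P_3>], [<P_2, P_3>] that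
    makes three combinations [P_i +- P_k] pairwise orthogonal. In the latter case the squared lengths
    of these axes satisfy one affine relation for each [P_i] and one relation affine in their
    inverses for each [Q_j]; two distinct relations of the same kind are impossible, which forces all
    joints into the box pattern of (PD2). In a (CDA) framework there is no room for a fourth joint.

    Sufficiency. Explicit motions preserve all [<P_i, Q_j>], and a moving frame brings two joints
    back to rest: opposite scalings of the common axis for (SD1), a diagonal map acting on the [P_i]
    and its inverse acting on the [Q_j] for (PD2), and a rotation of [Q_1] and [Q_2] in opposite
    directions for (CDA). *)

Require Import Defs.
From mathcomp Require Import all_boot all_order all_algebra.
From mathcomp Require Import all_classical all_reals all_analysis.
From mathcomp Require Import ring lra.

Set Implicit Arguments.
Unset Strict Implicit.
Unset Printing Implicit Defensive.

Import Order.TTheory GRing.Theory Num.Theory.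
Import numFieldNormedType.Exports.

Local Open Scope classical_set_scope.
Local Open Scope ring_scope.

(** * Identities between square roots of polynomials *)

(** The motion is merely continuous: [a] may oscillate around its limit, and the signs of the [w_j]
    may change in any manner, so neither an interval of values nor a branch of a square root is at
    hand. Two devices replace analyticity. Near a limit a nonzero polynomial vanishes at most at the
    limit itself, and [a] is found away from its limit at times arbitrarily close to the first
    moving time; [freq] states the consequence for a filter, and it survives on one of two sets
    covering [E], which is how signs get fixed. Square roots are compared only through their
    squares, by the parity of the multiplicity of a root. The classification itself speaks only of
    scalar products; there the two resting joints serve to turn constancy of these products into
    actual rest. *)

(* However far one goes along [F], [a] takes on [E] values outside any finite set:
   an identity between polynomials in [a] that holds on [E] is then formal. *)
Definition freq (R : rcfType) (T : Type) (F : set_system T) (a : T -> R) (E : set T) :=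
  forall p : {poly R}, p != 0 -> ~ F [set t | E t -> p.[a t] = 0].

Section Freq.
Variables (R : rcfType) (T : Type) (F : set_system T) (FF : Filter F).
Implicit Types (a w : T -> R) (E : set T).

(** If both parts failed, each with its own nonzero polynomial, the product of the two polynomials
    would refute [freq] on [E]. *)
Lemma freqU a E (A B : set T) :
  freq F a E -> (forall t, E t -> A t \/ B t) ->
  freq F a (E `&` A) \/ freq F a (E `&` B).
Proof.
move=> hE hAB; case: (pselect (freq F a (E `&` A))) => [|nA]; first by left.
right=> p p0 Fp; apply: nA => r r0 Fr.
apply: (hE (p * r)); first by rewrite mulf_neq0.
apply: filterS2 Fp Fr => t /= hp hr Et; rewrite hornerM.
by case: (hAB t Et) => h; [rewrite (hr (conj Et h)) mulr0|rewrite (hp (conj Et h)) mul0r].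
Qed.

Lemma freq_poly0 a E (p : {poly R}) :
  freq F a E -> (forall t, E t -> p.[a t] = 0) -> p = 0.
Proof.
move=> hE hp; apply/eqP/negP => /negP p0; apply: (hE p p0).
by apply: filterE => t /= /hp.
Qed.

Lemma freq_nonempty a E : freq F a E -> exists t, E t.
Proof.
move=> hE; apply: contrapT => h; apply: (hE 1) (oner_neq0 _) _.
by apply: filterE => t /= Et; case: h; exists t.
Qed.

Lemma freq_affine a E (u v : R) : v != 0 -> freq F a E -> freq F (fun t => u + v * a t) E.
Proof.
move=> v0 hE p p0 Fp; apply: (hE (p \Po (u%:P + v *: 'X))).
  have sX : size (v *: 'X : {poly R}) = 2 by rewrite size_scale // size_polyX.
  by rewrite comp_poly_eq0 // addrC size_polyDl sX // ltnS size_polyC_leq1.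
by apply: filterS Fp => t /= hp Et; rewrite horner_comp !hornerE hp.
Qed.

Lemma poly_deg3_eq0 (c0 c1 c2 c3 : R) :
  c0%:P + c1 *: 'X + c2 *: 'X^2 + c3 *: 'X^3 = 0 :> {poly R} ->
  [/\ c0 = 0, c1 = 0, c2 = 0 & c3 = 0].
Proof.
move=> h; have e i : (c0%:P + c1 *: 'X + c2 *: 'X^2 + c3 *: 'X^3 : {poly R})`_i = 0.
  by rewrite h coef0.
split; [move: (e 0%N)|move: (e 1%N)|move: (e 2%N)|move: (e 3%N)];
  by rewrite !coefD !coefZ !coefC !coefX !coefXn /= ?(mulr0,mulr1,addr0,add0r).
Qed.

Lemma freq_cubic a E c0 c1 c2 c3 : freq F a E ->
  (forall t, E t -> c0 + c1 * a t + c2 * a t ^+ 2 + c3 * a t ^+ 3 = 0) ->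
  [/\ c0 = 0, c1 = 0, c2 = 0 & c3 = 0].
Proof.
move=> hE h; apply: poly_deg3_eq0; apply: (freq_poly0 hE) => t /h.
by rewrite !hornerE.
Qed.

(* Multiplicities of [r] on the two sides have different parities. *)
Lemma sqr_eq_simple_root (p q k : {poly R}) r : ~~ root k r ->
  p ^+ 2 = q ^+ 2 * (('X - r%:P) * k) -> p = 0 /\ q = 0.
Proof.
move=> kr e.
have X0 : 'X - r%:P != 0 :> {poly R} by rewrite polyXsubC_eq0.
have k0 : k != 0 by apply: contraNneq kr => ->; rewrite root0.
have [q0|q0] := eqVneq q 0.
  by split=> //; move/eqP: e; rewrite q0 expr0n /= mul0r sqrf_eq0 => /eqP.
have p0 : p != 0.
  by rewrite -sqrf_eq0 e mulf_neq0 // ?sqrf_eq0 // mulf_neq0.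
have : mup r (p ^+ 2) = mup r (q ^+ 2 * (('X - r%:P) * k)) by rewrite e.
rewrite !expr2 mupM // mupM ?mulf_neq0 // mupM // mupM //.
have := @mup_XsubCX R 1 r r; rewrite expr1 eqxx => ->.
rewrite (mupNroot kr) addn0 !addnn => /(congr1 odd).
by rewrite oddD !odd_double.
Qed.

(* Gram determinant of unit vectors with scalar products [x], [y] and the indeterminate. *)
Definition hpoly (x y : R) : {poly R} :=
  (1 - x ^+ 2 - y ^+ 2)%:P + (2 * x * y) *: 'X - 'X^2.

Lemma hpolyE x y r :
  (hpoly x y).[r] = 1 - x ^+ 2 - y ^+ 2 + 2 * x * y * r - r ^+ 2.
Proof. by rewrite /hpoly !hornerE. Qed.

(* Equality of [hpoly x y] and [hpoly x' y'], coefficientwise. *)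
Definition same_h (x y x' y' : R) :=
  x * y = x' * y' /\ x ^+ 2 + y ^+ 2 = x' ^+ 2 + y' ^+ 2.

(** The discriminant [(1 - x ^+ 2) * (1 - y ^+ 2)] is positive up to a factor, so [hpoly x y] has
    two simple roots [x * y +- s]. If one of them is not a root of the other factor, it has odd
    multiplicity in the product; if both are, the two polynomials share their roots and leading
    coefficient and coincide. *)
Lemma hpoly_indep x y x' y' (p q : {poly R}) :
  x ^+ 2 < 1 -> y ^+ 2 < 1 -> ~ same_h x y x' y' ->
  p ^+ 2 = q ^+ 2 * (hpoly x y * hpoly x' y') -> p = 0 /\ q = 0.
Proof.
move=> hx hy ns.
have D0 : 0 < (1 - x ^+ 2) * (1 - y ^+ 2) by rewrite mulr_gt0 // subr_gt0.
set s := Num.sqrt ((1 - x ^+ 2) * (1 - y ^+ 2)).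
have s0 : 0 < s by rewrite sqrtr_gt0.
have ss : s ^+ 2 = (1 - x ^+ 2) * (1 - y ^+ 2) by rewrite sqr_sqrtr // ltW.
pose r1 := x * y + s; pose r2 := x * y - s.
have fact : hpoly x y = ('X - r1%:P) * - ('X - r2%:P).
  have -> : ('X - r1%:P) * - ('X - r2%:P) = - 'X^2 + (r1 + r2)%:P * 'X - (r1 * r2)%:P.
    by move: r1 r2 => u v; rewrite polyCD polyCM; ring.
  have -> : r1 + r2 = 2 * x * y by rewrite /r1 /r2; ring.
  have -> : r1 * r2 = - (1 - x ^+ 2 - y ^+ 2).
    have -> : r1 * r2 = (x * y) ^+ 2 - s ^+ 2 by rewrite /r1 /r2; ring.
    by rewrite ss; ring.
  by rewrite /hpoly mul_polyC polyCN; ring.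
have root_s r r' : r != r' -> hpoly x y = ('X - r%:P) * - ('X - r'%:P) ->
    ~~ root (hpoly x' y') r -> p ^+ 2 = q ^+ 2 * (hpoly x y * hpoly x' y') ->
    p = 0 /\ q = 0.
  move=> nr f nroot e; apply: (@sqr_eq_simple_root p q (- ('X - r'%:P) * hpoly x' y') r).
    by rewrite mulNr rootN rootM negb_or nroot andbT root_XsubC.
  by rewrite e f; ring.
have r12 : r1 != r2 by rewrite gt_eqF // /r1 /r2; lra.
have [R1|] := boolP (root (hpoly x' y') r1); last exact: (root_s _ _ r12 fact).
have [R2|] := boolP (root (hpoly x' y') r2); last first.
  by apply: (root_s r2 r1); rewrite 1?eq_sym // fact; ring.
have Z1 : (hpoly x y).[r1] = 0 by rewrite fact !hornerE; ring.
have Z2 : (hpoly x y).[r2] = 0 by rewrite fact !hornerE; ring.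
move/eqP: R1; move/eqP: R2; move: Z1 Z2; rewrite !hpolyE => Z1 Z2 R2 R1.
(* The difference of the two polynomials is affine, and its values at [r1] and [r2] differ by a
   multiple of [s]. *)
have e : x * y = x' * y'.
  have : (x * y - x' * y') * s = 0.
    by rewrite /r1 /r2 in Z1 Z2 R1 R2; lra.
  by move/eqP; rewrite mulf_eq0 (gt_eqF s0) orbF subr_eq0 => /eqP.
by case: ns; split=> //; have := congr1 ( *%R (2 * r1)) e; lra.
Qed.

(** Moving [q] times the root to the other side and squaring removes the unknown signs of [w] and
    [w']. *)
Lemma freq_sqrt_indep a E w w' x y x' y' (p q : {poly R}) :
  freq F a E -> x ^+ 2 < 1 -> y ^+ 2 < 1 -> ~ same_h x y x' y' ->
  (forall t, w t ^+ 2 = (hpoly x y).[a t]) ->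
  (forall t, w' t ^+ 2 = (hpoly x' y').[a t]) ->
  (forall t, E t -> p.[a t] + q.[a t] * (w t * w' t) = 0) -> p = 0 /\ q = 0.
Proof.
move=> hE hx hy ns hw hw' h; apply: (hpoly_indep hx hy ns).
apply/eqP; rewrite -subr_eq0; apply/eqP; apply: (freq_poly0 hE) => t Et.
move: (hpoly x y) (hpoly x' y') hw hw' => H H' hw hw'.
rewrite hornerD hornerN !hornerM -hw -hw'.
have -> : p.[a t] = - (q.[a t] * (w t * w' t)) by apply/eqP; rewrite -addr_eq0 h.
by ring.
Qed.

Lemma hpoly_neq0 x y : hpoly x y != 0.
Proof.
apply/eqP => /(congr1 (fun p : {poly R} => p`_2)).
by rewrite /hpoly !coefD coefZ coefN coefC coefX coefXn coef0 /=; lra.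
Qed.

(** Multiplying by [hpoly x y] turns the left side into a square and the claim into
    [hpoly_indep]. *)
Lemma sqrf_mul_eq0 (p q : {poly R}) x y x' y' : 
  x ^+ 2 < 1 -> y ^+ 2 < 1 -> ~ same_h x y x' y' ->
  p ^+ 2 * hpoly x y = q ^+ 2 * hpoly x' y' -> p = 0 /\ q = 0.
Proof.
move=> hx hy ns e.
have h0 u v : hpoly u v != 0.
  apply/eqP => /(congr1 (fun p : {poly R} => p`_2)).
  rewrite /hpoly !coefD coefZ coefN coefC coefX coefXn coef0 /=; lra.
have [] := @hpoly_indep x y x' y' (p * hpoly x y) q hx hy ns.
  by rewrite exprMn expr2 [hpoly x y ^+ 2]expr2 !mulrA -expr2 e; ring.
move=> /eqP; rewrite mulf_eq0 (negbTE (hpoly_neq0 _ _)) orbF => /eqP p0 q0.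
by split.
Qed.

(** Writing the relation as [A + B w1 w2 = - w3 (C w1 + D w2)] and squaring leaves only the root
    [w1 w2], whose two coefficients vanish by [freq_sqrt_indep]. The resulting equations [e1] and
    [e2] combine to a product equal to zero, each factor of which falls under [hpoly_indep]. *)
Lemma freq_sqrt_indep3 a E (w1 w2 w3 : T -> R) x1 y1 x2 y2 x3 y3
    (A B C D : {poly R}) :
  freq F a E -> 
  x1 ^+ 2 < 1 -> y1 ^+ 2 < 1 -> x2 ^+ 2 < 1 -> y2 ^+ 2 < 1 ->
  ~ same_h x1 y1 x2 y2 -> ~ same_h x1 y1 x3 y3 -> ~ same_h x2 y2 x3 y3 ->
  (forall t, w1 t ^+ 2 = (hpoly x1 y1).[a t]) ->
  (forall t, w2 t ^+ 2 = (hpoly x2 y2).[a t]) ->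
  (forall t, w3 t ^+ 2 = (hpoly x3 y3).[a t]) ->
  (forall t, E t -> A.[a t] + B.[a t] * (w1 t * w2 t) + C.[a t] * (w1 t * w3 t)
      + D.[a t] * (w2 t * w3 t) = 0) ->
  [/\ B = 0, C = 0 & D = 0].
Proof.
move=> hE hx1 hy1 hx2 hy2 n12 n13 n23 h1 h2 h3 h.
set H1 := hpoly x1 y1 in h1 *; set H2 := hpoly x2 y2 in h2 *; set H3 := hpoly x3 y3 in h3 *.
have [] := @freq_sqrt_indep a E w1 w2 x1 y1 x2 y2
  (A ^+ 2 + B ^+ 2 * (H1 * H2) - H3 * (C ^+ 2 * H1 + D ^+ 2 * H2))
  (2%:P * (A * B - H3 * C * D)) hE hx1 hy1 n12 h1 h2.
  move=> t Et; have := h t Et.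
  move: H1 H2 H3 h1 h2 h3 => H1 H2 H3 h1 h2 h3.
  rewrite !(hornerD, hornerN, hornerM, hornerC) -h1 -h2 -h3 => e.
  have -> : A.[a t] = - (B.[a t] * (w1 t * w2 t) + C.[a t] * (w1 t * w3 t)
      + D.[a t] * (w2 t * w3 t)) by lra.
  by ring.
move=> e1 /eqP; rewrite mulf_eq0 polyC_eq0 pnatr_eq0 /= subr_eq0 => /eqP e2.
have : (A ^+ 2 - C ^+ 2 * (H1 * H3)) * (A ^+ 2 - D ^+ 2 * (H2 * H3)) = 0.
  have -> : (A ^+ 2 - C ^+ 2 * (H1 * H3)) * (A ^+ 2 - D ^+ 2 * (H2 * H3)) =
     A ^+ 2 * (A ^+ 2 + B ^+ 2 * (H1 * H2) - H3 * (C ^+ 2 * H1 + D ^+ 2 * H2))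
     - (H1 * H2) * ((A * B) ^+ 2 - (H3 * C * D) ^+ 2) by ring.
  by rewrite e1 e2; ring.
move/eqP; rewrite mulf_eq0 => /orP[]; rewrite subr_eq0 => /eqP e3.
  have [A0 C0] := hpoly_indep hx1 hy1 n13 e3.
  have [] := @sqrf_mul_eq0 B D x1 y1 x3 y3 hx1 hy1 n13; last by move=> -> ->.
  apply: (mulfI (hpoly_neq0 x2 y2)); move: e1; rewrite A0 C0 -/H1 -/H2 -/H3 => e1.
  by apply/eqP; rewrite -subr_eq0 -[X in _ == X]e1; apply/eqP; ring.
have [A0 D0] := hpoly_indep hx2 hy2 n23 e3.
have [] := @sqrf_mul_eq0 B C x2 y2 x3 y3 hx2 hy2 n23; last by move=> -> ->.
apply: (mulfI (hpoly_neq0 x1 y1)); move: e1; rewrite A0 D0 -/H1 -/H2 -/H3 => e1.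
by apply/eqP; rewrite -subr_eq0 -[X in _ == X]e1; apply/eqP; ring.
Qed.

End Freq.

(** * The closing condition of a flexible (3, 3)-framework *)

Section Forms.
Variable R : rcfType.
Implicit Types x y z w a b c : R.

Definition det9 (x1 y1 z1 x2 y2 z2 x3 y3 z3 : R) : R :=
  x1 * (y2 * z3 - z2 * y3) + y1 * (z2 * x3 - x2 * z3) + z1 * (x2 * y3 - y2 * x3).

(** The determinant with columns [w], [u], [v], that is, a numerator of Cramer's rule. *)
Definition wcof (w1 w2 w3 u1 v1 u2 v2 u3 v3 : R) : R :=
  w1 * (u2 * v3 - v2 * u3) + w2 * (u3 * v1 - v3 * u1) + w3 * (u1 * v2 - v1 * u2).

(* Here [a], [b], [c] are the scalar products of [P1, P2], [P1, P3], [P2, P3],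
   [(x_j, y_j, z_j)] those of [Q_j] with the [P_i], and [w_j = det(P1, P2, Q_j)]. Solving the
   linear equations of [closing_of_lin] by Cramer's rule for [b - a c], [c - a b] and
   [om = det(P1, P2, P3)] and writing that [P3] is a unit vector eliminates [b], [c], [om]. *)
Definition closing (a x1 y1 z1 x2 y2 z2 x3 y3 z3 w1 w2 w3 : R) : Prop :=
  wcof w1 w2 w3 y1 z1 y2 z2 y3 z3 ^+ 2 + wcof w1 w2 w3 z1 x1 z2 x2 z3 x3 ^+ 2
  + 2 * a * (wcof w1 w2 w3 y1 z1 y2 z2 y3 z3 * wcof w1 w2 w3 z1 x1 z2 x2 z3 x3)
  - wcof w1 w2 w3 x1 y1 x2 y2 x3 y3 ^+ 2
  + (1 - a ^+ 2) * det9 x1 y1 z1 x2 y2 z2 x3 y3 z3 ^+ 2 = 0.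

Lemma closing_of_lin a b c om x1 y1 z1 x2 y2 z2 x3 y3 z3 w1 w2 w3 :
  1 - a ^+ 2 != 0 ->
  x1 * (b - a * c) + y1 * (c - a * b) + w1 * om = (1 - a ^+ 2) * z1 ->
  x2 * (b - a * c) + y2 * (c - a * b) + w2 * om = (1 - a ^+ 2) * z2 ->
  x3 * (b - a * c) + y3 * (c - a * b) + w3 * om = (1 - a ^+ 2) * z3 ->
  om ^+ 2 = 1 - a ^+ 2 - b ^+ 2 - c ^+ 2 + 2 * a * b * c ->
  closing a x1 y1 z1 x2 y2 z2 x3 y3 z3 w1 w2 w3.
Proof.
move=> a0 l1 l2 l3 hom.
set V1 := wcof w1 w2 w3 y1 z1 y2 z2 y3 z3.
set V2 := wcof w1 w2 w3 z1 x1 z2 x2 z3 x3.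
set V3 := wcof w1 w2 w3 x1 y1 x2 y2 x3 y3.
set dl := det9 x1 y1 z1 x2 y2 z2 x3 y3 z3.
(* Cramer's rule is kept in multiplied form because [V3] may vanish. *)
have e1 : V3 * (b - a * c) = - ((1 - a ^+ 2) * V1).
  have := congr1 ( *%R (y2 * w3 - w2 * y3)) l1.
  have := congr1 ( *%R (y3 * w1 - w3 * y1)) l2.
  have := congr1 ( *%R (y1 * w2 - w1 * y2)) l3.
  by rewrite /V1 /V3 /wcof; clear; lra.
have e2 : V3 * (c - a * b) = - ((1 - a ^+ 2) * V2).
  have := congr1 ( *%R (w2 * x3 - x2 * w3)) l1.
  have := congr1 ( *%R (w3 * x1 - x3 * w1)) l2.
  have := congr1 ( *%R (w1 * x2 - x1 * w2)) l3.
  by rewrite /V2 /V3 /wcof; clear; lra.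
have e3 : V3 * om = (1 - a ^+ 2) * dl.
  have := congr1 ( *%R (x2 * y3 - y2 * x3)) l1.
  have := congr1 ( *%R (x3 * y1 - y3 * x1)) l2.
  have := congr1 ( *%R (x1 * y2 - y1 * x2)) l3.
  by rewrite /V3 /dl /wcof /det9; clear; lra.
apply: (mulfI (mulf_neq0 a0 a0)); rewrite mulr0 -/V1 -/V2 -/V3 -/dl.
have -> : (1 - a ^+ 2) * (1 - a ^+ 2) * (V1 ^+ 2 + V2 ^+ 2 + 2 * a * (V1 * V2)
      - V3 ^+ 2 + (1 - a ^+ 2) * dl ^+ 2) =
   (- ((1 - a ^+ 2) * V1)) ^+ 2 + (- ((1 - a ^+ 2) * V2)) ^+ 2
   + 2 * a * (- ((1 - a ^+ 2) * V1)) * (- ((1 - a ^+ 2) * V2))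
   - (1 - a ^+ 2) ^+ 2 * V3 ^+ 2 + (1 - a ^+ 2) * ((1 - a ^+ 2) * dl) ^+ 2 by ring.
rewrite -e1 -e2 -e3 [(V3 * om) ^+ 2]exprMn hom; ring.
Qed.

(** Passing to the antipode of [Q2] multiplies every determinant by [e], and [closing] is quadratic
    in them. *)
Lemma closing_opp a x1 y1 z1 x2 y2 z2 x3 y3 z3 w1 w2 w3 e :
  e * e = 1 ->
  closing a x1 y1 z1 x2 y2 z2 x3 y3 z3 w1 w2 w3 ->
  closing a x1 y1 z1 (e * x2) (e * y2) (e * z2) x3 y3 z3 w1 (e * w2) w3.
Proof.
rewrite /closing /wcof /det9 => ee h.
rewrite -[RHS](mulr0 (e * e)) -{}h; ring.
Qed.

End Forms.

Section K33.
Variables (R : rcfType) (T : Type) (F : set_system T) (FF : Filter F).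
Implicit Types (a w : T -> R) (E : set T) (x y z : R).

(* If [w2 = e w1], then [closing] has the form [p(a) + q(a) w1 w3 = 0], so [p = q = 0]. *)
Lemma closing_two a E w1 w2 w3 e x1 y1 z1 x2 y2 z2 x3 y3 z3
  (G1 := (y2 * z3 - z2 * y3) + e * (y3 * z1 - z3 * y1))
  (G2 := (z2 * x3 - x2 * z3) + e * (z3 * x1 - x3 * z1))
  (G3 := (x2 * y3 - y2 * x3) + e * (x3 * y1 - y3 * x1))
  (N1 := y1 * z2 - z1 * y2) (N2 := z1 * x2 - x1 * z2) (N3 := x1 * y2 - y1 * x2)
  (gA := G1 ^+ 2 + G2 ^+ 2 - G3 ^+ 2) (gB := 2 * G1 * G2)
  (nA := N1 ^+ 2 + N2 ^+ 2 - N3 ^+ 2) (nB := 2 * N1 * N2)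
  (d2 := det9 x1 y1 z1 x2 y2 z2 x3 y3 z3 ^+ 2) :
  freq F a E -> x1 ^+ 2 < 1 -> y1 ^+ 2 < 1 -> ~ same_h x1 y1 x3 y3 ->
  (forall t, w1 t ^+ 2 = (hpoly x1 y1).[a t]) ->
  (forall t, w3 t ^+ 2 = (hpoly x3 y3).[a t]) ->
  (forall t, E t -> closing (a t) x1 y1 z1 x2 y2 z2 x3 y3 z3 (w1 t) (w2 t) (w3 t)) ->
  (forall t, E t -> w2 t = e * w1 t) ->
  [/\ G1 * N1 + G2 * N2 - G3 * N3 = 0, G1 * N2 + G2 * N1 = 0 &
   [/\ gA * (1 - x1 ^+ 2 - y1 ^+ 2) + nA * (1 - x3 ^+ 2 - y3 ^+ 2) + d2 = 0,
       gA * (2 * x1 * y1) + gB * (1 - x1 ^+ 2 - y1 ^+ 2) +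
       nA * (2 * x3 * y3) + nB * (1 - x3 ^+ 2 - y3 ^+ 2) = 0,
       - gA + gB * (2 * x1 * y1) - nA + nB * (2 * x3 * y3) - d2 = 0 &
       - gB - nB = 0]].
Proof.
move=> hE hx hy ns h1 h3 hc he.
(* Each [wcof] equals [w1 G_k + w3 N_k]: the squares [w1 ^+ 2] and [w3 ^+ 2] become polynomials in
   [a] and go to [P], the mixed terms give [Q]. *)
pose P : {poly R} := (gA%:P + gB *: 'X) * hpoly x1 y1 + (nA%:P + nB *: 'X) * hpoly x3 y3
  + d2 *: (1 - 'X^2).
pose Q : {poly R} := (2 * (G1 * N1 + G2 * N2 - G3 * N3))%:P + (2 * (G1 * N2 + G2 * N1)) *: 'X.
have PE r : P.[r] = (gA + gB * r) * (hpoly x1 y1).[r] + (nA + nB * r) * (hpoly x3 y3).[r]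
   + d2 * (1 - r ^+ 2).
  by rewrite /P !(hornerE, hornerM).
have QE r : Q.[r] = 2 * (G1 * N1 + G2 * N2 - G3 * N3) + 2 * (G1 * N2 + G2 * N1) * r.
  by rewrite /Q !hornerE.
have [] := @freq_sqrt_indep R T F FF a E w1 w3 x1 y1 x3 y3 P Q hE hx hy ns h1 h3.
  move=> t Et; rewrite PE QE -h1 -h3; have := hc t Et; rewrite (he t Et) => <-.
  by rewrite /gA /gB /nA /nB /G1 /G2 /G3 /N1 /N2 /N3 /d2 /wcof; ring.
move=> P0 Q0.
have [q0 q1 _ _] : [/\ 2 * (G1 * N1 + G2 * N2 - G3 * N3) = 0,
   2 * (G1 * N2 + G2 * N1) = 0, 0 = 0 :> R & 0 = 0 :> R].
  by apply: poly_deg3_eq0; rewrite !scale0r !addr0.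
have [] := @freq_cubic R T F FF a E
  (gA * (1 - x1 ^+ 2 - y1 ^+ 2) + nA * (1 - x3 ^+ 2 - y3 ^+ 2) + d2)
  (gA * (2 * x1 * y1) + gB * (1 - x1 ^+ 2 - y1 ^+ 2) +
       nA * (2 * x3 * y3) + nB * (1 - x3 ^+ 2 - y3 ^+ 2))
  (- gA + gB * (2 * x1 * y1) - nA + nB * (2 * x3 * y3) - d2)
  (- gB - nB) hE.
  move=> t Et; have := PE (a t); rewrite P0 horner0 !hpolyE => ->.
  move: gA gB nA nB d2 {P PE Q QE P0 Q0 q0 q1} => gA gB nA nB d2; ring.
move=> p0 p1 p2 p3; split; [lra|lra|by split].
Qed.

End K33.

(** * The coefficient equations when two of the polynomials [h_j] coincide *)

Section Numeric.
Variable R : rcfType.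
Implicit Types x y z : R.

Lemma mulf_eq0_right (x y : R) : x * y = 0 -> x != 0 -> y = 0.
Proof. by move=> /eqP; rewrite mulf_eq0 => /orP[/eqP->|/eqP//]; rewrite eqxx. Qed.

(* [Q1] and [Q2] are symmetric with respect to the plane of [P1], [P2]. *)
Lemma mirror_case x y z1 z2 x3 y3 z3
  (G1 := (y * z3 - z2 * y3) + - 1 * (y3 * z1 - z3 * y))
  (G2 := (z2 * x3 - x * z3) + - 1 * (z3 * x - x3 * z1))
  (G3 := (x * y3 - y * x3) + - 1 * (x3 * y - y3 * x))
  (N1 := y * z2 - z1 * y) (N2 := z1 * x - x * z2) (N3 := x * y - y * x)
  (gA := G1 ^+ 2 + G2 ^+ 2 - G3 ^+ 2) (gB := 2 * G1 * G2)
  (nA := N1 ^+ 2 + N2 ^+ 2 - N3 ^+ 2) (nB := 2 * N1 * N2)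
  (dl := det9 x y z1 x y z2 x3 y3 z3) (d2 := dl ^+ 2) :
  dl != 0 -> x ^+ 2 != y ^+ 2 ->
  G1 * N1 + G2 * N2 - G3 * N3 = 0 -> G1 * N2 + G2 * N1 = 0 ->
  gA * (1 - x ^+ 2 - y ^+ 2) + nA * (1 - x3 ^+ 2 - y3 ^+ 2) + d2 = 0 ->
  gA * (2 * x * y) + gB * (1 - x ^+ 2 - y ^+ 2) +
       nA * (2 * x3 * y3) + nB * (1 - x3 ^+ 2 - y3 ^+ 2) = 0 ->
  - gA + gB * (2 * x * y) - nA + nB * (2 * x3 * y3) - d2 = 0 ->
  - gB - nB = 0 ->
  [/\ z2 = - z1, z3 = 0 &
    [/\ y = 0, x3 = 0 & x ^+ 2 = z1 ^+ 2] \/ [/\ x = 0, y3 = 0 & y ^+ 2 = z1 ^+ 2]].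
Proof.
move=> dl0 xy q0 q1 p0 p1 p2 p3.
pose e := z2 - z1.
have dlE : dl = e * (y * x3 - x * y3) by rewrite /dl /det9 /e; ring.
move: (dl0); rewrite dlE mulf_eq0 negb_or => /andP[e0 D0].
(* As [(N1, N2, N3) = (e y, - e x, 0)], the relations [q0] and [q1] form a homogeneous system for
   [G1], [G2] with determinant [x ^+ 2 - y ^+ 2] up to sign. *)
have a1 : G1 * y - G2 * x = 0.
  apply: mulf_eq0_right e0; rewrite -[RHS]q0 /N1 /N2 /N3 /e; ring.
have a2 : G2 * y - G1 * x = 0.
  apply: mulf_eq0_right e0; rewrite -[RHS]q1 /N1 /N2 /N3 /e; ring.
have xy0 : y ^+ 2 - x ^+ 2 != 0 by rewrite subr_eq0 eq_sym.
have g1 : G1 = 0.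
  apply: mulf_eq0_right xy0; have := congr1 ( *%R y) a1; have := congr1 ( *%R x) a2.
  by move: G1 G2 {q0 q1 p0 p1 p2 p3 gA gB a1 a2} => G1 G2; lra.
have g2 : G2 = 0.
  apply: mulf_eq0_right xy0; have := congr1 ( *%R x) a1; have := congr1 ( *%R y) a2.
  by move: G1 G2 {q0 q1 p0 p1 p2 p3 gA gB a1 a2 g1} => G1 G2; lra.
have Z : z1 + z2 = 0.
  apply: mulf_eq0_right D0; have := congr1 ( *%R x) g1; have := congr1 ( *%R y) g2.
  by rewrite /G1 /G2; clear; lra.
have z2E : z2 = - z1 by lra.
have z3y : y * z3 = 0.
  have -> : y * z3 = 2^-1 * (G1 + y3 * (z1 + z2)) by rewrite /G1; field.
  by rewrite g1 Z; ring.
have z3x : x * z3 = 0.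
  have -> : x * z3 = - 2^-1 * (G2 - x3 * (z1 + z2)) by rewrite /G2; field.
  by rewrite g2 Z; ring.
have z30 : z3 = 0.
  move/eqP: z3y; rewrite mulf_eq0 => /orP[/eqP y0|/eqP//].
  move/eqP: z3x; rewrite mulf_eq0 => /orP[/eqP x0|/eqP//].
  by move: xy; rewrite x0 y0 eqxx.
have gBE : gB = 0 by rewrite /gB g1; ring.
have gAE : gA = - (2 * (x * y3 - y * x3)) ^+ 2 by rewrite /gA g1 g2 /G3; ring.
have nAE : nA = 4 * z1 ^+ 2 * (x ^+ 2 + y ^+ 2) by rewrite /nA /N1 /N2 /N3 z2E; ring.
have nBE : nB = - 8 * z1 ^+ 2 * (x * y) by rewrite /nB /N1 /N2 z2E; ring.
have d2E : d2 = 4 * z1 ^+ 2 * (x * y3 - y * x3) ^+ 2 by rewrite /d2 dlE /e z2E; ring.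
have z10 : z1 != 0 by apply: contraNneq e0 => z10; rewrite /e z2E z10 oppr0 addr0.
have xy1 : x * y = 0.
  move: p3; rewrite gBE nBE => p3; apply/eqP.
  have : z1 ^+ 2 * (x * y) = 0 by lra.
  by move/eqP; rewrite mulf_eq0 sqrf_eq0 (negbTE z10).
split=> //; move: p0 p1 p2 {p3}; rewrite gAE gBE nAE nBE d2E.
move: D0 xy; clear - xy1 z10.
move/eqP: xy1; rewrite mulf_eq0 => /orP[]/eqP -> => D0 xy p0 p1 p2; [right|left].
  have y0 : y != 0 by apply: contraNneq xy => ->.
  have x30 : x3 != 0 by apply: contraNneq D0 => ->; rewrite mulr0 mul0r subrr.
  have y30 : y3 = 0.
    have : (z1 * y) ^+ 2 * x3 * y3 = 0 by lra.
    by move/eqP; rewrite !mulf_eq0 !orbb (negbTE z10) (negbTE y0) (negbTE x30) => /eqP.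
  split=> //; rewrite y30 in p0 p2.
  have e1 : x3 ^+ 2 = z1 ^+ 2 + z1 ^+ 2 * x3 ^+ 2.
    have : y ^+ 2 * (x3 ^+ 2 - z1 ^+ 2 - z1 ^+ 2 * x3 ^+ 2) = 0 by lra.
    by move/eqP; rewrite mulf_eq0 sqrf_eq0 (negbTE y0) /= => /eqP; lra.
  have e2 : z1 ^+ 2 = x3 ^+ 2 * (1 - y ^+ 2).
    have : y ^+ 2 * (z1 ^+ 2 - x3 ^+ 2 * (1 - y ^+ 2)) = 0 by lra.
    by move/eqP; rewrite mulf_eq0 sqrf_eq0 (negbTE y0) /= => /eqP; lra.
  have : x3 ^+ 2 * (y ^+ 2 - z1 ^+ 2) = 0 by lra.
  by move/eqP; rewrite mulf_eq0 sqrf_eq0 (negbTE x30) /= => /eqP; lra.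
have x0 : x != 0 by apply: contraNneq xy => ->.
have y30 : y3 != 0 by apply: contraNneq D0 => ->; rewrite mulr0 mul0r subrr.
have x30 : x3 = 0.
  have : (z1 * x) ^+ 2 * y3 * x3 = 0 by lra.
  by move/eqP; rewrite !mulf_eq0 !orbb (negbTE z10) (negbTE x0) (negbTE y30) => /eqP.
split=> //; rewrite x30 in p0 p2.
have e1 : y3 ^+ 2 = z1 ^+ 2 + z1 ^+ 2 * y3 ^+ 2.
  have : x ^+ 2 * (y3 ^+ 2 - z1 ^+ 2 - z1 ^+ 2 * y3 ^+ 2) = 0 by lra.
  by move/eqP; rewrite mulf_eq0 sqrf_eq0 (negbTE x0) /= => /eqP; lra.
have e2 : z1 ^+ 2 = y3 ^+ 2 * (1 - x ^+ 2).
  have : x ^+ 2 * (z1 ^+ 2 - y3 ^+ 2 * (1 - x ^+ 2)) = 0 by lra.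
  by move/eqP; rewrite mulf_eq0 sqrf_eq0 (negbTE x0) /= => /eqP; lra.
have : y3 ^+ 2 * (x ^+ 2 - z1 ^+ 2) = 0 by lra.
by move/eqP; rewrite mulf_eq0 sqrf_eq0 (negbTE y30) /= => /eqP; lra.
Qed.

(* [swap_case] in the coordinates [s = x + y], [d = x - y], [s' = z1 + z2], [ze = (z1 - z2) / d],
   [s3 = x3 + y3], [d3 = x3 - y3], [w = 2 z3 - ze d3], where the two subcases become symmetric. *)
Lemma swap_case_half (s d s' ze s3 d3 w : R)
  (x := (s + d) / 2) (y := (s - d) / 2) (z1 := (s' + d * ze) / 2)
  (z2 := (s' - d * ze) / 2)
  (x3 := (s3 + d3) / 2) (y3 := (s3 - d3) / 2) (z3 := (w + ze * d3) / 2)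
  (gA := (w ^+ 2 + ze ^+ 2 * s3 ^+ 2) / 2 - s3 ^+ 2)
  (gB := (w ^+ 2 - ze ^+ 2 * s3 ^+ 2) / 2)
  (nA := (s' ^+ 2 + ze ^+ 2 * s ^+ 2) / 2 - s ^+ 2)
  (nB := (s' ^+ 2 - ze ^+ 2 * s ^+ 2) / 2)
  (d2 := ((s * w - s' * s3) / 2) ^+ 2) :
  s = 0 -> w = 0 -> s3 != 0 -> d ^+ 2 < 4 ->
  gA * (1 - x ^+ 2 - y ^+ 2) + nA * (1 - x3 ^+ 2 - y3 ^+ 2) + d2 = 0 ->
  gA * (2 * x * y) + gB * (1 - x ^+ 2 - y ^+ 2) +
       nA * (2 * x3 * y3) + nB * (1 - x3 ^+ 2 - y3 ^+ 2) = 0 ->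
  - gA + gB * (2 * x * y) - nA + nB * (2 * x3 * y3) - d2 = 0 ->
  - gB - nB = 0 ->
  ze ^+ 2 = 1.
Proof.
rewrite /x /y /x3 /y3 /gA /gB /nA /nB /d2 => -> -> s30 d4 p0 p1 p2 p3.
have E1 : s' ^+ 2 = ze ^+ 2 * s3 ^+ 2 by lra.
have S0 : s3 ^+ 2 != 0 by rewrite sqrf_eq0.
have E2 : d ^+ 2 = ze ^+ 2 * d3 ^+ 2.
  apply: (mulfI S0).
  have := congr1 ( *%R (d3 ^+ 2)) E1; have := congr1 ( *%R (d ^+ 2)) E1; lra.
have E3 : (ze ^+ 2 - 1) * (1 - d ^+ 2 / 4) = 0.
  apply: (mulf_eq0_right _ S0).
  have := congr1 ( *%R (d3 ^+ 2)) E1; have := congr1 ( *%R (d ^+ 2)) E1.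
  have := congr1 ( *%R (s3 ^+ 2)) E2; have := congr1 ( *%R (s3 ^+ 2 * ze ^+ 2)) E2.
  lra.
have : 1 - d ^+ 2 / 4 != 0 by apply: lt0r_neq0; lra.
by move=> h; move: E3; rewrite mulrC => /mulf_eq0_right /(_ h); lra.
Qed.



(* [Q1 - Q2] lies in the plane of [P1], [P2] and is proportional to [P1 - P2]. *)
Lemma swap_case x y z1 z2 x3 y3 z3
  (G1 := (x * z3 - z2 * y3) + 1 * (y3 * z1 - z3 * y))
  (G2 := (z2 * x3 - y * z3) + 1 * (z3 * x - x3 * z1))
  (G3 := (y * y3 - x * x3) + 1 * (x3 * y - y3 * x))
  (N1 := y * z2 - z1 * x) (N2 := z1 * y - x * z2) (N3 := x * x - y * y)
  (gA := G1 ^+ 2 + G2 ^+ 2 - G3 ^+ 2) (gB := 2 * G1 * G2)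
  (nA := N1 ^+ 2 + N2 ^+ 2 - N3 ^+ 2) (nB := 2 * N1 * N2)
  (dl := det9 x y z1 y x z2 x3 y3 z3) (d2 := dl ^+ 2) :
  dl != 0 -> x != y -> x ^+ 2 < 1 -> x3 ^+ 2 < 1 ->
  G1 * N1 + G2 * N2 - G3 * N3 = 0 -> G1 * N2 + G2 * N1 = 0 ->
  gA * (1 - x ^+ 2 - y ^+ 2) + nA * (1 - x3 ^+ 2 - y3 ^+ 2) + d2 = 0 ->
  gA * (2 * x * y) + gB * (1 - x ^+ 2 - y ^+ 2) +
       nA * (2 * x3 * y3) + nB * (1 - x3 ^+ 2 - y3 ^+ 2) = 0 ->
  - gA + gB * (2 * x * y) - nA + nB * (2 * x3 * y3) - d2 = 0 ->
  - gB - nB = 0 ->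
  (z1 - z2) ^+ 2 = (x - y) ^+ 2.
Proof.
move=> dl0 xy hx hx3 q0 q1 p0 p1 p2 p3.
pose d := x - y; have d0 : d != 0 by rewrite subr_eq0.
pose s := x + y; pose s' := z1 + z2; pose ze := (z1 - z2) / d.
pose s3 := x3 + y3; pose d3 := x3 - y3; pose w := 2 * z3 - ze * d3.
have xE : x = (s + d) / 2 by rewrite /s /d; field.
have yE : y = (s - d) / 2 by rewrite /s /d; field.
have x3E : x3 = (s3 + d3) / 2 by rewrite /s3 /d3; field.
have y3E : y3 = (s3 - d3) / 2 by rewrite /s3 /d3; field.
have zed : d * ze = z1 - z2 by rewrite /ze mulrCA mulfV // mulr1.
have z1E : z1 = (s' + d * ze) / 2 by rewrite zed /s'; field.
have z2E : z2 = (s' - d * ze) / 2 by rewrite zed /s'; field.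
have z3E : z3 = (w + ze * d3) / 2 by rewrite /w; field.
rewrite -[z1 - z2]zed -/d exprMn.
suff ze1 : ze ^+ 2 = 1 by rewrite ze1 mulr1.
move: p0 p1 p2 p3; move: s d s' ze s3 d3 w d0 xE yE x3E y3E z1E z2E z3E {zed}.
rewrite /gA /gB /nA /nB /d2 {gA gB nA nB d2}.
move=> s d s' ze s3 d3 w d0 xE yE x3E y3E z1E z2E z3E p0 p1 p2 p3.
have G1E : G1 = d * ((w + ze * s3) / 2) by rewrite /G1 ?xE ?yE ?z1E ?z2E ?x3E ?y3E ?z3E; field.
have G2E : G2 = d * ((w - ze * s3) / 2) by rewrite /G2 ?xE ?yE ?z1E ?z2E ?x3E ?y3E ?z3E; field.
have G3E : G3 = - (d * s3) by rewrite /G3 ?xE ?yE ?x3E ?y3E; field.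
have N1E : N1 = - (d * ((s' + ze * s) / 2)) by rewrite /N1 ?xE ?yE ?z1E ?z2E; field.
have N2E : N2 = - (d * ((s' - ze * s) / 2)) by rewrite /N2 ?xE ?yE ?z1E ?z2E; field.
have N3E : N3 = d * s by rewrite /N3 ?xE ?yE; field.
have dlE : dl = d * ((s * w - s' * s3) / 2).
  by rewrite /dl /det9 ?xE ?yE ?z1E ?z2E ?x3E ?y3E ?z3E; field.
have D0 : d * d != 0 by rewrite mulf_neq0.
have e1 : s' * w = ze ^+ 2 * (s * s3).
  have : d * d * (s' * w - ze ^+ 2 * (s * s3)) = 0.
    by move: q1; rewrite G1E G2E N1E N2E; clear; lra.
  by move/mulf_eq0_right/(_ D0); lra.
have e2 : s' * w = s * s3.
  have : d * d * (2 * (s * s3) - (s' * w + ze ^+ 2 * (s * s3))) = 0.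
    by move: q0; rewrite G1E G2E G3E N1E N2E N3E; clear; lra.
  by move/mulf_eq0_right/(_ D0); lra.
(* If [ze ^+ 2] is not 1, then [s] or [s3] vanishes; since the determinant does not, the two
   subcases exclude each other. *)
have e3 : s * s3 * (ze ^+ 2 - 1) = 0 by rewrite mulrBr mulrC -e1 e2; ring.
apply/eqP; apply: contraT => ze1.
have zz : ze ^+ 2 - 1 != 0 by rewrite subr_eq0.
have ss3 : s * s3 = 0 by apply: mulf_eq0_right zz; rewrite mulrC.
have s'w : s' * w = 0 by rewrite e2.
have dd : s * w - s' * s3 != 0.
  by apply: contraNneq dl0 => h; rewrite dlE h mul0r mulr0.
move: p0 p1 p2 p3; rewrite dlE G1E G2E G3E N1E N2E N3E.
rewrite {dlE G1E G2E G3E N1E N2E N3E q0 q1 dl0 G1 G2 G3 N1 N2 N3 dl}.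
have cancel (u : R) : d * d * u = 0 -> u = 0 by move=> /mulf_eq0_right; apply.
have [s0|s0] := eqVneq s 0.
  have s30 : s3 != 0 by apply: contraNneq dd => ->; rewrite s0 mul0r mulr0 subrr.
  have s'0 : s' != 0 by apply: contraNneq dd => ->; rewrite s0 !mul0r subrr.
  have w0 : w = 0 by apply: mulf_eq0_right s'0.
  have d4 : d ^+ 2 < 4 by move: hx; rewrite xE s0; lra.
  move=> p0 p1 p2 p3.
  rewrite -(@swap_case_half s d s' ze s3 d3 w s0 w0 s30 d4) ?eqxx // ?negbK // in ze1 *.
  - by apply: cancel; rewrite -[RHS]p0 ?xE ?yE ?x3E ?y3E; field.
  - by apply: cancel; rewrite -[RHS]p1 ?xE ?yE ?x3E ?y3E; field.
  - by apply: cancel; rewrite -[RHS]p2 ?xE ?yE ?x3E ?y3E; field.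
  - by apply: cancel; rewrite -[RHS]p3; field.
have s30 : s3 = 0 by apply: mulf_eq0_right s0.
have w0 : w != 0 by apply: contraNneq dd => ->; rewrite s30 !mulr0 subrr.
have s'0 : s' = 0 by apply: mulf_eq0_right w0; rewrite mulrC.
have d4 : d3 ^+ 2 < 4 by move: hx3; rewrite x3E s30; lra.
move=> p0 p1 p2 p3.
(* Exchanging [(s, d, s')] with [(s3, d3, w)] exchanges the coefficients [gA], [gB] with [nA], [nB]
   and preserves [d2], so the first subcase applies again. *)
rewrite -(@swap_case_half s3 d3 w ze s d s' s30 s'0 s0 d4) ?eqxx // in ze1 *.
- by apply: cancel; rewrite -[RHS]p0 ?xE ?yE ?x3E ?y3E; field.
- by apply: cancel; rewrite -[RHS]p1 ?xE ?yE ?x3E ?y3E; field.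
- by apply: cancel; rewrite -[RHS]p2 ?xE ?yE ?x3E ?y3E; field.
- by apply: cancel; rewrite -[RHS]p3; field.
Qed.

End Numeric.

(** * The coefficient equations when the polynomials [h_j] are distinct *)

Section IsolatedColumn.
Variable R : rcfType.
Implicit Types x y z : R.

(* The column [1] of the cofactor matrix is supported on its last entry. *)
Lemma isolated_column x1 y1 z1 x2 y2 z2 x3 y3 z3
  (U1 := y2 * z3 - z2 * y3) (V1 := z2 * x3 - x2 * z3) (W1 := x2 * y3 - y2 * x3)
  (U2 := y3 * z1 - z3 * y1) (V2 := z3 * x1 - x3 * z1) (W2 := x3 * y1 - y3 * x1)
  (U3 := y1 * z2 - z1 * y2) (V3 := z1 * x2 - x1 * z2) (W3 := x1 * y2 - y1 * x2) :
  det9 x1 y1 z1 x2 y2 z2 x3 y3 z3 != 0 ->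
  U1 = 0 -> V1 = 0 ->
  U1 * U2 + V1 * V2 - W1 * W2 = 0 -> U1 * U3 + V1 * V3 - W1 * W3 = 0 ->
  U2 * U3 + V2 * V3 - W2 * W3 = 0 -> U2 * V3 + U3 * V2 = 0 ->
  (U1 ^+ 2 + V1 ^+ 2 - W1 ^+ 2) * (2 * x1 * y1) + 2 * U1 * V1 * (1 - x1 ^+ 2 - y1 ^+ 2)
  + (U2 ^+ 2 + V2 ^+ 2 - W2 ^+ 2) * (2 * x2 * y2) + 2 * U2 * V2 * (1 - x2 ^+ 2 - y2 ^+ 2)
  + (U3 ^+ 2 + V3 ^+ 2 - W3 ^+ 2) * (2 * x3 * y3) + 2 * U3 * V3 * (1 - x3 ^+ 2 - y3 ^+ 2) = 0 ->
  - (2 * U1 * V1) - 2 * U2 * V2 - 2 * U3 * V3 = 0 ->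
  [/\ x1 = 0, y1 = 0, z2 = 0 & z3 = 0] /\
  [/\ x2 ^+ 2 = y2 ^+ 2, x2 ^+ 2 = x3 ^+ 2, x3 ^+ 2 = y3 ^+ 2 & x2 * y2 = - (x3 * y3)].
Proof.
move=> dl0 u1 v1 m12 m13 m23 n23 p1 p3.
have dlE : det9 x1 y1 z1 x2 y2 z2 x3 y3 z3 = z1 * W1.
  by rewrite /det9 -/U1 -/V1 -/W1 u1 v1; ring.
move: (dl0); rewrite dlE mulf_eq0 negb_or => /andP[z10 W10].
have w2 : W2 = 0 by apply: mulf_eq0_right W10; rewrite u1 v1 in m12; lra.
have w3 : W3 = 0 by apply: mulf_eq0_right W10; rewrite u1 v1 in m13; lra.
(* Expansions along foreign cofactors vanish: [x1 W1 + x2 W2 + x3 W3 = 0], and likewise for the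
   [y_k]; the entries [z2] and [z3] are obtained in the same way from [U1 = V1 = 0]. *)
have x10 : x1 = 0.
  apply: mulf_eq0_right W10; have := congr1 ( *%R x3) w3; have := congr1 ( *%R x2) w2.
  by rewrite /W1 /W2 /W3; clear; lra.
have y10 : y1 = 0.
  apply: mulf_eq0_right W10; have := congr1 ( *%R y3) w3; have := congr1 ( *%R y2) w2.
  by rewrite /W1 /W2 /W3; clear; lra.
have z20 : z2 = 0.
  apply: mulf_eq0_right W10; have := congr1 ( *%R x2) u1; have := congr1 ( *%R y2) v1.
  by rewrite /W1 /U1 /V1; clear; lra.
have z30 : z3 = 0.
  apply: mulf_eq0_right W10; have := congr1 ( *%R x3) u1; have := congr1 ( *%R y3) v1.
  by rewrite /W1 /U1 /V1; clear; lra.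
have zz : z1 ^+ 2 != 0 by rewrite sqrf_eq0.
move: m23 n23 p1 p3 W10; rewrite /U1 /V1 /U2 /V2 /W2 /U3 /V3 /W3 /W1 x10 y10 z20 z30.
move: zz; clear => zz m23 n23 p1 p3 W10.
have e1 : x2 * y3 + x3 * y2 = 0 by apply: mulf_eq0_right zz; lra.
have e2 : x2 * x3 + y2 * y3 = 0 by apply: mulf_eq0_right zz; lra.
have y20 : y2 != 0.
  apply: contraNneq W10 => y20; rewrite y20 in e1 *; rewrite mul0r subr0.
  by apply/eqP; lra.
have y30 : y3 != 0.
  apply: contraNneq W10 => y30; rewrite y30 in e1 *; rewrite mulr0 sub0r.
  by rewrite oppr_eq0; apply/eqP; lra.
have s3 : x3 ^+ 2 = y3 ^+ 2.
  suff : y2 * (x3 ^+ 2 - y3 ^+ 2) = 0 by move/mulf_eq0_right/(_ y20); lra.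
  have := congr1 ( *%R x3) e1; have := congr1 ( *%R y3) e2; lra.
have s2 : x2 ^+ 2 = y2 ^+ 2.
  suff : y3 * (x2 ^+ 2 - y2 ^+ 2) = 0 by move/mulf_eq0_right/(_ y30); lra.
  have := congr1 ( *%R x2) e1; have := congr1 ( *%R y2) e2; lra.
have uv : x2 * y2 + x3 * y3 = 0 by apply: mulf_eq0_right zz; lra.
have x20 : x2 != 0 by rewrite -sqrf_eq0 s2 sqrf_eq0.
have s23 : x2 ^+ 2 = x3 ^+ 2.
  suff : z1 ^+ 2 * (x2 * y2 * (x3 ^+ 2 - x2 ^+ 2)) = 0.
    by move=> /mulf_eq0_right/(_ zz)/mulf_eq0_right/(_ (mulf_neq0 x20 y20)); lra.
  have := congr1 ( *%R (z1 ^+ 2 * (x2 * y2))) s2.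
  have := congr1 ( *%R (z1 ^+ 2 * (x3 * y3))) s3.
  have := congr1 ( *%R (z1 ^+ 2 * (x2 * y2))) s3.
  have := congr1 ( *%R (z1 ^+ 2 * (x3 * y3))) s2.
  have := congr1 ( *%R (z1 ^+ 2 * x2 ^+ 2)) uv.
  have := congr1 ( *%R (z1 ^+ 2 * x3 ^+ 2)) uv.
  have := congr1 ( *%R (z1 ^+ 2 * y2 ^+ 2)) uv.
  have := congr1 ( *%R (z1 ^+ 2 * y3 ^+ 2)) uv.
  have := congr1 ( *%R (z1 ^+ 2)) uv.
  lra.
by split; split=> //; lra.
Qed.

(** If no [U_k] vanished, the three ratios [V_k / U_k] would be pairwise opposite, hence zero, and
    the row of the [V_k] would vanish. If some [U_k] vanishes, so does [V_k], unless the whole row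
    of the [U_k] is zero. A nonzero determinant excludes a zero row of cofactors. *)
Lemma some_column_isolated x1 y1 z1 x2 y2 z2 x3 y3 z3
  (U1 := y2 * z3 - z2 * y3) (V1 := z2 * x3 - x2 * z3)
  (U2 := y3 * z1 - z3 * y1) (V2 := z3 * x1 - x3 * z1)
  (U3 := y1 * z2 - z1 * y2) (V3 := z1 * x2 - x1 * z2) :
  det9 x1 y1 z1 x2 y2 z2 x3 y3 z3 != 0 ->
  U1 * V2 + U2 * V1 = 0 -> U1 * V3 + U3 * V1 = 0 -> U2 * V3 + U3 * V2 = 0 ->
  [\/ U1 = 0 /\ V1 = 0, U2 = 0 /\ V2 = 0 | U3 = 0 /\ V3 = 0].
Proof.
move=> dl0 n12 n13 n23.
have nU : ~~ [&& U1 == 0, U2 == 0 & U3 == 0].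
  apply: contraNN dl0 => /and3P[/eqP u1 /eqP u2 /eqP u3]; apply/eqP.
  have -> : det9 x1 y1 z1 x2 y2 z2 x3 y3 z3 = x1 * U1 + x2 * U2 + x3 * U3.
    by rewrite /det9 /U1 /U2 /U3; ring.
  by rewrite u1 u2 u3; ring.
have nV : ~~ [&& V1 == 0, V2 == 0 & V3 == 0].
  apply: contraNN dl0 => /and3P[/eqP u1 /eqP u2 /eqP u3]; apply/eqP.
  have -> : det9 x1 y1 z1 x2 y2 z2 x3 y3 z3 = y1 * V1 + y2 * V2 + y3 * V3.
    by rewrite /det9 /V1 /V2 /V3; ring.
  by rewrite u1 u2 u3; ring.
move: U1 V1 U2 V2 U3 V3 {dl0} n12 n13 n23 nU nV => U1 V1 U2 V2 U3 V3 n12 n13 n23 nU nV.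
have [u1|u1] := eqVneq U1 0.
  rewrite u1 !mul0r !add0r in n12 n13.
  have [v1|v1] := eqVneq V1 0; first by constructor 1.
  have u2 : U2 = 0 by apply: mulf_eq0_right v1; rewrite mulrC.
  have u3 : U3 = 0 by apply: mulf_eq0_right v1; rewrite mulrC.
  by move: nU; rewrite u1 u2 u3 eqxx.
have [u2|u2] := eqVneq U2 0.
  have v2 : V2 = 0 by apply: mulf_eq0_right u1; rewrite u2 in n12; lra.
  by constructor 2.
have [u3|u3] := eqVneq U3 0.
  have v3 : V3 = 0 by apply: mulf_eq0_right u1; rewrite u3 in n13; lra.
  by constructor 3.
have v1 : V1 = 0.
  suff : (2 * U2 * U3) * V1 = 0 by move/mulf_eq0_right; apply; rewrite !mulf_neq0 // pnatr_eq0.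
  have := congr1 ( *%R U3) n12; have := congr1 ( *%R U2) n13.
  have := congr1 ( *%R U1) n23; lra.
have v2 : V2 = 0 by apply: mulf_eq0_right u1; rewrite v1 in n12; lra.
have v3 : V3 = 0 by apply: mulf_eq0_right u1; rewrite v1 in n13; lra.
by move: nV; rewrite v1 v2 v3 eqxx.
Qed.

End IsolatedColumn.

Lemma perm_cycle3 (I : eqType) (x y z : I) : perm_eq [:: z; x; y] [:: x; y; z].
Proof. exact: (permEl (perm_catC [:: z] [:: x; y])). Qed.

(** * Classification of the closing conditions: (CDA) or a box *)

Section Classification.
Variables (R : rcfType) (T : Type) (F : set_system T) (FF : Filter F).
Implicit Types (a w : T -> R) (E : set T) (x y z : R).

Lemma freqS a E (E' : set T) : E `<=` E' -> freq F a E -> freq F a E'.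
Proof. by move=> s h p p0 Fp; apply: (h p p0); apply: filterS Fp => t /= + /s; apply. Qed.

Lemma sqr_eq_sign (x y : R) : x ^+ 2 = y ^+ 2 -> exists2 e, e * e = 1 & x = e * y.
Proof.
move=> /eqP; rewrite eqf_sqr => /orP[]/eqP ->; [exists 1|exists (-1)]; ring.
Qed.

Lemma sign_cases (e : R) : e * e = 1 -> e = 1 \/ e = -1.
Proof.
by move=> /eqP; rewrite -expr2 sqrf_eq1 => /orP[]/eqP ->; [left|right].
Qed.

Lemma sign_neq0 (e : R) : e * e = 1 -> e != 0.
Proof.
by move=> ee; apply/eqP => e0; move/eqP: ee; rewrite e0 mul0r eq_sym oner_eq0.
Qed.

(** The sums and the differences agree up to sign; the two signs are equal in the proportional case
    and opposite in the exchanged one. These are the mirror and the swap situations. *)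
Lemma same_hP x1 y1 x2 y2 : same_h x1 y1 x2 y2 ->
  exists2 e : R, e * e = 1 & (x2 = e * x1 /\ y2 = e * y1) \/ (x2 = e * y1 /\ y2 = e * x1).
Proof.
move=> [h1 h2].
have /sqr_eq_sign[e ee hp] : (x2 + y2) ^+ 2 = (x1 + y1) ^+ 2 by lra.
have /sqr_eq_sign[f ff hm] : (x2 - y2) ^+ 2 = (x1 - y1) ^+ 2 by lra.
exists e => //; have [|] := sign_cases ee; have [|] := sign_cases ff => fE eE;
  rewrite eE fE in hp hm *; by [left; lra|right; lra].
Qed.

Lemma same_h_sym x1 y1 x2 y2 : same_h x1 y1 x2 y2 -> same_h x2 y2 x1 y1.
Proof. by move=> [h1 h2]; split. Qed.

(* (CDA) up to the order of the columns [j1], [j2]: the four block entries have the same absolute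
   value and an odd number of them is negative; in this form it survives [q_j |-> - q_j]. *)
Definition cda_core (I J : Type) (c : I -> J -> R) i0 i1 i2 j0 j1 j2 :=
  [/\ c i0 j1 = 0, c i0 j2 = 0, c i1 j0 = 0, c i2 j0 = 0 &
   [/\ c i1 j1 ^+ 2 = c i1 j2 ^+ 2, c i1 j1 ^+ 2 = c i2 j1 ^+ 2,
       c i2 j1 ^+ 2 = c i2 j2 ^+ 2 & c i1 j1 * c i2 j1 = - (c i1 j2 * c i2 j2)]].

Section Config.
Variables (I J : eqType) (c : I -> J -> R) (i1 i2 i3 : I).
Variables (a b g om : T -> R) (w : J -> T -> R).

Definition minor j1 j2 j3 := det9 (c i1 j1) (c i2 j1) (c i3 j1) (c i1 j2) (c i2 j2) (c i3 j2)
  (c i1 j3) (c i2 j3) (c i3 j3).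

Definition cda_up_to_order (i : seq I) (j : seq J) :=
  exists i0 i1 i2 j0 j1 j2, [/\ perm_eq [:: i0; i1; i2] i, perm_eq [:: j0; j1; j2] j &
    cda_core c i0 i1 i2 j0 j1 j2].

(* For [O_i = e_i P_i] the relation says that [O_2 + O_3], [O_1 + O_3], [O_1 + O_2] are pairwise
   orthogonal, which is the shape of three vertices of a box in (SD2). *)
Definition box_relation :=
  exists e1 e2 e3 : R, [/\ e1 * e1 = 1, e2 * e2 = 1, e3 * e3 = 1 &
    freq F a [set t | e1 * e2 * a t + e1 * e3 * b t + e2 * e3 * g t = -1]].

Hypothesis (ha : forall t, a t ^+ 2 < 1) (hc1 : forall j, c i1 j ^+ 2 < 1)
  (hc2 : forall j, c i2 j ^+ 2 < 1).
Hypothesis hw : forall j t, w j t ^+ 2 = (hpoly (c i1 j) (c i2 j)).[a t].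
Hypothesis hlin : forall j t, c i1 j * (b t - a t * g t) + c i2 j * (g t - a t * b t)
  + w j t * om t = (1 - a t ^+ 2) * c i3 j.
Hypothesis hom : forall t,
  om t ^+ 2 = 1 - a t ^+ 2 - b t ^+ 2 - g t ^+ 2 + 2 * a t * b t * g t.
Hypothesis hfreq : freq F a setT.

Let a0 t : 1 - a t ^+ 2 != 0. Proof. by rewrite subr_eq0 gt_eqF. Qed.

Let hclose j1 j2 j3 t : closing (a t) (c i1 j1) (c i2 j1) (c i3 j1)
  (c i1 j2) (c i2 j2) (c i3 j2) (c i1 j3) (c i2 j3) (c i3 j3) (w j1 t) (w j2 t) (w j3 t).
Proof. by apply: (@closing_of_lin R (a t) (b t) (g t) (om t)). Qed.

Lemma minor_cycle j1 j2 j3 : minor j1 j2 j3 = minor j2 j3 j1.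
Proof. by rewrite /minor /det9; ring. Qed.

Let sh j k := same_h (c i1 j) (c i2 j) (c i1 k) (c i2 k).

(** [swap_case] yields [z1 - e * z2 = u * (x - e * y)] with a sign [u]. In the difference of the two
    linear equations [hlin] the unknown [om] cancels and a factor [(x - e * y) * (1 + e * a)] splits
    off, which leaves the affine relation [b - e * g = u * (1 - e * a)]. *)
Lemma swap_pair j1 j2 j3 (s e z2 : R) E :
  minor j1 j2 j3 != 0 -> ~ sh j1 j3 -> s * s = 1 -> e * e = 1 ->
  c i1 j2 = s * c i2 j1 -> c i2 j2 = s * c i1 j1 -> c i3 j2 = s * z2 ->
  (forall t, E t -> s * w j2 t = e * w j1 t) -> freq F a E ->
  box_relation.
Proof.
move=> m0 nsh ss ee x2E y2E z2E hE hf.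
set x := c i1 j1 in x2E y2E *; set y := c i2 j1 in x2E y2E *.
set z1 := c i3 j1; set x3 := c i1 j3; set y3 := c i2 j3; set z3 := c i3 j3.
have sx2 : s * c i1 j2 = y by rewrite x2E mulrA ss mul1r.
have sy2 : s * c i2 j2 = x by rewrite y2E mulrA ss mul1r.
have sz2 : s * c i3 j2 = z2 by rewrite z2E mulrA ss mul1r.
have m0' : det9 x y z1 y x z2 x3 y3 z3 != 0.
  have -> : det9 x y z1 y x z2 x3 y3 z3 = s * minor j1 j2 j3.
    rewrite -[LHS]mul1r -ss /minor x2E y2E z2E -/x -/y -/z1 -/x3 -/y3 -/z3 /det9; ring.
  by rewrite mulf_neq0 // (sign_neq0 ss).
have key : (x - e * y) ^+ 2 = (z1 - e * z2) ^+ 2 /\ x - e * y != 0.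
  have d0 : x - e * y != 0.
    apply/negP => /eqP d0; have [t Et] := freq_nonempty FF hf.
    have := hlin j2 t; rewrite x2E y2E z2E => /(congr1 ( *%R (s * e))).
    have -> : s * e * (s * y * (b t - a t * g t) + s * x * (g t - a t * b t) + w j2 t * om t)
      = (s * s) * (e * y * (b t - a t * g t) + e * x * (g t - a t * b t))
       + e * (s * w j2 t) * om t by ring.
    have exy : e * x = y.
      have -> : x = e * y by lra.
      by rewrite mulrA ee mul1r.
    have eyx : e * y = x by lra.
    rewrite hE // ss mulrA ee !mul1r eyx exy hlin -/z1 => h.
    have {}h : z1 = e * z2.
      by apply: (mulfI (a0 t)); rewrite h -[RHS]mul1r -ss; ring.
    case/eqP: m0'; rewrite h -exy.
    have -> : det9 x (e * x) (e * z2) (e * x) x z2 x3 y3 z3 =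
       (1 - e * e) * (x * (x * z3 - z2 * y3)) by rewrite /det9; ring.
    by rewrite ee subrr mul0r.
  split=> //.
  have cl t : E t -> closing (a t) x y z1 y x z2 x3 y3 z3 (w j1 t) (s * w j2 t) (w j3 t).
    by move=> Et; have := closing_opp ss (hclose j1 j2 j3 t); rewrite sx2 sy2 sz2.
  have [q0 q1 [p0 p1 p2 p3]] := @closing_two R T F FF a E (w j1) (fun t => s * w j2 t)
     (w j3) e x y z1 y x z2 x3 y3 z3 hf (hc1 j1) (hc2 j1) nsh (hw j1) (hw j3) cl hE.
  have [eE|eE] := sign_cases ee; rewrite eE in d0 q0 q1 p0 p1 p2 p3 *.
    rewrite !mul1r in d0 *; rewrite subr_eq0 in d0; symmetry.
    by apply: (@swap_case R x y z1 z2 x3 y3 z3) => //; apply: hc1.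
  (* For [e = -1], passing to the antipodes of [P2] and [Q2] restores the hypotheses of
     [swap_case]. *)
  rewrite !mulN1r !opprK in d0 *; symmetry.
  have -> : z1 + z2 = z1 - - z2 by ring.
  have -> : x + y = x - - y by ring.
  apply: (@swap_case R x (- y) z1 (- z2) x3 (- y3) z3) => //.
  - by apply: contraNneq m0' => h; rewrite -[X in _ == X]h /det9; apply/eqP; ring.
  - by rewrite -subr_eq0 opprK.
  - exact: hc1.
  - exact: hc1.
  - by rewrite -[RHS]q0; ring.
  - by move: q1; lra.
  - by rewrite -[RHS]p0 /det9; ring.
  - by move: p1; lra.
  - by rewrite -[RHS]p2 /det9; ring.
  - by move: p3; lra.
case: key => key d0.
have [u uu hu] := sqr_eq_sign (esym key).
exists 1, (- e), (- u); split; rewrite ?mulrNN ?mulr1 //.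
apply: freqS hf => t Et /=.
have ea : 1 + e * a t != 0.
  apply: contraNneq (a0 t) => h; rewrite subr_eq0 eq_sym -subr_eq0.
  have -> : a t ^+ 2 - 1 = (e * e) * a t ^+ 2 - 1 by rewrite ee mul1r.
  have -> : e * e * a t ^+ 2 - 1 = (1 + e * a t) * (e * a t - 1) by ring.
  by rewrite h mul0r.
have hl : b t - e * g t = u * (1 - e * a t).
  apply: (mulfI (mulf_neq0 d0 ea)).
  have l1 := hlin j1 t.
  have := hlin j2 t; rewrite x2E y2E z2E => /(congr1 ( *%R (s * e))).
  have -> : s * e * (s * y * (b t - a t * g t) + s * x * (g t - a t * b t) + w j2 t * om t)
      = (s * s) * (e * y * (b t - a t * g t) + e * x * (g t - a t * b t))
       + e * (s * w j2 t) * om t by ring.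
  rewrite hE // [e * (e * _)]mulrA ss ee !mul1r => l2.
  have l3 : (1 - a t ^+ 2) * (z1 - e * z2) =
    (1 - a t ^+ 2) * z1 - s * e * ((1 - a t ^+ 2) * (s * z2)).
    by rewrite -[e * z2 in LHS]mul1r -ss; ring.
  have -> : (x - e * y) * (1 + e * a t) * (u * (1 - e * a t)) =
     (1 - (e * e) * a t ^+ 2) * (u * (x - e * y)) by ring.
  rewrite ee mul1r -hu l3 -l1 -l2 -/x -/y.
  have [eE|eE] := sign_cases ee; rewrite eE; ring.
have -> : 1 * - e * a t + 1 * - u * b t + e * u * g t =
  - (e * a t + u * (b t - e * g t)) by ring.
rewrite hl mulrA uu; ring.
Qed.


(** The ratio of the two square roots may change its sign along the motion; [freqU] retains a set of
    times on which it is constant and [a] still takes enough values. *)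
Lemma freq_sign j1 j2 E : sh j1 j2 -> freq F a E ->
  exists E' e, [/\ e * e = 1, freq F a E' & forall t, E' t -> E t /\ w j2 t = e * w j1 t].
Proof.
move=> h12 hE.
have hw12 t : w j2 t ^+ 2 = w j1 t ^+ 2.
  by rewrite !hw !hpolyE; case: h12 => e1 e2; have := congr1 ( *%R (2 * a t)) e1; lra.
have [t _|hf|hf] := @freqU R T F FF a E [set t | w j2 t = 1 * w j1 t] [set t | w j2 t = -1 * w j1 t] hE.
- have [s ss hs] := sqr_eq_sign (hw12 t).
  by have [sE|sE] := sign_cases ss; [left|right]; rewrite /= hs sE.
- by exists (E `&` [set t | w j2 t = 1 * w j1 t]), 1; rewrite mulr1.
- by exists (E `&` [set t | w j2 t = -1 * w j1 t]), (-1); rewrite mulrNN mulr1.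
Qed.

(** The exchanged pattern of [same_hP] leads to [swap_pair]. So does the proportional one when
    [x ^+ 2 = y ^+ 2], since it is then an exchange as well, up to sign; otherwise [mirror_case]
    applies and gives (CDA). *)
Lemma two_equal_columns j1 j2 j3 :
  minor j1 j2 j3 != 0 -> sh j1 j2 -> ~ sh j1 j3 ->
  cda_up_to_order [:: i1; i2; i3] [:: j1; j2; j3] \/ box_relation.
Proof.
move=> m0 h12 n13.
have [E [e [ee hf hE0]]] := freq_sign h12 hfreq.
have hE t : E t -> w j2 t = e * w j1 t by move=> /hE0[].
have [s ss hs] := same_hP h12.
have swap : c i1 j2 = s * c i2 j1 -> c i2 j2 = s * c i1 j1 -> box_relation.
  move=> x2E y2E; apply: (@swap_pair j1 j2 j3 s (s * e) (s * c i3 j2) E) => //.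
  - by rewrite mulrACA ss ee mulr1.
  - by rewrite mulrA ss mul1r.
  - by move=> t Et; rewrite hE // mulrA.
case: hs => [[x2E y2E]|[x2E y2E]]; last by right; exact: swap.
have [xy|xy] := eqVneq (c i1 j1 ^+ 2) (c i2 j1 ^+ 2).
  right; have [u uu hu] := sqr_eq_sign xy.
  have hv : c i2 j1 = u * c i1 j1 by rewrite hu mulrA uu mul1r.
  apply: (@swap_pair j1 j2 j3 (s * u) (s * u * e) (s * u * c i3 j2) E) => //.
  - by rewrite mulrACA ss uu mulr1.
  - by rewrite mulrACA [s * u * _]mulrACA ss uu ee !mulr1.
  - by rewrite x2E hu mulrA.
  - by rewrite y2E hv mulrA.
  - by rewrite mulrA [s * u * _]mulrACA ss uu !mul1r.
  - by move=> t Et; rewrite hE // mulrA.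
left.
set x := c i1 j1 in x2E y2E xy *; set y := c i2 j1 in x2E y2E xy *.
pose z1 := c i3 j1; pose z2 := s * c i3 j2.
pose x3 := c i1 j3; pose y3 := c i2 j3; pose z3 := c i3 j3.
have sx2 : s * c i1 j2 = x by rewrite x2E mulrA ss mul1r.
have sy2 : s * c i2 j2 = y by rewrite y2E mulrA ss mul1r.
have m0' : det9 x y z1 x y z2 x3 y3 z3 != 0.
  have -> : det9 x y z1 x y z2 x3 y3 z3 = s * minor j1 j2 j3.
    have z2S : c i3 j2 = s * z2 by rewrite /z2 mulrA ss mul1r.
    by rewrite -[LHS]mul1r -ss /minor x2E y2E z2S -/x -/y -/z1 -/x3 -/y3 -/z3 /det9; ring.
  by rewrite mulf_neq0 // (sign_neq0 ss).
have cl t : E t -> closing (a t) x y z1 x y z2 x3 y3 z3 (w j1 t) (s * w j2 t) (w j3 t).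
  by move=> Et; have := closing_opp ss (hclose j1 j2 j3 t); rewrite sx2 sy2.
have see : s * e * (s * e) = 1 by rewrite mulrACA ss ee mulr1.
have hE' t : E t -> s * w j2 t = (s * e) * w j1 t by move=> Et; rewrite hE // mulrA.
(* With the other sign, [hlin] makes the third entries agree too, so that the minor has two equal
   rows. *)
have seE : s * e = -1.
  have [seE|//] := sign_cases see.
  have [t Et] := freq_nonempty FF hf.
  have l1 := hlin j1 t; have := congr1 ( *%R s) (hlin j2 t).
  have -> : s * (c i1 j2 * (b t - a t * g t) + c i2 j2 * (g t - a t * b t) + w j2 t * om t) =
    (s * c i1 j2) * (b t - a t * g t) + (s * c i2 j2) * (g t - a t * b t) + (s * w j2 t) * om t.
    by ring.
  rewrite hE' // seE mul1r sx2 sy2 l1 mulrCA => /(mulfI (a0 t)) zz.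
  by case/eqP: m0'; rewrite /z2 -zz /det9 /z1; ring.
rewrite seE in hE'.
have [q0 q1 [p0 p1 p2 p3]] := @closing_two R T F FF a E (w j1) (fun t => s * w j2 t)
   (w j3) (-1) x y z1 x y z2 x3 y3 z3 hf (hc1 j1) (hc2 j1) n13 (hw j1) (hw j3) cl hE'.
have [z2E z30 h] := @mirror_case R x y z1 z2 x3 y3 z3 m0' xy q0 q1 p0 p1 p2 p3.
have z2E' : c i3 j2 = - s * z1 by rewrite -[LHS]mul1r -ss -mulrA -/z2 z2E mulrN mulNr.
have pj : perm_eq [:: j3; j1; j2] [:: j1; j2; j3].
  exact: perm_cycle3.
have ss2 : s ^+ 2 = 1 by rewrite expr2.
case: h => [] [y0 x30 xz].
- exists i2, i1, i3, j3, j1, j2; split=> //.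
    by rewrite (perm_catCA [:: i2] [:: i1] [:: i3]).
  split; [exact: y0|by rewrite y2E y0 mulr0|exact: x30|exact: z30|].
  rewrite -/x -/z1 x2E z2E' !exprMn sqrrN ss2 !mul1r; split=> //.
  by rewrite !mulNr mulrN opprK mulrACA ss mul1r.
- exists i1, i2, i3, j3, j1, j2; split=> //.
  split; [exact: y0|by rewrite x2E y0 mulr0|exact: x30|exact: z30|].
  rewrite -/y -/z1 y2E z2E' !exprMn sqrrN ss2 !mul1r; split=> //.
  by rewrite !mulNr mulrN opprK mulrACA ss mul1r.
Qed.


(** All three [w_j] are multiples of one of them, so [closing] becomes a cubic equation
    [(A + B a) h(a) + d2 (1 - a ^ 2) = 0]. Its coefficients force [B = 0] and [h = 1 - a ^ 2]: all
    three [Q_j] are orthogonal to [P1] and [P2], and the minor vanishes. *)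
Lemma not_all_equal_columns j1 j2 j3 : minor j1 j2 j3 != 0 -> sh j1 j2 -> ~ sh j1 j3.
Proof.
move=> m0 h12 h13.
have [E1 [e [ee hf1 hE1]]] := freq_sign h12 hfreq.
have [E [f [ff hf hE]]] := freq_sign h13 hf1.
set x := c i1 j1; set y := c i2 j1.
pose V1 := wcof 1 e f (c i2 j1) (c i3 j1) (c i2 j2) (c i3 j2) (c i2 j3) (c i3 j3).
pose V2 := wcof 1 e f (c i3 j1) (c i1 j1) (c i3 j2) (c i1 j2) (c i3 j3) (c i1 j3).
pose V3 := wcof 1 e f (c i1 j1) (c i2 j1) (c i1 j2) (c i2 j2) (c i1 j3) (c i2 j3).
pose A := V1 ^+ 2 + V2 ^+ 2 - V3 ^+ 2; pose B := 2 * V1 * V2.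
pose d2 := minor j1 j2 j3 ^+ 2.
have d20 : d2 != 0 by rewrite sqrf_eq0.
have [] := @freq_cubic R T F FF a E (A * (1 - x ^+ 2 - y ^+ 2) + d2)
  (A * (2 * x * y) + B * (1 - x ^+ 2 - y ^+ 2)) (- A + B * (2 * x * y) - d2) (- B) hf.
  move=> t Et; have [/hE1[_ w2] w3] := hE t Et.
  have := hclose j1 j2 j3 t; rewrite /closing -/(minor j1 j2 j3) w2 w3 => <-.
  have scale u1 v1 u2 v2 u3 v3 : wcof (w j1 t) (e * w j1 t) (f * w j1 t) u1 v1 u2 v2 u3 v3
     = w j1 t * wcof 1 e f u1 v1 u2 v2 u3 v3 by rewrite /wcof; ring.
  rewrite !scale -/V1 -/V2 -/V3 !exprMn hw hpolyE -/x -/y -/d2 /A /B.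
  have -> : w j1 t * V1 * (w j1 t * V2) = w j1 t ^+ 2 * (V1 * V2) by ring.
  rewrite hw hpolyE -/x -/y; move: V1 V2 V3 {A B scale} => V1 V2 V3; ring.
move=> p0 p1 p2 p3.
have B0 : B = 0 by lra.
have A0 : A = - d2 by rewrite B0 in p2; lra.
have xy0 : x * y = 0.
  have : d2 * (x * y) = 0 by rewrite A0 B0 in p1; lra.
  by move/mulf_eq0_right/(_ d20).
have xy1 : x ^+ 2 + y ^+ 2 = 0.
  have : d2 * (x ^+ 2 + y ^+ 2) = 0 by rewrite A0 in p0; lra.
  by move/mulf_eq0_right/(_ d20).
have zero u v : u ^+ 2 + v ^+ 2 = 0 -> u = 0 /\ v = 0 :> R.
  move/eqP; rewrite paddr_eq0 ?sqr_ge0 // !sqrf_eq0 => /andP[/eqP-> /eqP->].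
  by split.
have [x1 y1] := zero _ _ xy1.
have [x2 y2] := zero _ _ (etrans (esym h12.2) xy1).
have [x3 y3] := zero _ _ (etrans (esym h13.2) xy1).
case/eqP: m0; rewrite /minor /det9 x2 y2 x3 y3 -/x -/y x1 y1; ring.
Qed.

Lemma distinct_columns j1 j2 j3 :
  minor j1 j2 j3 != 0 -> ~ sh j1 j2 -> ~ sh j1 j3 -> ~ sh j2 j3 ->
  cda_up_to_order [:: i1; i2; i3] [:: j1; j2; j3].
Proof.
move=> m0 n12 n13 n23.
pose U k l := c i2 k * c i3 l - c i3 k * c i2 l.
pose V k l := c i3 k * c i1 l - c i1 k * c i3 l.
pose W k l := c i1 k * c i2 l - c i2 k * c i1 l.
(* [closing] is a quadratic form [U ^ 2 + V ^ 2 - W ^ 2 + 2 a U V] in the cofactors; [q] is twice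
   its polar form, [m] below gives its values. *)
pose q k l k' l' : {poly R} :=
  (2 * (U k l * U k' l' + V k l * V k' l' - W k l * W k' l'))%:P
  + (2 * (U k l * V k' l' + U k' l' * V k l)) *: 'X.
have qE k l k' l' r : (q k l k' l').[r] =
  2 * (U k l * U k' l' + V k l * V k' l' - W k l * W k' l')
  + 2 * (U k l * V k' l' + U k' l' * V k l) * r by rewrite /q !hornerE.
have q0 k l k' l' : q k l k' l' = 0 ->
   U k l * U k' l' + V k l * V k' l' - W k l * W k' l' = 0 /\
   U k l * V k' l' + U k' l' * V k l = 0.
  move=> h; have [h0 h1 _ _] : [/\ 2 * (U k l * U k' l' + V k l * V k' l' - W k l * W k' l') = 0,
     2 * (U k l * V k' l' + U k' l' * V k l) = 0, 0 = 0 :> R & 0 = 0 :> R].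
    by apply: poly_deg3_eq0; rewrite !scale0r !addr0.
  by split; lra.
pose m k l : {poly R} := (U k l ^+ 2 + V k l ^+ 2 - W k l ^+ 2)%:P + (2 * U k l * V k l) *: 'X.
have mE k l r : (m k l).[r] = U k l ^+ 2 + V k l ^+ 2 - W k l ^+ 2 + 2 * U k l * V k l * r.
  by rewrite /m !hornerE.
pose d2 := minor j1 j2 j3 ^+ 2.
pose h j := hpoly (c i1 j) (c i2 j).
pose A : {poly R} := m j2 j3 * h j1 + m j3 j1 * h j2 + m j1 j2 * h j3 + d2 *: (1 - 'X^2).
have AE r : A.[r] = (m j2 j3).[r] * (h j1).[r] + (m j3 j1).[r] * (h j2).[r]
   + (m j1 j2).[r] * (h j3).[r] + d2 * (1 - r ^+ 2).
  have gen (m1 m2 m3 h1 h2 h3 : {poly R}) : (m1 * h1 + m2 * h2 + m3 * h3 + d2 *: (1 - 'X^2)).[r]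
    = m1.[r] * h1.[r] + m2.[r] * h2.[r] + m3.[r] * h3.[r] + d2 * (1 - r ^+ 2).
    by rewrite !(hornerD, hornerM, hornerZ, hornerN, hornerXn, hornerC).
  exact: gen.
have cl t : A.[a t] + (q j2 j3 j3 j1).[a t] * (w j1 t * w j2 t)
  + (q j2 j3 j1 j2).[a t] * (w j1 t * w j3 t) + (q j3 j1 j1 j2).[a t] * (w j2 t * w j3 t) = 0.
  rewrite AE !qE !mE /h -!hw -(hclose j1 j2 j3 t) /d2 /minor /wcof /U /V /W.
  by move: (det9 _ _ _ _ _ _ _ _ _) => d; ring.
have [Z1 Z2 Z3] := @freq_sqrt_indep3 R T F FF a setT (w j1) (w j2) (w j3) _ _ _ _ _ _
  A _ _ _ hfreq (hc1 j1) (hc2 j1) (hc1 j2) (hc2 j2) n12 n13 n23 (hw j1) (hw j2) (hw j3)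
  (fun t _ => cl t).
have A0 t : A.[a t] = 0 by have := cl t; rewrite Z1 Z2 Z3 !horner0 !mul0r !addr0.
have {Z1}[m12 n12'] := q0 _ _ _ _ Z1; have {Z2}[m13 n13'] := q0 _ _ _ _ Z2.
have {Z3}[m23 n23'] := q0 _ _ _ _ Z3.
have [] := @freq_cubic R T F FF a setT
  ((U j2 j3 ^+ 2 + V j2 j3 ^+ 2 - W j2 j3 ^+ 2) * (1 - c i1 j1 ^+ 2 - c i2 j1 ^+ 2)
  + (U j3 j1 ^+ 2 + V j3 j1 ^+ 2 - W j3 j1 ^+ 2) * (1 - c i1 j2 ^+ 2 - c i2 j2 ^+ 2)
  + (U j1 j2 ^+ 2 + V j1 j2 ^+ 2 - W j1 j2 ^+ 2) * (1 - c i1 j3 ^+ 2 - c i2 j3 ^+ 2) + d2)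
  ((U j2 j3 ^+ 2 + V j2 j3 ^+ 2 - W j2 j3 ^+ 2) * (2 * c i1 j1 * c i2 j1)
   + 2 * U j2 j3 * V j2 j3 * (1 - c i1 j1 ^+ 2 - c i2 j1 ^+ 2)
  + (U j3 j1 ^+ 2 + V j3 j1 ^+ 2 - W j3 j1 ^+ 2) * (2 * c i1 j2 * c i2 j2)
   + 2 * U j3 j1 * V j3 j1 * (1 - c i1 j2 ^+ 2 - c i2 j2 ^+ 2)
  + (U j1 j2 ^+ 2 + V j1 j2 ^+ 2 - W j1 j2 ^+ 2) * (2 * c i1 j3 * c i2 j3)
   + 2 * U j1 j2 * V j1 j2 * (1 - c i1 j3 ^+ 2 - c i2 j3 ^+ 2))
  (- (U j2 j3 ^+ 2 + V j2 j3 ^+ 2 - W j2 j3 ^+ 2) + 2 * U j2 j3 * V j2 j3 * (2 * c i1 j1 * c i2 j1)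
  - (U j3 j1 ^+ 2 + V j3 j1 ^+ 2 - W j3 j1 ^+ 2) + 2 * U j3 j1 * V j3 j1 * (2 * c i1 j2 * c i2 j2)
  - (U j1 j2 ^+ 2 + V j1 j2 ^+ 2 - W j1 j2 ^+ 2) + 2 * U j1 j2 * V j1 j2 * (2 * c i1 j3 * c i2 j3)
   - d2)
  (- (2 * U j2 j3 * V j2 j3) - 2 * U j3 j1 * V j3 j1 - 2 * U j1 j2 * V j1 j2) hfreq.
  move=> t _; rewrite -[RHS](A0 t) AE !mE /h !hpolyE.
  by move: U V W d2 {q qE q0 m mE A AE cl A0 m12 n12' m13 n13' m23 n23'} => U V W d2; ring.
move=> _ p1 _ p3.
have [iso|iso|iso] := some_column_isolated m0 n12' n13' n23'.
- case: iso => u1 v1.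
  have [[x1 y1 z2 z3] [s1 s2 s3 s4]] := isolated_column m0 u1 v1 m12 m13 m23 n23' p1 p3.
  (* [P3] and the joint of the isolated column take the places of [p_0] and [q_0]; the other two
     cases follow by cyclic renumbering. *)
  exists i3, i1, i2, j1, j2, j3; split=> //; first exact: perm_cycle3.
  by split=> //; split=> //; rewrite -s1 s2.
- case: iso => u1 v1; rewrite minor_cycle in m0.
  have [] := isolated_column m0 u1 v1 m23.
  + by rewrite -[RHS]m12 /U /V /W; ring.
  + by rewrite -[RHS]m13 /U /V /W; ring.
  + by rewrite -[RHS]n13' /U /V /W; ring.
  + by rewrite -[RHS]p1 /U /V /W; ring.
  + by rewrite -[RHS]p3 /U /V /W; ring.
  move=> [x1 y1 z2 z3] [s1 s2 s3 s4].
  exists i3, i1, i2, j2, j3, j1; split; first exact: perm_cycle3.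
    by rewrite perm_sym perm_cycle3.
  by split=> //; split=> //; rewrite -s1 s2.
- case: iso => u1 v1; rewrite 2!minor_cycle in m0.
  have [] := isolated_column m0 u1 v1.
  + by rewrite -[RHS]m13 /U /V /W; ring.
  + by rewrite -[RHS]m23 /U /V /W; ring.
  + by rewrite -[RHS]m12 /U /V /W; ring.
  + by rewrite -[RHS]n12' /U /V /W; ring.
  + by rewrite -[RHS]p1 /U /V /W; ring.
  + by rewrite -[RHS]p3 /U /V /W; ring.
  move=> [x1 y1 z2 z3] [s1 s2 s3 s4].
  exists i3, i1, i2, j3, j1, j2; split; try exact: perm_cycle3.
  by split=> //; split=> //; rewrite -s1 s2.
Qed.

Lemma cda_perm i j j' : perm_eq j j' -> cda_up_to_order i j -> cda_up_to_order i j'.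
Proof.
move=> p [k0 [k1 [k2 [l0 [l1 [l2 [pi pj h]]]]]]].
by exists k0, k1, k2, l0, l1, l2; split=> //; rewrite (permPr p) in pj *.
Qed.

Theorem k33_classification j1 j2 j3 : minor j1 j2 j3 != 0 ->
  cda_up_to_order [:: i1; i2; i3] [:: j1; j2; j3] \/ box_relation.
Proof.
move=> m0.
case: (pselect (sh j1 j2)) => [h12|n12].
  by apply: two_equal_columns => //; apply: (not_all_equal_columns m0).
case: (pselect (sh j1 j3)) => [h13|n13].
  have m0' : minor j1 j3 j2 != 0.
    by apply: contraNneq m0 => h; rewrite -oppr_eq0 -[X in _ == X]h /minor /det9; apply/eqP; ring.
  have [h|] := two_equal_columns m0' h13 n12; [left|by right].
  by apply: cda_perm h; by rewrite perm_cons (permEl (perm_catC [:: j3] [:: j2])).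
case: (pselect (sh j2 j3)) => [h23|n23].
  have m0' : minor j2 j3 j1 != 0 by rewrite -minor_cycle.
  have n21 : ~ sh j2 j1 by move/same_h_sym.
  have [h|] := two_equal_columns m0' h23 n21; [left|by right].
  by apply: cda_perm h; by rewrite perm_sym perm_cycle3.
by left; apply: distinct_columns.
Qed.

End Config.
End Classification.

(** * Vectors of the three-dimensional space *)

Section Vec.
Variable R : realType.
Implicit Types x y z a b c : 'rV[R]_3.

Lemma rV3P x y : x 0 0 = y 0 0 -> x 0 1 = y 0 1 -> x 0 2 = y 0 2 -> x = y.
Proof.
move=> h0 h1 h2; apply/rowP => -[[|[|[|//]]] i].
- by rewrite (_ : Ordinal i = 0) //; apply: val_inj.
- by rewrite (_ : Ordinal i = 1) //; apply: val_inj.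
- by rewrite (_ : Ordinal i = 2) //; apply: val_inj.
Qed.

Lemma dotE x y : dot x y = x 0 0 * y 0 0 + x 0 1 * y 0 1 + x 0 2 * y 0 2.
Proof.
rewrite /dot !big_ord_recl big_ord0 addr0 addrA.
by congr (_ + x 0 _ * y 0 _ + x 0 _ * y 0 _); apply: val_inj.
Qed.

Definition det3 x y z : R :=
  x 0 0 * (y 0 1 * z 0 2 - y 0 2 * z 0 1) + x 0 1 * (y 0 2 * z 0 0 - y 0 0 * z 0 2)
  + x 0 2 * (y 0 0 * z 0 1 - y 0 1 * z 0 0).

(* Locked, lest [mxE] unfold it. *)
Definition vec (u v w : R) : 'rV[R]_3 := locked (\row_(k < 3) nth 0 [:: u; v; w] k).

Lemma vec0 u v w : vec u v w 0 0 = u. Proof. by rewrite /vec -lock mxE. Qed.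
Lemma vec1 u v w : vec u v w 0 1 = v. Proof. by rewrite /vec -lock mxE. Qed.
Lemma vec2 u v w : vec u v w 0 2 = w. Proof. by rewrite /vec -lock mxE. Qed.
Definition vecE := (vec0, vec1, vec2).

Definition cross x y : 'rV[R]_3 :=
  vec (x 0 1 * y 0 2 - x 0 2 * y 0 1) (x 0 2 * y 0 0 - x 0 0 * y 0 2)
      (x 0 0 * y 0 1 - x 0 1 * y 0 0).

Lemma dotC x y : dot x y = dot y x. Proof. by rewrite !dotE; ring. Qed.
Lemma dotDl x y z : dot (x + y) z = dot x z + dot y z.
Proof. by rewrite !dotE !mxE; ring. Qed.
Lemma dotDr x y z : dot z (x + y) = dot z x + dot z y.
Proof. by rewrite !dotE !mxE; ring. Qed.
Lemma dotZl (k : R) x y : dot (k *: x) y = k * dot x y.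
Proof. by rewrite !dotE !mxE; ring. Qed.
Lemma dotZr (k : R) x y : dot x (k *: y) = k * dot x y.
Proof. by rewrite !dotE !mxE; ring. Qed.
Lemma dotNl x y : dot (- x) y = - dot x y.
Proof. by rewrite !dotE !mxE; ring. Qed.
Lemma dotNr x y : dot x (- y) = - dot x y.
Proof. by rewrite !dotE !mxE; ring. Qed.
Lemma dot0l x : dot 0 x = 0. Proof. by rewrite !dotE !mxE; ring. Qed.
Lemma dot0r x : dot x 0 = 0. Proof. by rewrite !dotE !mxE; ring. Qed.
Definition dot_lin := (dotDl, dotDr, dotNl, dotNr, dotZl, dotZr).

Lemma dot_ge0 x : 0 <= dot x x.
Proof. by rewrite dotE -!expr2 !addr_ge0 ?sqr_ge0. Qed.

Lemma dot_eq0 x : dot x x = 0 -> x = 0.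
Proof.
rewrite dotE -!expr2 => /eqP.
rewrite paddr_eq0 ?addr_ge0 ?sqr_ge0 // paddr_eq0 ?sqr_ge0 // !sqrf_eq0.
move=> /andP[/andP[/eqP h0 /eqP h1] /eqP h2].
by apply: rV3P; rewrite mxE.
Qed.

Lemma dot_gt0 x : x != 0 -> 0 < dot x x.
Proof.
by move=> x0; rewrite lt_neqAle dot_ge0 andbT; apply: contraNneq x0 => h; apply/eqP/dot_eq0.
Qed.

Lemma det3_mul a b c x y z :
  det3 a b c * det3 x y z =
  det9 (dot a x) (dot b x) (dot c x) (dot a y) (dot b y) (dot c y)
       (dot a z) (dot b z) (dot c z).
Proof. by rewrite /det9 /det3 !dotE; ring. Qed.

Lemma cross_dot x y z : dot (cross x y) z = det3 x y z.
Proof. by rewrite /cross /det3 !dotE !vecE; ring. Qed.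

(** The splitting of the scalar product along the plane of [a], [b] and its normal, multiplied by
    the Gram determinant to avoid division. *)
Lemma dot_frame a b x y :
  (dot a a * dot b b - dot a b ^+ 2) * dot x y =
  (dot b b * dot a x - dot a b * dot b x) * dot a y
  + (dot a a * dot b x - dot a b * dot a x) * dot b y + det3 a b x * det3 a b y.
Proof. by rewrite /det3 !dotE; ring. Qed.

Lemma unit_dot_bound x y : dot x x = 1 -> dot y y = 1 -> dot x y ^+ 2 <= 1.
Proof.
move=> hx hy; have := dot_ge0 (cross x y).
have -> : dot (cross x y) (cross x y) = dot x x * dot y y - dot x y ^+ 2.
  by rewrite /cross !dotE !vecE; ring.
by rewrite hx hy; lra.
Qed.

Lemma unit_dot_lt1 x y : dot x x = 1 -> dot y y = 1 -> x <> y -> x <> - y ->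
  dot x y ^+ 2 < 1.
Proof.
move=> hx hy n1 n2; rewrite lt_neqAle unit_dot_bound // andbT.
rewrite sqrf_eq1; apply/negP => /orP[]/eqP h.
  apply: n1; apply/eqP; rewrite -subr_eq0; apply/eqP/dot_eq0.
  by rewrite !dot_lin (dotC y x) hx hy h; ring.
apply: n2; apply/eqP; rewrite -addr_eq0; apply/eqP/dot_eq0.
by rewrite !dot_lin (dotC y x) hx hy h; ring.
Qed.

Lemma frame_eq a b x y : dot a a * dot b b - dot a b ^+ 2 != 0 ->
  dot a x = dot a y -> dot b x = dot b y -> det3 a b x = det3 a b y -> x = y.
Proof.
move=> g0 ha hb hd; apply/eqP; rewrite -subr_eq0; apply/eqP/dot_eq0.
apply: (mulfI g0); rewrite mulr0 dot_frame !dot_lin ha hb.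
have -> : det3 a b (x - y) = 0.
  rewrite -[RHS](subrr (det3 a b x)) [in X in _ = _ - X]hd /det3 !mxE; ring.
by ring.
Qed.

Lemma det3_dual a b c x : det3 a b c *: x =
  dot x a *: cross b c + dot x b *: cross c a + dot x c *: cross a b.
Proof. by apply: rV3P; rewrite !mxE !vecE /det3 !dotE; ring. Qed.

Lemma dots_eq a b c x y : det3 a b c != 0 ->
  dot x a = dot y a -> dot x b = dot y b -> dot x c = dot y c -> x = y.
Proof.
move=> d0 ha hb hc; apply/eqP; rewrite -subr_eq0; apply/eqP.
have : det3 a b c *: (x - y) = 0.
  by rewrite det3_dual !dot_lin ha hb hc !subrr !scale0r !addr0.
by move/eqP; rewrite scaler_eq0 (negbTE d0) => /eqP.
Qed.

Lemma det3_expand a b c x : det3 a b c *: x =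
  det3 x b c *: a + det3 a x c *: b + det3 a b x *: c.
Proof. by apply: rV3P; rewrite !mxE /det3; ring. Qed.

Lemma planar_decomp a b x : dot a a * dot b b - dot a b ^+ 2 != 0 -> det3 a b x = 0 ->
  exists u v : R, x = u *: a + v *: b.
Proof.
move=> g0 d0; set g := _ - _ in g0.
exists ((dot b b * dot a x - dot a b * dot b x) / g), ((dot a a * dot b x - dot a b * dot a x) / g).
apply: (@frame_eq a b) => //.
- by rewrite !dot_lin /g in g0 *; field.
- by rewrite !dot_lin (dotC b a) /g in g0 *; field.
- by rewrite d0 /det3 !mxE; ring.
Qed.

End Vec.

(** * Flexes near the first moving time *)

Section Cvg.
Context {R : realType} {T : Type} {F : set_system T} {FF : Filter F}.

Lemma cvg_coord (f : T -> 'rV[R]_3) (v : 'rV[R]_3) i j : f @ F --> v -> (fun t => f t i j) @ F --> v i j.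
Proof. by move=> fv; exact: (cvg_comp f (fun M : 'rV[R]_3 => M i j) fv (@coord_continuous R 1 3 i j v)). Qed.

Lemma cvg_dot (f g : T -> 'rV[R]_3) (x y : 'rV[R]_3) : f @ F --> x -> g @ F --> y ->
  (fun t => dot (f t) (g t)) @ F --> dot x y.
Proof.
move=> fx gy; rewrite dotE; under eq_fun do rewrite dotE.
by apply: cvgD; [apply: cvgD|]; apply: cvgM; apply: cvg_coord.
Qed.

Lemma cvg_det3 (f g h : T -> 'rV[R]_3) (x y z : 'rV[R]_3) : f @ F --> x -> g @ F --> y -> h @ F --> z ->
  (fun t => det3 (f t) (g t) (h t)) @ F --> det3 x y z.
Proof.
move=> fx gy hz; rewrite /det3.
apply: cvgD; [apply: cvgD|]; apply: cvgM; (try exact: cvg_coord);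
  apply: cvgB; apply: cvgM; exact: cvg_coord.
Qed.

Lemma near_neq0 (u : T -> R) (l : R) : u @ F --> l -> l != 0 -> \forall t \near F, u t != 0.
Proof. by move=> ul l0; apply: (cvgr_neq0 _ ul l0). Qed.

(** Close to a nonzero limit [l] the value [- l] is not taken; this is how continuity selects
    signs. *)
Lemma near_sqr_eq (u : T -> R) (l : R) : u @ F --> l ->
  \forall t \near F, u t ^+ 2 = l ^+ 2 -> u t = l.
Proof.
move=> ul; have [->|l0] := eqVneq l 0.
  by apply: nearW => t /eqP; rewrite expr0n /= sqrf_eq0 => /eqP.
have : (fun t => u t + l) @ F --> l + l by apply: cvgD => //; apply: cvg_cst.
move/near_neq0; rewrite -mulr2n mulrn_eq0 /= (negbTE l0) => /(_ isT).
apply: filterS => t h /eqP; rewrite eqf_sqr => /orP[/eqP//|/eqP e].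
by move: h; rewrite e addNr eqxx.
Qed.

Lemma cvg_horner (u : T -> R) (l : R) (p : {poly R}) : u @ F --> l ->
  (fun t => p.[u t]) @ F --> p.[l].
Proof. by move=> ul; exact: (cvg_comp u (horner p) ul (@continuous_horner R p l)). Qed.

(** After splitting off the power of ['X - l%:P], the cofactor is nonzero at [l] and hence nearby,
    so a zero of the polynomial close to [l] is [l] itself. *)
Lemma freq_of_limit (u : T -> R) (l : R) (E : set T) : u @ F --> l ->
  ~ (\forall t \near F, E t -> u t = l) -> freq F u E.
Proof.
move=> ul hE p p0 Fp; apply: hE.
have [k [r rl pE]] := multiplicity_XsubC p l.
rewrite p0 /= in rl.
have := near_neq0 (cvg_horner (p := r) ul) rl.
apply: filterS2 Fp => t /= hp r0 /hp; rewrite pE hornerM => /mulf_eq0_right/(_ r0).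
rewrite horner_exp !hornerE => /eqP; rewrite expf_eq0 => /andP[_].
by rewrite subr_eq0 => /eqP.
Qed.
End Cvg.

Section Germ.
Variables (R : realType) (T : Type) (F : set_system T).

(** Together with the constant mixed products this says that the configuration at time [t] is
    congruent to the limiting one. *)
Definition same_gram (m n : nat) (P : 'I_m -> T -> 'rV[R]_3) (Q : 'I_n -> T -> 'rV[R]_3)
    (p : 'I_m -> 'rV[R]_3) (q : 'I_n -> 'rV[R]_3) (t : T) : Prop :=
  (forall i k, dot (P i t) (P k t) = dot (p i) (p k)) /\
  (forall j l, dot (Q j t) (Q l t) = dot (q j) (q l)).

(* A flex near the first time at which a joint starts to move. *)
Record flex_germ (m n : nat) (P : 'I_m -> T -> 'rV[R]_3) (Q : 'I_n -> T -> 'rV[R]_3)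
    (p : 'I_m -> 'rV[R]_3) (q : 'I_n -> 'rV[R]_3) : Prop := FlexGerm {
  germ_cvgP : forall i, P i @ F --> p i;
  germ_cvgQ : forall j, Q j @ F --> q j;
  germ_unitP : forall i t, dot (P i t) (P i t) = 1;
  germ_unitQ : forall j t, dot (Q j t) (Q j t) = 1;
  germ_dot : forall i j t, dot (P i t) (Q j t) = dot (p i) (q j);
  germ_framework : spherical_framework p q;
  germ_non_overlap : P2_non_overlapping p q;
  germ_moves : ~ (\forall t \near F, same_gram P Q p q t) }.

Lemma germ_swap m n (P : 'I_m -> T -> 'rV[R]_3) (Q : 'I_n -> T -> 'rV[R]_3) p q :
  Filter F -> flex_germ P Q p q -> flex_germ Q P q p.
Proof.
move=> FF [cP cQ uP uQ d [s1 s2 s3] [n1 n2] mv]; split=> //.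
- by move=> i j t; rewrite dotC d dotC.
- split=> // i j; have [h1 h2] := s3 j i; split=> [e|e]; [exact: h1|apply: h2].
  by rewrite e opprK.
- by move=> h; apply: mv; apply: filterS h => t [].
Qed.

Section Facts.
Context {FF : ProperFilter F}.
Variables (m n : nat) (P : 'I_m -> T -> 'rV[R]_3) (Q : 'I_n -> T -> 'rV[R]_3).
Variables (p : 'I_m -> 'rV[R]_3) (q : 'I_n -> 'rV[R]_3).
Hypothesis germ : flex_germ P Q p q.

Lemma germ_unitp i : dot (p i) (p i) = 1.
Proof. by case: (germ_framework germ) => h _ _; apply: h. Qed.

Lemma germ_unitq j : dot (q j) (q j) = 1.
Proof. by case: (germ_framework germ) => _ h _; apply: h. Qed.

Lemma germ_pp i k : i != k -> dot (p i) (p k) ^+ 2 < 1.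
Proof.
move=> /eqP ik; have [h1 h2] := (germ_non_overlap germ).1 i k ik.
by apply: unit_dot_lt1; rewrite ?germ_unitp.
Qed.

Lemma germ_pq i j : dot (p i) (q j) ^+ 2 < 1.
Proof.
case: (germ_framework germ) => _ _ /(_ i j)[h1 h2].
by apply: unit_dot_lt1; rewrite ?germ_unitp ?germ_unitq.
Qed.

Lemma germ_gram_neq0 i k : i != k -> 1 - dot (p i) (p k) ^+ 2 != 0.
Proof. by move=> ik; rewrite subr_eq0 gt_eqF // germ_pp. Qed.

Lemma det3_sqr i k j t : det3 (P i t) (P k t) (Q j t) ^+ 2 =
  (hpoly (dot (p i) (q j)) (dot (p k) (q j))).[dot (P i t) (P k t)].
Proof.
rewrite hpolyE -!(germ_dot germ _ _ t) expr2 det3_mul /det9.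
rewrite !(germ_unitP germ) (germ_unitQ germ) (dotC (P k t) (P i t)).
by rewrite (dotC (Q j t) (P i t)) (dotC (Q j t) (P k t)); ring.
Qed.

Lemma det3_sqr_lim i k j : det3 (p i) (p k) (q j) ^+ 2 =
  (hpoly (dot (p i) (q j)) (dot (p k) (q j))).[dot (p i) (p k)].
Proof.
rewrite hpolyE expr2 det3_mul /det9 !germ_unitp germ_unitq (dotC (p k) (p i)).
by rewrite (dotC (q j) (p i)) (dotC (q j) (p k)); ring.
Qed.

Lemma near_det3 i k : \forall t \near F, dot (P i t) (P k t) = dot (p i) (p k) ->
  forall j, det3 (P i t) (P k t) (Q j t) = det3 (p i) (p k) (q j).
Proof.
have : \forall t \near F, forall j, det3 (P i t) (P k t) (Q j t) ^+ 2 =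
    det3 (p i) (p k) (q j) ^+ 2 ->
    det3 (P i t) (P k t) (Q j t) = det3 (p i) (p k) (q j).
  apply: filter_forall => j; apply: near_sqr_eq.
  by apply: cvg_det3; [exact: (germ_cvgP germ)|exact: (germ_cvgP germ)|exact: (germ_cvgQ germ)].
apply: filterS => t h a j; apply: h.
by rewrite det3_sqr a det3_sqr_lim.
Qed.

(** When the angle between [P i] and [P k] has its limiting value, each [Q j] has its limiting
    coordinates in their frame: the mixed products are constant, and the normal component is fixed
    up to a sign that continuity decides. *)
Lemma near_same_QQ i k : i != k ->
  \forall t \near F, dot (P i t) (P k t) = dot (p i) (p k) ->
  forall j l, dot (Q j t) (Q l t) = dot (q j) (q l).
Proof.
move=> ik; apply: filterS (near_det3 i k) => t h a j l.
apply: (mulfI (germ_gram_neq0 ik)).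
have := dot_frame (P i t) (P k t) (Q j t) (Q l t).
rewrite !(germ_unitP germ) !(germ_dot germ) a !h // mul1r => ->.
have := dot_frame (p i) (p k) (q j) (q l).
by rewrite !germ_unitp mul1r => ->.
Qed.

(* Unless the vectors [(p i1 . q j)_j] and [(p i2 . q j)_j] are proportional, the constant products
   with the [q j] fix the coefficients of every [P i] in [P i1], [P i2]; the unit norm of [P i3]
   then fixes the angle between [P i1] and [P i2], and nothing moves. *)
Lemma planar_case i1 i2 i3 : i1 != i2 -> i1 != i3 -> i2 != i3 ->
  ~ (\forall t \near F, (forall i, det3 (P i1 t) (P i2 t) (P i t) = 0) ->
       same_gram P Q p q t) ->
  SD1 p q.
Proof.
move=> i12 i13 i23 hF.
have g0 := germ_gram_neq0 i12.
have G0 : dot (p i1) (p i1) * dot (p i2) (p i2) - dot (p i1) (p i2) ^+ 2 != 0.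
  by rewrite !germ_unitp mul1r.
have planar i : det3 (p i1) (p i2) (p i) = 0.
  apply: contrapT => /eqP d0; apply: hF.
  have cv : (fun t => det3 (P i1 t) (P i2 t) (P i t)) @ F --> det3 (p i1) (p i2) (p i).
    by apply: cvg_det3; exact: (germ_cvgP germ).
  by apply: filterS (near_neq0 cv d0) => t /eqP d h; case: d.
pose x j := dot (p i1) (q j); pose y j := dot (p i2) (q j).
have [[j [l D]]|hD] := pselect (exists j l, x j * y l - x l * y j != 0); last first.
  have {}hD j l : x j * y l - x l * y j = 0.
    by apply: contrapT => /eqP h; apply: hD; exists j, l.
  have [s [r [sr h]]] : exists s r : R, ~~ ((s == 0) && (r == 0)) /\
      forall j, s * x j + r * y j = 0.
    have [[j0 h0]|h0] := pselect (exists j, ~~ ((x j == 0) && (y j == 0))).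
      exists (y j0), (- x j0); split; first by rewrite oppr_eq0 andbC.
      by move=> j; have := hD j j0; lra.
    exists 1, 0; rewrite oner_eq0; split=> // j.
    have : ~~ ~~ ((x j == 0) && (y j == 0)) by apply/negP => h; apply: h0; exists j.
    by rewrite negbK => /andP[/eqP-> _]; ring.
  (* The combination [s *: p i1 + r *: p i2] is orthogonal to every [q j] and lies in the plane of
     the [p i], hence is orthogonal to the normal of that plane. *)
  exists (cross (p i1) (p i2)), (s *: p i1 + r *: p i2); split.
  - split.
    + move=> /(congr1 (fun v => dot v v)).
      have -> : dot (cross (p i1) (p i2)) (cross (p i1) (p i2)) =
        dot (p i1) (p i1) * dot (p i2) (p i2) - dot (p i1) (p i2) ^+ 2.
        by rewrite /cross !dotE !vecE; ring.
      by rewrite dot0l; apply/eqP.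
    + move=> e; move: sr; apply/negP; rewrite negbK.
      have e1 := congr1 (dot (p i1)) e; have e2 := congr1 (dot (p i2)) e.
      rewrite !dot_lin !dot0r !germ_unitp in e1 e2; rewrite (dotC (p i2)) in e2.
      have s0 : s = 0.
        by apply: mulf_eq0_right g0; have := congr1 ( *%R (dot (p i1) (p i2))) e2; lra.
      by rewrite s0 mul0r add0r mulr1 in e2; rewrite s0 e2 !eqxx.
    + rewrite !dot_lin !cross_dot /det3; ring.
  - by move=> i; rewrite /plane /= cross_dot planar.
  - by move=> j; rewrite /plane /= !dot_lin; apply: h.
exfalso; apply: hF.
have dec i : exists uv : R * R, p i = uv.1 *: p i1 + uv.2 *: p i2.
  by have [u [v e]] := planar_decomp G0 (planar i); exists (u, v).
have [uv huv] := choice dec.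
have cv : (fun t => 1 - dot (P i1 t) (P i2 t) ^+ 2) @ F --> 1 - dot (p i1) (p i2) ^+ 2.
  apply: cvgB; first exact: cvg_cst.
  by rewrite expr2; under eq_fun do rewrite expr2; apply: cvgM; apply: cvg_dot; exact: (germ_cvgP germ).
apply: filterS2 (near_neq0 cv g0) (near_same_QQ i12) => t gt hQ hpl.
have Gt : dot (P i1 t) (P i1 t) * dot (P i2 t) (P i2 t) - dot (P i1 t) (P i2 t) ^+ 2 != 0.
  by rewrite !(germ_unitP germ) mul1r.
have PE i : P i t = (uv i).1 *: P i1 t + (uv i).2 *: P i2 t.
  have [u [v e]] := planar_decomp Gt (hpl i).
  have e1 k : u * x k + v * y k = (uv i).1 * x k + (uv i).2 * y k.
    have := germ_dot germ i k t; rewrite e huv !dot_lin !(germ_dot germ).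
    by rewrite -/(x k) -/(y k).
  have uE : u = (uv i).1.
    apply/eqP; rewrite -subr_eq0; apply/eqP; apply: mulf_eq0_right D; rewrite mulrC.
    by have := congr1 ( *%R (y l)) (e1 j); have := congr1 ( *%R (y j)) (e1 l); lra.
  have vE : v = (uv i).2.
    apply/eqP; rewrite -subr_eq0; apply/eqP; apply: mulf_eq0_right D; rewrite mulrC.
    by have := congr1 ( *%R (x l)) (e1 j); have := congr1 ( *%R (x j)) (e1 l); lra.
  by rewrite e uE vE.
have aE : dot (P i1 t) (P i2 t) = dot (p i1) (p i2).
  have := germ_unitP germ i3 t; have := germ_unitp i3.
  rewrite PE (huv i3) !dot_lin !(germ_unitP germ) !germ_unitp.
  rewrite (dotC (P i2 t) (P i1 t)) (dotC (p i2) (p i1)).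
  move: (uv i3) (huv i3) => [u v] /= e h1 h2.
  (* A zero coefficient would identify [p i3] with [p i1] or [p i2] up to sign; so the angle really
     occurs in the equation of the unit norm. *)
  have uv0 : u * v != 0.
    have [n1 n2] := (germ_non_overlap germ).1 i1 i3 (elimN eqP i13).
    have [n3 n4] := (germ_non_overlap germ).1 i2 i3 (elimN eqP i23).
    rewrite mulf_neq0 //; apply/eqP => z0; move: h1 e; rewrite z0 => h1 e.
    - have : v ^+ 2 == 1 by apply/eqP; lra.
      rewrite sqrf_eq1 => /orP[]/eqP vE; [apply: n3|apply: n4];
        by rewrite e vE scale0r add0r ?scale1r ?scaleN1r ?opprK.
    - have : u ^+ 2 == 1 by apply/eqP; lra.
      rewrite sqrf_eq1 => /orP[]/eqP vE; [apply: n1|apply: n2];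
        by rewrite e vE scale0r addr0 ?scale1r ?scaleN1r ?opprK.
  by apply: (mulfI uv0); lra.
split; last exact: hQ.
move=> i k; rewrite PE (PE k) (huv i) (huv k) !dot_lin !(germ_unitP germ) !germ_unitp.
by rewrite (dotC (P i2 t) (P i1 t)) (dotC (p i2) (p i1)) aE.
Qed.

End Facts.
End Germ.

(** * Orthogonal axes, symmetric rectangles and relations between squared lengths *)

Section Box.
Variable R : realType.
Implicit Types x y z : 'rV[R]_3.

Lemma det3_neq0_dot x y z : dot x x = 1 -> dot y y = 1 -> det3 x y z != 0 -> dot x y ^+ 2 < 1.
Proof.
move=> hx hy d0; apply: unit_dot_lt1 => // e; move/eqP: d0; apply; rewrite e /det3 ?mxE; ring.
Qed.

Lemma det3_cycle x y z : det3 x y z = det3 y z x.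
Proof. by rewrite /det3; ring. Qed.

(** This is the formula with the inverse Gram matrix of [x], [y], [z], cleared of its
    denominator. *)
Lemma gram_determines x y z u v :
  det3 x y z ^+ 2 * dot u v =
  dot u x * dot v x * (dot y y * dot z z - dot y z ^+ 2)
  + dot u y * dot v y * (dot x x * dot z z - dot x z ^+ 2)
  + dot u z * dot v z * (dot x x * dot y y - dot x y ^+ 2)
  + (dot u x * dot v y + dot u y * dot v x) * (dot x z * dot y z - dot x y * dot z z)
  + (dot u x * dot v z + dot u z * dot v x) * (dot x y * dot y z - dot x z * dot y y)
  + (dot u y * dot v z + dot u z * dot v y) * (dot x y * dot x z - dot y z * dot x x).
Proof. by rewrite /det3 !dotE; ring. Qed.

Lemma orth_expand (E1 E2 E3 x : 'rV[R]_3) :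
  dot E1 E2 = 0 -> dot E1 E3 = 0 -> dot E2 E3 = 0 ->
  E1 != 0 -> E2 != 0 -> E3 != 0 ->
  x = (dot x E1 / dot E1 E1) *: E1 + (dot x E2 / dot E2 E2) *: E2 + (dot x E3 / dot E3 E3) *: E3.
Proof.
move=> h12 h13 h23 /dot_gt0 l1 /dot_gt0 l2 /dot_gt0 l3.
have d0 : det3 E1 E2 E3 != 0.
  rewrite -sqrf_eq0 expr2 det3_mul /det9 (dotC E2 E1) (dotC E3 E1) (dotC E3 E2) h12 h13 h23.
  by rewrite !(mul0r, mulr0, subr0, addr0, subrr) !mulf_neq0 // gt_eqF.
by apply: (dots_eq d0); rewrite !dot_lin ?(dotC E2 E1) ?(dotC E3 E1) ?(dotC E3 E2) ?h12 ?h13 ?h23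
  ?mulr0 ?add0r ?addr0 divfK // gt_eqF.
Qed.

Lemma orth_comb_norm (E1 E2 E3 : 'rV[R]_3) (u v w : R) :
  dot E1 E2 = 0 -> dot E1 E3 = 0 -> dot E2 E3 = 0 ->
  dot (u *: E1 + v *: E2 + w *: E3) (u *: E1 + v *: E2 + w *: E3) =
  u ^+ 2 * dot E1 E1 + v ^+ 2 * dot E2 E2 + w ^+ 2 * dot E3 E3.
Proof.
by move=> h12 h13 h23; rewrite !dot_lin (dotC E2 E1) (dotC E3 E1) (dotC E3 E2) h12 h13 h23; ring.
Qed.

Lemma orth_norm (E1 E2 E3 x : 'rV[R]_3) :
  dot E1 E2 = 0 -> dot E1 E3 = 0 -> dot E2 E3 = 0 ->
  E1 != 0 -> E2 != 0 -> E3 != 0 ->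
  dot x x = dot x E1 ^+ 2 / dot E1 E1 + dot x E2 ^+ 2 / dot E2 E2 + dot x E3 ^+ 2 / dot E3 E3.
Proof.
move=> h12 h13 h23 n1 n2 n3.
have /lt0r_neq0 l1 := dot_gt0 n1; have /lt0r_neq0 l2 := dot_gt0 n2.
have /lt0r_neq0 l3 := dot_gt0 n3.
rewrite {1 2}(orth_expand x h12 h13 h23 n1 n2 n3) orth_comb_norm //.
by field; rewrite l1 l2 l3.
Qed.

Section Rectangle.
Variables (E1 E2 E3 : 'rV[R]_3) (r1 r2 r3 : R).
Hypotheses (h12 : dot E1 E2 = 0) (h13 : dot E1 E3 = 0) (h23 : dot E2 E3 = 0).
Hypotheses (n1 : E1 != 0) (n2 : E2 != 0) (r10 : r1 != 0) (r20 : r2 != 0).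

Definition vertex (s1 s2 : R) := (s1 * r1) *: E1 + (s2 * r2) *: E2 + r3 *: E3.

(** The vertices are listed in cyclic order, as [rectangle] requires. *)
Definition vertices : set 'rV[R]_3 :=
  [set vertex 1 1; vertex (-1) 1; vertex (-1) (-1); vertex 1 (-1)].

Lemma vertexP (s1 s2 : R) : s1 * s1 = 1 -> s2 * s2 = 1 -> vertices (vertex s1 s2).
Proof.
move=> /sign_cases[] -> /sign_cases[] ->; rewrite /vertices /=; tauto.
Qed.

Lemma verticesE x : vertices x -> exists s1 s2 : R, [/\ s1 * s1 = 1, s2 * s2 = 1 & x = vertex s1 s2].
Proof.
have N : (-1 : R) * -1 = 1 by rewrite mulrNN mulr1.
by move=> [[[|]|]|] ->; [exists 1, 1|exists (-1), 1|exists (-1), (-1)|exists 1, (-1)];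
  rewrite ?mulr1.
Qed.

Let L1 : dot E1 E1 != 0. Proof. by rewrite gt_eqF // dot_gt0. Qed.
Let L2 : dot E2 E2 != 0. Proof. by rewrite gt_eqF // dot_gt0. Qed.

Lemma dot_vertex1 s1 s2 : dot E1 (vertex s1 s2) = s1 * r1 * dot E1 E1.
Proof. by rewrite /vertex !dot_lin h12 h13; ring. Qed.

Lemma dot_vertex2 s1 s2 : dot E2 (vertex s1 s2) = s2 * r2 * dot E2 E2.
Proof. by rewrite /vertex !dot_lin (dotC E2 E1) h12 h23; ring. Qed.

Lemma reflection_vertex1 s1 s2 : reflection E1 (vertex s1 s2) = vertex (- s1) s2.
Proof.
rewrite /reflection dot_vertex1 mulrA mulfK // /vertex.
by apply: rV3P; rewrite !mxE; ring.
Qed.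

Lemma reflection_vertex2 s1 s2 : reflection E2 (vertex s1 s2) = vertex s1 (- s2).
Proof.
rewrite /reflection dot_vertex2 mulrA mulfK // /vertex.
by apply: rV3P; rewrite !mxE; ring.
Qed.

Lemma symmetric_rectangle_vertices : symmetric_rectangle E1 E2 vertices.
Proof.
have sN (s : R) : s * s = 1 -> - s * - s = 1 by rewrite mulrNN.
split.
- exists (vertex 1 1), (vertex (-1) 1), (vertex (-1) (-1)), (vertex 1 (-1)); split=> //.
  + move=> /(congr1 (dot E1)); rewrite !dot_vertex1 => /(mulIf L1)/(mulIf r10); lra.
  + move=> /(congr1 (dot E2)); rewrite !dot_vertex2 => /(mulIf L2)/(mulIf r20); lra.
  + by apply: rV3P; rewrite !mxE; ring.
  + have -> : vertex (-1) 1 - vertex 1 1 = (- 2 * r1) *: E1 by apply: rV3P; rewrite !mxE; ring.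
    have -> : vertex 1 (-1) - vertex 1 1 = (- 2 * r2) *: E2 by apply: rV3P; rewrite !mxE; ring.
    by rewrite !dot_lin h12 !mulr0.
- apply/seteqP; split=> x.
    move=> [y /verticesE[s1 [s2 [e1 e2 ->]]] <-].
    by rewrite reflection_vertex1; apply: vertexP => //; exact: sN.
  move=> /verticesE[s1 [s2 [e1 e2 ->]]].
  exists (vertex (- s1) s2); first by apply: vertexP => //; exact: sN.
  by rewrite reflection_vertex1 opprK.
- apply/seteqP; split=> x.
    move=> [y /verticesE[s1 [s2 [e1 e2 ->]]] <-].
    by rewrite reflection_vertex2; apply: vertexP => //; exact: sN.
  move=> /verticesE[s1 [s2 [e1 e2 ->]]].
  exists (vertex s1 (- s2)); first by apply: vertexP => //; exact: sN.
  by rewrite reflection_vertex2 opprK.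
- move=> x /verticesE[s1 [s2 [e1 e2 ->]]]; rewrite /plane /= dot_vertex1 dot_vertex2.
  by split; apply/eqP; rewrite !mulf_neq0 // sign_neq0.
Qed.

(** An antipode is taken exactly when it is needed to give the third coordinate the value [r3]; all
    signs of the other two coordinates occur among the four vertices. *)
Lemma antipode_vertices k (f : 'I_k -> 'rV[R]_3) (x1 x2 x3 : 'I_k -> R) :
  (forall i, f i = x1 i *: E1 + x2 i *: E2 + x3 i *: E3) ->
  (forall i, x1 i ^+ 2 = r1 ^+ 2) -> (forall i, x2 i ^+ 2 = r2 ^+ 2) ->
  (forall i, x3 i ^+ 2 = r3 ^+ 2) ->
  forall i, vertices (antipode_some (fun i => x3 i != r3) f i).
Proof.
move=> hf h1 h2 h3 i; rewrite /antipode_some.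
have [s1 ss1 e1] := sqr_eq_sign (h1 i); have [s2 ss2 e2] := sqr_eq_sign (h2 i).
have [e3|/eqP e3] := eqVneq (x3 i) r3; rewrite /= hf.
  by rewrite e1 e2 e3; apply: vertexP.
have {}e3 : x3 i = - r3.
  by have /eqP := h3 i; rewrite eqf_sqr => /orP[/eqP//|/eqP].
have -> : - (x1 i *: E1 + x2 i *: E2 + x3 i *: E3) = vertex (- s1) (- s2).
  by rewrite e1 e2 e3 /vertex; apply: rV3P; rewrite !mxE; ring.
by apply: vertexP; rewrite mulrNN.
Qed.

End Rectangle.

(* Two independent affine relations between [l1], [l2], [l3] confine them to a line,
   on which the strictly convex [B1 / l1 + B2 / l2 + B3 / l3] is not constant. *)
Lemma affine_relation_unique (T : Type) (E : set T) (l1 l2 l3 : T -> R)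
    (A1 A2 A3 G1 G2 G3 B1 B2 B3 : R) :
  (forall c0 c1 c2 c3, (forall t, E t -> c0 + c1 * l3 t + c2 * l3 t ^+ 2 + c3 * l3 t ^+ 3 = 0) ->
     [/\ c0 = 0, c1 = 0, c2 = 0 & c3 = 0]) ->
  (forall t, E t -> [/\ 0 < l1 t, 0 < l2 t & 0 < l3 t]) ->
  0 < B1 -> 0 < B2 -> 0 < B3 ->
  (forall t, E t -> A1 * l1 t + A2 * l2 t + A3 * l3 t = 1) ->
  (forall t, E t -> G1 * l1 t + G2 * l2 t + G3 * l3 t = 1) ->
  (forall t, E t -> B1 / l1 t + B2 / l2 t + B3 / l3 t = 1) ->
  [/\ A1 = G1, A2 = G2 & A3 = G3].
Proof.
move=> cub pos b1 b2 b3 hA hG hB.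
have [t0 Et0] : exists t, E t.
  apply: contrapT => h; have [] := cub 1 0 0 0.
    by move=> t Et; case: h; exists t.
  by move/eqP; rewrite oner_eq0.
pose d1 := A1 - G1; pose d2 := A2 - G2; pose d3 := A3 - G3.
have hd t : E t -> d1 * l1 t + d2 * l2 t + d3 * l3 t = 0.
  by move=> Et; have := hA t Et; have := hG t Et; rewrite /d1 /d2 /d3; lra.
suff [z1 [z2 z3]] : d1 = 0 /\ d2 = 0 /\ d3 = 0 by split; rewrite /d1 /d2 /d3 in z1 z2 z3; lra.
pose D := A1 * d2 - A2 * d1.
(* If [D = 0], eliminating [l1] and [l2] leaves relations in [l3] alone, which must be trivial;
   otherwise [l1] and [l2] are affine functions of [l3]. *)
have [D0|D0] := eqVneq D 0.
  have [z1 _ _ _] : [/\ d1 = 0, - (d1 * A3 - A1 * d3) = 0, 0 = 0 :> R & 0 = 0 :> R].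
    apply: cub => t Et.
    have := congr1 ( *%R d1) (hA t Et); have := congr1 ( *%R A1) (hd t Et).
    by have := congr1 ( *%R (l2 t)) D0; rewrite /D; lra.
  have [z2 _ _ _] : [/\ d2 = 0, - (d2 * A3 - A2 * d3) = 0, 0 = 0 :> R & 0 = 0 :> R].
    apply: cub => t Et.
    have := congr1 ( *%R d2) (hA t Et); have := congr1 ( *%R A2) (hd t Et).
    by have := congr1 ( *%R (l1 t)) D0; rewrite /D; lra.
  do 2?split=> //; have := hd t0 Et0; rewrite z1 z2 !mul0r !add0r mulrC => /mulf_eq0_right; apply.
  by have [_ _ h] := pos t0 Et0; rewrite gt_eqF.
exfalso.
pose al1 := d2 / D; pose be1 := (A2 * d3 - A3 * d2) / D.
pose al2 := - d1 / D; pose be2 := (A3 * d1 - A1 * d3) / D.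
have e1 t : E t -> l1 t = al1 + be1 * l3 t.
  move=> Et; apply: (mulfI D0); rewrite /al1 /be1.
  have -> : D * (d2 / D + (A2 * d3 - A3 * d2) / D * l3 t) = d2 + (A2 * d3 - A3 * d2) * l3 t.
    by field.
  have := congr1 ( *%R d2) (hA t Et); have := congr1 ( *%R A2) (hd t Et); rewrite /D; lra.
have e2 t : E t -> l2 t = al2 + be2 * l3 t.
  move=> Et; apply: (mulfI D0); rewrite /al2 /be2.
  have -> : D * (- d1 / D + (A3 * d1 - A1 * d3) / D * l3 t) = - d1 + (A3 * d1 - A1 * d3) * l3 t.
    by field.
  have := congr1 ( *%R d1) (hA t Et); have := congr1 ( *%R A1) (hd t Et); rewrite /D; lra.
move: al1 be1 al2 be2 e1 e2 => al1 be1 al2 be2 e1 e2.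
(* Multiplied by [l1 l2 l3], the third relation is a cubic identity in [l3]. Its extreme
   coefficients give [al1 * al2 = 0] and [be1 * be2 = 0]; then [p1] forces [l1] or [l2] to be
   identically zero, against positivity. *)
have [p0 p1 p2 p3] : [/\ B3 * (al1 * al2) = 0,
    B1 * al2 + B2 * al1 + B3 * (al1 * be2 + al2 * be1) - al1 * al2 = 0,
    B1 * be2 + B2 * be1 + B3 * (be1 * be2) - (al1 * be2 + al2 * be1) = 0 &
    - (be1 * be2) = 0].
  apply: cub => t Et; have [/lt0r_neq0 q1 /lt0r_neq0 q2 /lt0r_neq0 q3] := pos t Et.
  have := hB t Et => /(congr1 ( *%R (l1 t * l2 t * l3 t))).
  have -> : l1 t * l2 t * l3 t * (B1 / l1 t + B2 / l2 t + B3 / l3 t) =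
     B1 * (l2 t * l3 t) + B2 * (l1 t * l3 t) + B3 * (l1 t * l2 t).
    by field; rewrite q1 q2 q3.
  rewrite e1 // e2 //; lra.
have [w1 w2 w3] := pos t0 Et0; rewrite e1 // in w1; rewrite e2 // in w2.
have be0 : be1 * be2 = 0 by lra.
move/mulf_eq0_right : p0 => /(_ (lt0r_neq0 b3)) /eqP; rewrite mulf_eq0 => /orP[]/eqP al0.
  rewrite al0 add0r in w1.
  have be1p : 0 < be1 by move: w1; rewrite pmulr_lgt0.
  have be20 : be2 = 0 by apply: (mulf_eq0_right be0); rewrite lt0r_neq0.
  have al20 : al2 = 0.
    have : (B1 + B3 * be1) * al2 = 0 by rewrite al0 in p1; lra.
    by move/mulf_eq0_right; apply; rewrite gt_eqF // addr_gt0 // mulr_gt0.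
  by move: w2; rewrite al20 be20 mul0r addr0 ltxx.
rewrite al0 add0r in w2.
have be2p : 0 < be2 by move: w2; rewrite pmulr_lgt0.
have be10 : be1 = 0 by apply: mulf_eq0_right (lt0r_neq0 be2p); rewrite mulrC.
have al10 : al1 = 0.
  have : (B2 + B3 * be2) * al1 = 0 by rewrite al0 in p1; lra.
  by move/mulf_eq0_right; apply; rewrite gt_eqF // addr_gt0 // mulr_gt0.
by move: w1; rewrite al10 be10 mul0r addr0 ltxx.
Qed.

End Box.

(** * Flexes with independent triples in both parts *)

Section Independent.
Variables (R : realType) (T : Type) (F : set_system T).
Context {FF : ProperFilter F}.
Variables (m n : nat) (P : 'I_m -> T -> 'rV[R]_3) (Q : 'I_n -> T -> 'rV[R]_3).
Variables (p : 'I_m -> 'rV[R]_3) (q : 'I_n -> 'rV[R]_3).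
Hypothesis germ : flex_germ F P Q p q.
Variables (i1 i2 i3 : 'I_m) (j1 j2 j3 : 'I_n).
Hypotheses (dp : det3 (p i1) (p i2) (p i3) != 0) (dq : det3 (q j1) (q j2) (q j3) != 0).

(** The product is the determinant of the constant matrix of mixed products, so that both triples
    stay independent. *)
Lemma det3_PQ t : det3 (P i1 t) (P i2 t) (P i3 t) * det3 (Q j1 t) (Q j2 t) (Q j3 t) =
  det3 (p i1) (p i2) (p i3) * det3 (q j1) (q j2) (q j3).
Proof. by rewrite !det3_mul !(germ_dot germ). Qed.

Lemma det3_P_neq0 t : det3 (P i1 t) (P i2 t) (P i3 t) != 0.
Proof. by have := mulf_neq0 dp dq; rewrite -(det3_PQ t) mulf_eq0 negb_or => /andP[]. Qed.

Lemma det3_Q_neq0 t : det3 (Q j1 t) (Q j2 t) (Q j3 t) != 0.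
Proof. by have := mulf_neq0 dp dq; rewrite -(det3_PQ t) mulf_eq0 negb_or => /andP[]. Qed.

Lemma i1_neq_i2 : i1 != i2.
Proof. by apply: contraNneq dp => ->; rewrite /det3; apply/eqP; ring. Qed.

(** The products with three independent [Q j] are constant and determine a vector, so linear
    relations between the [P i] are carried along by the motion. *)
Lemma coef_const i : exists c1 c2 c3 : R,
  p i = c1 *: p i1 + c2 *: p i2 + c3 *: p i3 /\
  forall t, P i t = c1 *: P i1 t + c2 *: P i2 t + c3 *: P i3 t.
Proof.
pose d := det3 (p i1) (p i2) (p i3); have d0 : d != 0 := dp.
pose c1 := det3 (p i) (p i2) (p i3) / d; pose c2 := det3 (p i1) (p i) (p i3) / d.
pose c3 := det3 (p i1) (p i2) (p i) / d.
have pE : p i = c1 *: p i1 + c2 *: p i2 + c3 *: p i3.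
  apply: (scalerI d0); rewrite /d det3_expand -/d !scalerDr !scalerA.
  by rewrite /c1 /c2 /c3 ![d * _]mulrC !divfK.
exists c1, c2, c3; split=> // t.
apply: (dots_eq (det3_Q_neq0 t)); rewrite !dot_lin !(germ_dot germ) [in LHS]pE; by rewrite !dot_lin.
Qed.

Lemma same_gram_PP t : (forall j l, dot (Q j t) (Q l t) = dot (q j) (q l)) ->
  forall i k, dot (P i t) (P k t) = dot (p i) (p k).
Proof.
move=> h i k.
have dE : det3 (Q j1 t) (Q j2 t) (Q j3 t) ^+ 2 = det3 (q j1) (q j2) (q j3) ^+ 2.
  by rewrite !expr2 !det3_mul !h.
apply: (mulfI (expf_neq0 2 dq)).
rewrite (gram_determines (q j1) (q j2) (q j3) (p i) (p k)) -dE.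
by rewrite gram_determines !h !(germ_dot germ).
Qed.

(** If this product were eventually equal to its limit, [near_same_QQ] and then [same_gram_PP] would
    restore all products inside the two parts, and nothing would move. *)
Lemma freq_all : freq F (fun t => dot (P i1 t) (P i2 t)) setT.
Proof.
have cv : (fun t => dot (P i1 t) (P i2 t)) @ F --> dot (p i1) (p i2).
  by apply: cvg_dot; exact: (germ_cvgP germ).
apply: (freq_of_limit cv) => h; apply: (germ_moves germ).
apply: filterS2 h (near_same_QQ germ i1_neq_i2) => t /(_ I) a /(_ a) hQ.
by split=> //; exact: same_gram_PP.
Qed.

Lemma independent_case :
  cda_up_to_order (fun i j => dot (p i) (q j)) [:: i1; i2; i3] [:: j1; j2; j3] \/
  box_relation F (fun t => dot (P i1 t) (P i2 t)) (fun t => dot (P i1 t) (P i3 t))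
    (fun t => dot (P i2 t) (P i3 t)).
Proof.
apply: (@k33_classification R T F _ _ _ (fun i j => dot (p i) (q j)) i1 i2 i3
  (fun t => dot (P i1 t) (P i2 t)) (fun t => dot (P i1 t) (P i3 t))
  (fun t => dot (P i2 t) (P i3 t)) (fun t => det3 (P i1 t) (P i2 t) (P i3 t))
  (fun j t => det3 (P i1 t) (P i2 t) (Q j t))).
- by move=> t; apply: (det3_neq0_dot _ _ (det3_P_neq0 t)); exact: (germ_unitP germ).
- by move=> j; apply: (germ_pq germ).
- by move=> j; apply: (germ_pq germ).
- by move=> j t; apply: (det3_sqr germ).
- move=> j t; have := dot_frame (P i1 t) (P i2 t) (Q j t) (P i3 t).
  rewrite !(germ_unitP germ) !(germ_dot germ) (dotC (Q j t)) (germ_dot germ) => h.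
  rewrite -[RHS]/((1 - dot (P i1 t) (P i2 t) ^+ 2) * dot (p i3) (q j)).
  move: h; rewrite mul1r => ->; ring.
- move=> t; rewrite expr2 det3_mul /det9 !(germ_unitP germ).
  rewrite (dotC (P i2 t) (P i1 t)) (dotC (P i3 t) (P i1 t)) (dotC (P i3 t) (P i2 t)).
  ring.
- exact: freq_all.
- by rewrite /minor -det3_mul mulf_neq0.
Qed.

Hypothesis box : box_relation F (fun t => dot (P i1 t) (P i2 t)) (fun t => dot (P i1 t) (P i3 t))
    (fun t => dot (P i2 t) (P i3 t)).

Lemma box_case : PD2 p q.
Proof.
case: box => e1 [e2 [e3 [ee1 ee2 ee3]]]; set E := [set t | _] => hE.
(* [axes] below applies at the times of [E] and, by continuity, to the limit configuration. *)
pose O1 x1 : 'rV[R]_3 := e1 *: x1; pose O2 x2 : 'rV[R]_3 := e2 *: x2.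
pose O3 x3 : 'rV[R]_3 := e3 *: x3.
pose A1 (x1 x2 x3 : 'rV[R]_3) := O2 x2 + O3 x3.
pose A2 (x1 x2 x3 : 'rV[R]_3) := O1 x1 + O3 x3.
pose A3 (x1 x2 x3 : 'rV[R]_3) := O1 x1 + O2 x2.
have axes (x1 x2 x3 : 'rV[R]_3) : dot x1 x1 = 1 -> dot x2 x2 = 1 -> dot x3 x3 = 1 ->
   det3 x1 x2 x3 != 0 ->
   e1 * e2 * dot x1 x2 + e1 * e3 * dot x1 x3 + e2 * e3 * dot x2 x3 = -1 ->
   [/\ dot (A1 x1 x2 x3) (A2 x1 x2 x3) = 0, dot (A1 x1 x2 x3) (A3 x1 x2 x3) = 0,
       dot (A2 x1 x2 x3) (A3 x1 x2 x3) = 0 &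
      [/\ A1 x1 x2 x3 != 0, A2 x1 x2 x3 != 0, A3 x1 x2 x3 != 0,
        dot (A3 x1 x2 x3) (A3 x1 x2 x3) = 2 + 2 * e1 * e2 * dot x1 x2 &
       dot (A1 x1 x2 x3) (A1 x1 x2 x3) + dot (A2 x1 x2 x3) (A2 x1 x2 x3)
       + dot (A3 x1 x2 x3) (A3 x1 x2 x3) = 4]].
  move=> u1 u2 u3 d rel.
  have nz (x y z : 'rV[R]_3) (e f : R) : e * e = 1 -> f * f = 1 -> det3 x y z != 0 ->
      e *: x + f *: y != 0.
    move=> ee ff; apply: contraNneq => h.
    have xE : x = (- (e * f)) *: y.
      rewrite -[LHS]scale1r -ee -scalerA (_ : e *: x = - (f *: y)); last first.
        by apply/eqP; rewrite -addr_eq0 h.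
      by rewrite scalerN scalerA scaleNr.
    by rewrite xE /det3 !mxE; apply/eqP; ring.
  rewrite /A1 /A2 /A3 /O1 /O2 /O3; split.
  - rewrite !dot_lin ?(dotC x2 x1) ?(dotC x3 x1) ?(dotC x3 x2) u3.
    by rewrite -[RHS](subrr (e3 * e3)) {2}ee3 -[in RHS]rel; ring.
  - rewrite !dot_lin ?(dotC x2 x1) ?(dotC x3 x1) ?(dotC x3 x2) u2.
    by rewrite -[RHS](subrr (e2 * e2)) {2}ee2 -[in RHS]rel; ring.
  - rewrite !dot_lin ?(dotC x3 x1) ?(dotC x3 x2) u1.
    by rewrite -[RHS](subrr (e1 * e1)) {2}ee1 -[in RHS]rel; ring.
  split.
  - by apply: (nz _ _ x1) => //; rewrite -det3_cycle.
  - rewrite addrC; apply: (nz _ _ x2) => //; rewrite det3_cycle //.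
  - exact: (nz _ _ x3).
  - rewrite !dot_lin ?(dotC x2 x1) u1 u2.
    have -> : e1 * (e1 * 1) + e1 * (e2 * dot x1 x2) + (e2 * (e1 * dot x1 x2) + e2 * (e2 * 1))
     = e1 * e1 + e2 * e2 + 2 * e1 * e2 * dot x1 x2 by ring.
    by rewrite ee1 ee2; ring.
  - rewrite !dot_lin ?(dotC x2 x1) ?(dotC x3 x1) ?(dotC x3 x2) u1 u2 u3.
    have -> : 4 = 2 * (e1 * e1 + e2 * e2 + e3 * e3)
       + 2 * (e1 * e2 * dot x1 x2 + e1 * e3 * dot x1 x3 + e2 * e3 * dot x2 x3) :> R.
      by rewrite rel ee1 ee2 ee3; ring.
    ring.
have relp : e1 * e2 * dot (p i1) (p i2) + e1 * e3 * dot (p i1) (p i3)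
    + e2 * e3 * dot (p i2) (p i3) = -1.
  apply: contrapT => /eqP; rewrite -subr_eq0 => ne.
  have cv : (fun t => e1 * e2 * dot (P i1 t) (P i2 t) + e1 * e3 * dot (P i1 t) (P i3 t)
    + e2 * e3 * dot (P i2 t) (P i3 t) - -1) @ F --> e1 * e2 * dot (p i1) (p i2)
     + e1 * e3 * dot (p i1) (p i3) + e2 * e3 * dot (p i2) (p i3) - -1.
    apply: cvgB; last exact: cvg_cst.
    by apply: cvgD; [apply: cvgD|]; (apply: cvgM; first exact: cvg_cst); apply: cvg_dot;
      exact: (germ_cvgP germ).
  (* For the polynomial 1, [freq] says that [E] is not eventually avoided, so its defining equation
     passes to the limit. *)
  apply: (hE 1 (oner_neq0 _)); apply: filterS (near_neq0 cv ne) => t h /= e.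
  by move: h; rewrite e subrr eqxx.
pose L1 t := A1 (P i1 t) (P i2 t) (P i3 t).
pose L2 t := A2 (P i1 t) (P i2 t) (P i3 t).
pose L3 t := A3 (P i1 t) (P i2 t) (P i3 t).
pose l1 t := dot (L1 t) (L1 t); pose l2 t := dot (L2 t) (L2 t); pose l3 t := dot (L3 t) (L3 t).
have axesE t : E t -> [/\ dot (L1 t) (L2 t) = 0, dot (L1 t) (L3 t) = 0, dot (L2 t) (L3 t) = 0 &
    [/\ L1 t != 0, L2 t != 0, L3 t != 0,
      l3 t = 2 + 2 * e1 * e2 * dot (P i1 t) (P i2 t) & l1 t + l2 t + l3 t = 4]].
  by move=> Et; apply: axes => //; rewrite ?(germ_unitP germ) // det3_P_neq0.
have posE t : E t -> [/\ 0 < l1 t, 0 < l2 t & 0 < l3 t].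
  by move=> /axesE[_ _ _ [n1 n2 n3 _ _]]; split; apply: dot_gt0.
pose D1 := A1 (p i1) (p i2) (p i3); pose D2 := A2 (p i1) (p i2) (p i3).
pose D3 := A3 (p i1) (p i2) (p i3).
have [h12 h13 h23 [n1 n2 n3 _ _]] : [/\ dot D1 D2 = 0, dot D1 D3 = 0, dot D2 D3 = 0 &
    [/\ D1 != 0, D2 != 0, D3 != 0,
      dot D3 D3 = 2 + 2 * e1 * e2 * dot (p i1) (p i2) & dot D1 D1 + dot D2 D2 + dot D3 D3 = 4]].
  by apply: axes => //; rewrite ?(germ_unitp germ).
have hk1 j t : dot (Q j t) (L1 t) = dot (q j) D1.
  by rewrite /L1 /D1 /A1 /O1 /O2 /O3 !dot_lin ![dot (Q _ _) _]dotC !(germ_dot germ) ![dot (q _) _]dotC.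
have hk2 j t : dot (Q j t) (L2 t) = dot (q j) D2.
  by rewrite /L2 /D2 /A2 /O1 /O2 /O3 !dot_lin ![dot (Q _ _) _]dotC !(germ_dot germ) ![dot (q _) _]dotC.
have hk3 j t : dot (Q j t) (L3 t) = dot (q j) D3.
  by rewrite /L3 /D3 /A3 /O1 /O2 /O3 !dot_lin ![dot (Q _ _) _]dotC !(germ_dot germ) ![dot (q _) _]dotC.
have normQ j t : E t -> dot (q j) D1 ^+ 2 / l1 t + dot (q j) D2 ^+ 2 / l2 t
    + dot (q j) D3 ^+ 2 / l3 t = 1.
  move=> Et; have [a12 a13 a23 [m1 m2 m3 _ _]] := axesE t Et.
  have := germ_unitQ germ j t.
  by rewrite (orth_norm _ a12 a13 a23 m1 m2 m3) hk1 hk2 hk3.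
have cub3 c0 c1 c2 c3 : (forall t, E t -> c0 + c1 * l3 t + c2 * l3 t ^+ 2 + c3 * l3 t ^+ 3 = 0) ->
     [/\ c0 = 0, c1 = 0, c2 = 0 & c3 = 0].
  have s0 : 2 * e1 * e2 != 0 by rewrite !mulf_neq0 ?pnatr_eq0 ?(sign_neq0 ee1) ?(sign_neq0 ee2).
  move=> h; apply: (@freq_cubic R T F _ _ _ _ _ _ _ (@freq_affine R T F _ _ _ 2 _ s0 hE)) => t Et.
  by have := h t Et; have [_ _ _ [_ _ _ -> _]] := axesE t Et.
have cub3V c0 c1 c2 c3 : (forall t, E t ->
      c0 + c1 * (l3 t)^-1 + c2 * (l3 t)^-1 ^+ 2 + c3 * (l3 t)^-1 ^+ 3 = 0) ->
     [/\ c0 = 0, c1 = 0, c2 = 0 & c3 = 0].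
  move=> h; have [-> -> -> ->] : [/\ c3 = 0, c2 = 0, c1 = 0 & c0 = 0]; last by [].
  apply: cub3 => t Et; have [_ _ /lt0r_neq0 q3] := posE t Et.
  by rewrite -[RHS](mulr0 (l3 t ^+ 3)) -(h t Et); field.
(* In the inverses of the [l_k] the unit norms of the [Q j] are affine relations, while
   [l1 + l2 + l3 = 4] takes the role of the strictly convex one. *)
have sameQ j k : [/\ dot (q j) D1 ^+ 2 = dot (q k) D1 ^+ 2, dot (q j) D2 ^+ 2 = dot (q k) D2 ^+ 2
    & dot (q j) D3 ^+ 2 = dot (q k) D3 ^+ 2].
  apply: (@affine_relation_unique R T E (fun t => (l1 t)^-1) (fun t => (l2 t)^-1)
    (fun t => (l3 t)^-1) _ _ _ _ _ _ 4^-1 4^-1 4^-1 cub3V) => //;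
    rewrite ?invr_gt0 ?ltr0n //.
  - by move=> t /posE[? ? ?]; rewrite !invr_gt0.
  - exact: normQ.
  - exact: normQ.
  - move=> t Et; have [_ _ _ [_ _ _ _ s]] := axesE t Et.
    by rewrite !invrK -!mulrDr s mulVf // pnatr_eq0.
have [t0 Et0] := freq_nonempty FF hE.
(* If one [q j], hence every [q j], were orthogonal to an axis, this axis at time [t0] would be
   orthogonal to three independent vectors. *)
have posQ (D : 'rV[R]_3) (L : T -> 'rV[R]_3) : (forall j t, dot (Q j t) (L t) = dot (q j) D) ->
    L t0 != 0 -> (forall j k, dot (q j) D ^+ 2 = dot (q k) D ^+ 2) -> 0 < dot (q j1) D ^+ 2.
  move=> hL L0 hD; rewrite lt_neqAle sqr_ge0 andbT eq_sym; apply: contraNneq L0 => z.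
  have zero j : dot (L t0) (Q j t0) = dot 0 (Q j t0).
    rewrite dot0l dotC hL; apply/eqP; rewrite -sqrf_eq0; apply/eqP.
    by rewrite (hD j j1).
  by apply/eqP; apply: (dots_eq (det3_Q_neq0 t0)); exact: zero.
have [_ _ _ [m1 m2 m3 _ _]] := axesE t0 Et0.
have k1 := posQ D1 L1 hk1 m1 (fun j k => let: And3 h _ _ := sameQ j k in h).
have k2 := posQ D2 L2 hk2 m2 (fun j k => let: And3 _ h _ := sameQ j k in h).
have k3 := posQ D3 L3 hk3 m3 (fun j k => let: And3 _ _ h := sameQ j k in h).
have decP i : exists x : R * R * R,
   [/\ p i = x.1.1 *: D1 + x.1.2 *: D2 + x.2 *: D3 &
     [/\ x.1.1 ^+ 2 = 2^-1 ^+ 2, x.1.2 ^+ 2 = 2^-1 ^+ 2 & x.2 ^+ 2 = 2^-1 ^+ 2]].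
  have [c1 [c2 [c3 [pE PE]]]] := coef_const i.
  (* From [O1 = (A2 + A3 - A1) / 2] and its analogues. *)
  pose x1 := (c2 * e2 + c3 * e3 - c1 * e1) / 2; pose x2 := (c1 * e1 + c3 * e3 - c2 * e2) / 2.
  pose x3 := (c1 * e1 + c2 * e2 - c3 * e3) / 2.
  have lin (y1 y2 y3 : 'rV[R]_3) : c1 *: y1 + c2 *: y2 + c3 *: y3 =
      x1 *: A1 y1 y2 y3 + x2 *: A2 y1 y2 y3 + x3 *: A3 y1 y2 y3.
    rewrite -[c1]mulr1 -{1}ee1 -[c2 in LHS]mulr1 -{1}ee2 -[c3 in LHS]mulr1 -{1}ee3.
    by apply: rV3P; rewrite /x1 /x2 /x3 /A1 /A2 /A3 /O1 /O2 /O3 !mxE; field.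
  exists (x1, x2, x3) => /=; split; first by rewrite pE lin.
  suff [s1 s2 s3] : [/\ 4^-1 = x1 ^+ 2, 4^-1 = x2 ^+ 2 & 4^-1 = x3 ^+ 2].
    by rewrite -s1 -s2 -s3 exprVn -natrX.
  (* The unit norm of [P i] is compared with [(l1 + l2 + l3) / 4 = 1]; the convex relation is the
     norm of [Q j1]. *)
  apply: (@affine_relation_unique R T E l1 l2 l3 _ _ _ _ _ _ _ _ _ cub3 posE k1 k2 k3).
  - move=> t Et; have [_ _ _ [_ _ _ _ s]] := axesE t Et.
    by rewrite -!mulrDr s mulVf // pnatr_eq0.
  - move=> t Et; have [a12 a13 a23 _] := axesE t Et.
    by have := germ_unitP germ i t; rewrite PE lin (orth_comb_norm _ _ _ a12 a13 a23).
  - exact: normQ.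
have [x hx] := choice decP.
have l0 (D : 'rV[R]_3) : D != 0 -> dot D D != 0 by move=> /dot_gt0/lt0r_neq0.
pose y (D : 'rV[R]_3) j := dot (q j) D / dot D D.
have y0 (D : 'rV[R]_3) : D != 0 -> 0 < dot (q j1) D ^+ 2 -> y D j1 != 0.
  by move=> D0 k; rewrite mulf_neq0 ?invr_eq0 ?l0 // -sqrf_eq0 gt_eqF.
have half0 : 2^-1 != 0 :> R by rewrite invr_eq0 pnatr_eq0.
exists (fun i => (x i).2 != 2^-1), (fun j => y D3 j != y D3 j1), D1, D2,
  (vertices D1 D2 D3 2^-1 2^-1 2^-1), (vertices D1 D2 D3 (y D1 j1) (y D2 j1) (y D3 j1)); split.
- by split=> //; apply/eqP.
- exact: symmetric_rectangle_vertices.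
- by apply: symmetric_rectangle_vertices => //; apply: y0.
- by apply: (antipode_vertices (x1 := fun i => (x i).1.1) (x2 := fun i => (x i).1.2)
    (x3 := fun i => (x i).2)) => i; have [hp [s1 s2 s3]] := hx i.
- apply: (antipode_vertices (x1 := y D1) (x2 := y D2) (x3 := y D3)) => j.
  + exact: orth_expand.
  + by rewrite /y !exprMn; have [-> _ _] := sameQ j j1.
  + by rewrite /y !exprMn; have [_ -> _] := sameQ j j1.
  + by rewrite /y !exprMn; have [_ _ ->] := sameQ j j1.
Qed.

End Independent.

(** * (CDA) frameworks *)

Lemma perm_eq2 (I : eqType) (b c y z : I) : perm_eq [:: b; c] [:: y; z] ->
  (b = y /\ c = z) \/ (b = z /\ c = y).
Proof.
move=> h; have : b \in [:: y; z] by rewrite -(perm_mem h) mem_head.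
rewrite !inE => /orP[]/eqP e; move: h; rewrite e.
  by rewrite perm_cons => /perm_small_eq -/(_ isT) [->]; left.
rewrite (permPr (permEl (perm_catC [:: y] [:: z]))) /= perm_cons => /perm_small_eq -/(_ isT) [->].
by right.
Qed.

Lemma perm_eq3 (I : eqType) (a b c x y z : I) : perm_eq [:: a; b; c] [:: x; y; z] ->
  [\/ a = x /\ (b = y /\ c = z \/ b = z /\ c = y),
      a = y /\ (b = x /\ c = z \/ b = z /\ c = x) |
      a = z /\ (b = x /\ c = y \/ b = y /\ c = x)].
Proof.
move=> h; have : a \in [:: x; y; z] by rewrite -(perm_mem h) mem_head.
rewrite !inE => /or3P[]/eqP e; move: h; rewrite e.
- by rewrite perm_cons => /perm_eq2; constructor 1.
- rewrite (permPr (permEl (perm_catCA [:: x] [:: y] [:: z]))) /= perm_cons => /perm_eq2.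
  by constructor 2.
- rewrite (permPr (permEl (perm_catC [:: x; y] [:: z]))) /= perm_cons => /perm_eq2.
  by constructor 3.
Qed.

Section Combinatorics.
Variable R : realType.

Lemma collinear_unit (x y : 'rV[R]_3) (k : R) : dot x x = 1 -> dot y y = 1 ->
  x = k *: y -> x = y \/ x = - y.
Proof.
move=> hx hy e; move: (hx); rewrite e !dot_lin hy mulr1 => /sign_cases[] ->.
  by left; rewrite scale1r.
by right; rewrite scaleN1r.
Qed.

Section FourthJoint.
Variables (m n : nat) (p : 'I_m -> 'rV[R]_3) (q : 'I_n -> 'rV[R]_3).
Hypothesis up : forall i, dot (p i) (p i) = 1.
Hypothesis np : forall i k, i <> k -> p i <> p k /\ p i <> - p k.
Variables (j1 j2 j3 : 'I_n).
Hypothesis dq : det3 (q j1) (q j2) (q j3) != 0.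
Let c i j := dot (p i) (q j).
Hypothesis all_cda : forall i k l, det3 (p i) (p k) (p l) != 0 ->
  cda_up_to_order c [:: i; k; l] [:: j1; j2; j3].

(* Comparing the (CDA) patterns of the triples that contain a fourth joint forces its products with
   the [q j] to be, up to a scalar, those of one of the three joints. *)
Lemma no_fourth_joint i1 i2 i3 : det3 (p i1) (p i2) (p i3) != 0 ->
  forall i, i \in [:: i1; i2; i3].
Proof.
move=> dp i; apply: contrapT => /negP ni.
have ui : uniq [:: i1; i2; i3].
  rewrite /= !inE negb_or !andbT -andbA; apply/and3P; split; apply: contraNneq dp => ->;
    by rewrite /det3; apply/eqP; ring.
have [a0 [a1 [a2 [b0 [b1 [b2 [pa pb core]]]]]]] := all_cda dp.
move: ni; rewrite -(perm_mem pa) !inE !negb_or => /and3P[/eqP i0 /eqP ia1 /eqP ia2].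
move: ui; rewrite -(perm_uniq pa) /= !inE negb_or andbT -andbA.
move=> /and3P[/eqP a01 /eqP a02 /eqP a12].
case: core => c01 c02 c10 c20 [s1 s2 s3 s4].
have eqb (x y : 'rV[R]_3) : dot x (q b0) = dot y (q b0) -> dot x (q b1) = dot y (q b1) ->
    dot x (q b2) = dot y (q b2) -> x = y.
  move=> h0 h1 h2.
  have h j : j \in [:: j1; j2; j3] -> dot x (q j) = dot y (q j).
    by rewrite -(perm_mem pb) !inE => /or3P[]/eqP->.
  by apply: (dots_eq dq); apply: h; rewrite !inE eqxx ?orbT.
have p0 k : p k <> 0 by move=> e; have := up k; rewrite e dot0l => /eqP; rewrite eq_sym oner_eq0.
have n00 : c a0 b0 <> 0.
  by move=> h; apply: (p0 a0); apply: eqb; rewrite dot0l.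
have n11 : c a1 b1 <> 0.
  move=> h; move: s1; rewrite h expr0n /= => /esym/eqP; rewrite sqrf_eq0 => /eqP h2.
  by apply: (p0 a1); apply: eqb; rewrite dot0l.
have nz (x y : R) : x <> 0 -> x ^+ 2 = y ^+ 2 -> y <> 0.
  by move=> x0 + y0; rewrite y0 expr0n /= => /eqP; rewrite sqrf_eq0 => /eqP.
have n12 := nz _ _ n11 s1; have n21 := nz _ _ n11 s2; have n22 := nz _ _ n21 s3.
(* For an independent triple, the nonzero entries of [a1] and [a2] leave [p i] only the place of
   [p a0], to which it is then proportional. Otherwise [p i] lies in the plane of [p a1], [p a2]. *)
have [d|/eqP d] := eqVneq (det3 (p i) (p a1) (p a2)) 0; last first.
  have [ci1 ci2] : c i b1 = 0 /\ c i b2 = 0.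
    have [k0 [k1 [k2 [l0 [l1 [l2 [pk pl]]]]]]] := all_cda (introN eqP d).
    rewrite -(permPr pb) in pl.
    case=> z1 z2 z3 z4 _; have := perm_eq3 pk; have := perm_eq3 pl.
    case=> [] [? [] [? ?]] [] [? [] [? ?]]; subst; first [by split | exfalso; contradiction].
  have h : p i = (c i b0 / c a0 b0) *: p a0.
    apply: eqb; rewrite !dot_lin -/(c _ _) -/(c _ _).
    + by rewrite divfK //; apply/eqP.
    + by rewrite ci1 c01 mulr0.
    + by rewrite ci2 c02 mulr0.
  have [e|e] := collinear_unit (up i) (up a0) h.
  - by have [] := np i0.
  - by have [] := np i0.
have G12 : dot (p a1) (p a1) * dot (p a2) (p a2) - dot (p a1) (p a2) ^+ 2 != 0.
  have [h1 h2] := np a12.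
  by rewrite !up mul1r subr_eq0 gt_eqF // unit_dot_lt1.
have [u [v pE]] : exists u v : R, p i = u *: p a1 + v *: p a2.
  by apply: planar_decomp => //; rewrite -det3_cycle.
have ci0 : c i b0 = 0.
  by rewrite /c pE !dot_lin -/(c a1 b0) -/(c a2 b0) c10 c20; ring.
have v0 : v != 0.
  apply/eqP => v0; have h : p i = u *: p a1 by rewrite pE v0 scale0r addr0.
  have [e|e] := collinear_unit (up i) (up a1) h.
  - by have [] := np ia1.
  - by have [] := np ia1.
have d0 : det3 (p a0) (p a1) (p a2) != 0.
  apply/eqP => h; apply: n00.
  have [u' [v' e]] : exists u v : R, p a0 = u *: p a1 + v *: p a2.
    by apply: planar_decomp => //; rewrite -det3_cycle.
  by rewrite /c e !dot_lin -/(c a1 b0) -/(c a2 b0) c10 c20; ring.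
have di : det3 (p a0) (p a1) (p i) != 0.
  have -> : det3 (p a0) (p a1) (p i) = v * det3 (p a0) (p a1) (p a2).
    by rewrite pE /det3 !mxE; ring.
  by rewrite mulf_neq0.
(* In the triple of [a0], [a1] and [i] the fourth joint replaces [p a2]. *)
have [q1 q2] : c i b1 ^+ 2 = c a1 b1 ^+ 2 /\ c i b2 ^+ 2 = c a1 b2 ^+ 2.
  have [k0 [k1 [k2 [l0 [l1 [l2 [pk pl]]]]]]] := all_cda di.
  rewrite -(permPr pb) in pl.
  case=> z1 z2 z3 z4 [z5 z6 z7 _]; have := perm_eq3 pk; have := perm_eq3 pl.
  case=> [] [? [] [? ?]] [] [? [] [? ?]]; subst; try (exfalso; contradiction); split; lra.
have [x xx ex] := sqr_eq_sign q1; have [y yy ey] := sqr_eq_sign q2.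
have c1 : p i = x *: p a1 -> False.
  move=> h; have [e|e] := @collinear_unit (p i) (p a1) x (up i) (up a1) h.
  - by have [] := np ia1.
  - by have [] := np ia1.
(* Equal signs make [p i] a multiple of [p a1]; opposite signs make it a multiple of [p a2], because
   the rows of [a1] and [a2] differ by one relative sign. *)
have [xy|xy] := eqVneq x y.
  by apply: c1; apply: eqb; rewrite !dot_lin -/(c _ _) -/(c _ _) ?ci0 ?c10 ?mulr0 // ey xy.
have {}xy : y = - x.
  by move: xy; have [->|->] := sign_cases xx; have [->|->] := sign_cases yy;
    rewrite ?opprK // eqxx.
have [k kk ek] := sqr_eq_sign (esym s2).
have e22 : c a2 b2 = - k * c a1 b2.
  apply: (mulfI (introN eqP n12)).
  have -> : c a1 b2 * (- k * c a1 b2) = - (k * c a1 b2 ^+ 2) by ring.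
  by rewrite -s1; move: s4; rewrite ek; lra.
have h : p i = (x * k) *: p a2.
  apply: eqb; rewrite !dot_lin -/(c _ _) -/(c _ _).
  + by rewrite ci0 c20 mulr0.
  + by rewrite ek ex mulrA -[x * k * k]mulrA kk mulr1.
  + by rewrite e22 ey xy mulrA mulrN -[x * k * k]mulrA kk mulr1.
by have [e|e] := collinear_unit (up i) (up a2) h; have [] := np ia2.
Qed.
End FourthJoint.

End Combinatorics.

Section CDAPattern.
Variable R : realType.

(** An odd number of negative entries is a condition symmetric in rows and columns; in the given
    form it has to be divided by an entry, whence the separate case of zero. *)
Lemma cda_core_transpose (I J : Type) (c : I -> J -> R) i0 i1 i2 j0 j1 j2 :
  cda_core c i0 i1 i2 j0 j1 j2 -> cda_core (fun j i => c i j) j0 j1 j2 i0 i1 i2.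
Proof.
case=> c01 c02 c10 c20 [s1 s2 s3 s4]; split=> //; split=> //; try lra.
have [z|nz] := eqVneq (c i1 j1) 0.
  have z2 : c i2 j2 = 0.
    by apply/eqP; rewrite -sqrf_eq0 -s3 -s2 z expr0n.
  by rewrite z z2 mul0r mulr0 oppr0.
have nz' : c i2 j1 != 0 by rewrite -sqrf_eq0 -s2 sqrf_eq0.
apply: (mulfI nz').
have := congr1 ( *%R (c i1 j2)) s4; have := congr1 ( *%R (c i2 j2)) s1.
have := congr1 ( *%R (c i2 j2)) s2; lra.
Qed.

Lemma cda_transpose (I J : eqType) (c : I -> J -> R) i j :
  cda_up_to_order c i j -> cda_up_to_order (fun j i => c i j) j i.
Proof.
move=> [i0 [i1 [i2 [j0 [j1 [j2 [pi pj h]]]]]]].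
by exists j0, j1, j2, i0, i1, i2; split=> //; exact: cda_core_transpose h.
Qed.

(** When the block is nonzero, exactly one of its four entries differs in sign from the other three.
    The relative signs [a] and [k] locate it, and the renumbering brings it to the pair [p_1],
    [q_2]. *)
Lemma CDA_of_core (m n : nat) (p : 'I_m -> 'rV[R]_3) (q : 'I_n -> 'rV[R]_3) i0 i1 i2 j0 j1 j2 :
  m = 3 -> n = 3 -> uniq [:: i0; i1; i2] -> uniq [:: j0; j1; j2] ->
  cda_core (fun i j => dot (p i) (q j)) i0 i1 i2 j0 j1 j2 -> CDA p q.
Proof.
move=> m3 n3 ui uj [c01 c02 c10 c20 [s1 s2 s3 s4]].
have ui' : uniq [:: i0; i2; i1].
  by rewrite -(perm_uniq (s1 := [:: i0; i1; i2])) // perm_cons (permEl (perm_catC [:: i1] [:: i2])).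
have uj' : uniq [:: j0; j2; j1].
  by rewrite -(perm_uniq (s1 := [:: j0; j1; j2])) // perm_cons (permEl (perm_catC [:: j1] [:: j2])).
split=> //.
have D j i : dot (q j) (p i) = dot (p i) (q j) := dotC _ _.
have [a aa ea] := sqr_eq_sign s1; have [b bb eb] := sqr_eq_sign s3.
have [k kk ek] := sqr_eq_sign (esym s2).
have [z|nz] := eqVneq (dot (p i1) (q j2)) 0.
  have z11 : dot (p i1) (q j1) = 0 by rewrite ea z mulr0.
  have z21 : dot (p i2) (q j1) = 0 by rewrite ek z11 mulr0.
  have z22 : dot (p i2) (q j2) = 0 by apply/eqP; rewrite -sqrf_eq0 -s3 z21 expr0n.
  exists i0, i1, i2, j0, j1, j2; rewrite !D; split=> //.
  by rewrite z11 z21 z22 z oppr0.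
have e22 : dot (p i2) (q j2) = - k * dot (p i1) (q j2).
  apply: (mulfI nz); rewrite mulrCA mulNr -expr2 -s1.
  by move: s4; rewrite ek; lra.
have [aE|aE] := sign_cases aa; have [kE|kE] := sign_cases kk; rewrite aE in ea; rewrite kE in ek e22.
- exists i0, i2, i1, j0, j1, j2; rewrite !D; split=> //; rewrite ek e22 ea; by split; ring.
- exists i0, i2, i1, j0, j2, j1; rewrite !D; split=> //; rewrite ek e22 ea; by split; ring.
- exists i0, i1, i2, j0, j1, j2; rewrite !D; split=> //; rewrite ek e22 ea; by split; ring.
- exists i0, i1, i2, j0, j2, j1; rewrite !D; split=> //; rewrite ek e22 ea; by split; ring.
Qed.

End CDAPattern.

(** * Flexible frameworks are of one of the three types *)

Section GermTheorem.
Variables (R : realType).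

Lemma SD1_swap (m n : nat) (p : 'I_m -> 'rV[R]_3) (q : 'I_n -> 'rV[R]_3) :
  SD1 q p -> SD1 p q.
Proof.
by move=> [u [v [[u0 v0 uv] hq hp]]]; exists v, u; split=> //; split=> //; rewrite dotC.
Qed.

Lemma three_ordinals n : (2 < n)%N -> exists i1 i2 i3 : 'I_n, [/\ i1 != i2, i1 != i3 & i2 != i3].
Proof.
move=> h; exists (Ordinal (ltn_trans (ltn_trans (ltn0Sn 0) (ltnSn 1)) h)), (Ordinal (ltn_trans (ltnSn 1) h)),
  (Ordinal h); by [].
Qed.

Lemma ordinals_of_three n (i1 i2 i3 : 'I_n) : (2 < n)%N ->
  (forall i, i \in [:: i1; i2; i3]) -> n = 3.
Proof.
move=> h2 h; apply/eqP; rewrite eqn_leq h2 andbT -[n in (n <= _)%N](size_enum_ord n).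
by apply: (uniq_leq_size (s2 := [:: i1; i2; i3])); [exact: enum_uniq|move=> i _; apply: h].
Qed.

Lemma germ_classification (T : Type) (F : set_system T) (FF : ProperFilter F) (m n : nat)
    (P : 'I_m -> T -> 'rV[R]_3) (Q : 'I_n -> T -> 'rV[R]_3) p q :
  (2 < m)%N -> (2 < n)%N -> flex_germ F P Q p q -> SD1 p q \/ PD2 p q \/ CDA p q.
Proof.
move=> hm hn germ.
have unip := germ_unitp germ; have uniq_ := germ_unitq germ.
have [[i1 [i2 [i3 [j1 [j2 [j3 [dp dq]]]]]]]|none] := pselect (exists i1 i2 i3 j1 j2 j3,
    det3 (p i1) (p i2) (p i3) != 0 /\ det3 (q j1) (q j2) (q j3) != 0); last first.
  left; have [i1 [i2 [i3 [i12 i13 i23]]]] := three_ordinals hm.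
  have [j1 [j2 [j3 [j12 j13 j23]]]] := three_ordinals hn.
  have [hP|hP] := pselect (\forall t \near F,
      (forall i, det3 (P i1 t) (P i2 t) (P i t) = 0) -> same_gram P Q p q t); last first.
    exact: (planar_case germ i12 i13 i23 hP).
  apply: SD1_swap; apply: (planar_case (germ_swap _ germ) j12 j13 j23) => hQ.
  apply: (germ_moves germ); apply: filterS2 hP hQ => t hP hQ.
  have [/hP//|/existsNP[i /eqP hi]] := pselect (forall i, det3 (P i1 t) (P i2 t) (P i t) = 0).
  (* The product of a determinant of the [P] and one of the [Q] keeps its limiting value, which is
     zero by [none]; one independent [P] triple therefore makes all [Q] triples dependent at this
     time. *)
  suff /hQ[] : forall j, det3 (Q j1 t) (Q j2 t) (Q j t) = 0 by [].
  move=> j; apply: (mulfI hi); rewrite mulr0 det3_mul !(germ_dot germ) -det3_mul.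
  apply/eqP; apply/negP => /negP; rewrite mulf_eq0 negb_or => /andP[d1 d2].
  by apply: none; exists i1, i2, i, j1, j2, j.
right.
have [[k1 [k2 [k3 [l1 [l2 [l3 [dk dl box]]]]]]]|nobox] := pselect (exists i1 i2 i3 j1 j2 j3,
    [/\ det3 (p i1) (p i2) (p i3) != 0, det3 (q j1) (q j2) (q j3) != 0 &
    box_relation F (fun t => dot (P i1 t) (P i2 t)) (fun t => dot (P i1 t) (P i3 t))
    (fun t => dot (P i2 t) (P i3 t))]).
  by left; exact: (box_case germ dk dl box).
right.
have cda k1 k2 k3 l1 l2 l3 : det3 (p k1) (p k2) (p k3) != 0 -> det3 (q l1) (q l2) (q l3) != 0 ->
    cda_up_to_order (fun i j => dot (p i) (q j)) [:: k1; k2; k3] [:: l1; l2; l3].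
  move=> dk dl; have [//|box] := independent_case germ dk dl.
  by case: nobox; exists k1, k2, k3, l1, l2, l3.
have [n1 n2] := germ_non_overlap germ.
have m3 : m = 3.
  apply: (ordinals_of_three hm).
  by apply: (no_fourth_joint unip n1 dq _ dp) => k1 k2 k3 dk; exact: cda.
have n3 : n = 3.
  apply: (ordinals_of_three hn).
  apply: (no_fourth_joint uniq_ n2 dp _ dq) => k1 k2 k3 dk.
  have := cda_transpose (cda _ _ _ _ _ _ dp dk).
  by congr (cda_up_to_order _ _ _); apply/funext => j; apply/funext => i; rewrite dotC.
have [i1' [i2' [i3' [j1' [j2' [j3' [pi pj core]]]]]]] := cda _ _ _ _ _ _ dp dq.
have det_uniq k (f : 'I_k -> 'rV[R]_3) (a b c : 'I_k) : det3 (f a) (f b) (f c) != 0 -> uniq [:: a; b; c].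
  move=> d; rewrite /= !inE negb_or !andbT -andbA; apply/and3P; split;
    apply: contraNneq d => ->; by rewrite /det3; apply/eqP; ring.
apply: CDA_of_core m3 n3 _ _ core.
  by rewrite (perm_uniq pi) (det_uniq _ p).
by rewrite (perm_uniq pj) (det_uniq _ q).
Qed.

Lemma flexible_classification (m n : nat) (p : 'I_m -> 'rV[R]_3) (q : 'I_n -> 'rV[R]_3) :
  (2 < m)%N -> (2 < n)%N -> spherical_framework p q -> P2_non_overlapping p q ->
  flexible p q -> SD1 p q \/ PD2 p q \/ CDA p q.
Proof.
move=> hm hn hf hno [P [Q [[cP cQ] hS [P0 Q0] hd [[a [b fixed]] [s sI ms]]]]].
have [sp sq spq] := hf.
have unip i : dot (p i) (p i) = 1 by apply: sp.
have uniq_ j : dot (q j) (q j) = 1 by apply: sq.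
pose I : set R := [set` `[0, 1]].
have dots i j t : I t -> dot (P i t) (Q j t) = dot (p i) (q j).
  move=> It; have := hd i j t It; rewrite P0 Q0 /dS => /(congr1 cos).
  have bnd (x y : 'rV[R]_3) : dot x x = 1 -> dot y y = 1 -> dot x y \in `[-1, 1].
    by move=> hx hy; have := unit_dot_bound hx hy => h; rewrite in_itv /=; apply/andP; split; nra.
  have [hP hQ] := hS t It.
  by rewrite !acosK //; apply: bnd => //; [apply: hP|apply: hQ].
pose still t := (forall i, P i t = p i) /\ (forall j, Q j t = q j).
pose M := [set t | I t /\ ~ still t].
have Ms : M s.
  split=> // -[h1 h2]; case: ms => [[i]|[j]]; [rewrite h1 P0|rewrite h2 Q0] => h; exact: h.
have lbM : lbound M 0 by move=> t [+ _]; rewrite /I /= in_itv /= => /andP[].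
have infM : has_inf M by split; [exists s|exists 0].
pose t1 := inf M.
have t1_lb t : M t -> t1 <= t by move=> Mt; apply: ge_inf Mt; exists 0.
have It1 : I t1.
  rewrite /I /= in_itv /=; apply/andP; split; first by apply: lb_le_inf => //; exists s.
  by apply: le_trans (t1_lb s Ms) _; move: sI; rewrite in_itv /= => /andP[].
pose F := within I (nbhs t1).
have FF : ProperFilter F.
  by apply: within_nbhs_proper; apply: subset_closure.
have cvgPF i : P i @ F --> P i t1 by have /subspace_continuousP/(_ t1 It1) := cP i.
have cvgQF j : Q j @ F --> Q j t1 by have /subspace_continuousP/(_ t1 It1) := cQ j.
have ballF (B : set R) : F B -> exists2 e : R, 0 < e & forall t, I t -> `|t1 - t| < e -> B t.
  by move=> /nbhs_ballP[e e0 h]; exists e => // t It te; apply: h.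
(* A joint displaced at [t1] would by continuity be displaced slightly earlier, against the choice
   of [t1] as infimum. *)
have not_moved (f : R -> 'rV[R]_3) x : f @ F --> f t1 -> f 0 = x ->
    (forall t, I t -> f t <> x -> M t) -> f t1 = x.
  move=> cf f0 hM; apply: contrapT => nx.
  have /near_neq0 : (fun t => dot (f t - x) (f t - x)) @ F --> dot (f t1 - x) (f t1 - x).
    by apply: cvg_dot; apply: cvgB => //; exact: cvg_cst.
  have d0 : dot (f t1 - x) (f t1 - x) != 0.
    by apply/eqP => /dot_eq0/eqP; rewrite subr_eq0 => /eqP.
  move=> /(_ d0)/ballF[e e0 he].
  have t10 : 0 < t1.
    move: It1; rewrite /I /= in_itv /= => /andP[h _]; rewrite lt_neqAle h andbT.
    by apply/eqP => z; apply: nx; rewrite -z.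
  pose d := Num.min (e / 2) t1.
  have dP : 0 < d by rewrite lt_min t10 divr_gt0.
  have de : d < e by rewrite gt_min; apply/orP; left; lra.
  have dt : d <= t1 by rewrite ge_min lexx orbT.
  have It : I (t1 - d).
    move: It1; rewrite /I /= !in_itv /= => /andP[h1 h2]; apply/andP; split; lra.
  have : M (t1 - d).
    apply: hM => // fx; have := he _ It; rewrite fx subrr dot0l eqxx.
    by rewrite opprB addrC subrK gtr0_norm // => /(_ de).
  by move/t1_lb; lra.
have Pt1 i : P i t1 = p i.
  by apply: not_moved => // t It h; split=> // -[h1 _]; apply: h; apply: h1.
have Qt1 j : Q j t1 = q j.
  by apply: not_moved => // t It h; split=> // -[_ h1]; apply: h; apply: h1.
(* Outside the unit interval the joints are put at rest, so that the equations of a germ hold at all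
   times. *)
pose P' i t := if t \in `[0, 1] then P i t else p i.
pose Q' j t := if t \in `[0, 1] then Q j t else q j.
have FI : F I by apply: (@filterE _ (nbhs t1) _ [set t | I t -> I t]) => t; exact: id.
have cvgP' i : P' i @ F --> p i.
  rewrite -Pt1; apply: cvg_trans (cvgPF i); apply: near_eq_cvg.
  by apply: filterS FI => t /= It; rewrite /P' It.
have cvgQ' j : Q' j @ F --> q j.
  rewrite -Qt1; apply: cvg_trans (cvgQF j); apply: near_eq_cvg.
  by apply: filterS FI => t /= It; rewrite /Q' It.
have uP' i t : dot (P' i t) (P' i t) = 1.
  by rewrite /P'; case: ifP => [It|_] //; have [h _] := hS t It; apply: h.
have uQ' j t : dot (Q' j t) (Q' j t) = 1.
  by rewrite /Q'; case: ifP => [It|_] //; have [_ h] := hS t It; apply: h.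
have fixP t : P' a t = p a.
  by rewrite /P'; case: ifP => [It|_] //; have [-> _] := fixed t It; rewrite P0.
have fixQ t : Q' b t = q b.
  by rewrite /Q'; case: ifP => [It|_] //; have [_ ->] := fixed t It; rewrite Q0.
have d' i j t : dot (P' i t) (Q' j t) = dot (p i) (q j).
  by rewrite /P' /Q'; case: ifP => [It|_] //; apply: dots.
have G0 : dot (p a) (p a) * dot (q b) (q b) - dot (p a) (q b) ^+ 2 != 0.
  rewrite unip uniq_ mul1r subr_eq0 gt_eqF //; apply: unit_dot_lt1 => //;
  by have [] := spq a b.
(* Relative to the resting joints [p a] and [q b], a unit vector with given products is determined
   up to a reflection, and continuity excludes the mirror image. *)
have near_frame (f : R -> 'rV[R]_3) x : f @ F --> x -> dot x x = 1 -> (forall t, dot (f t) (f t) = 1) ->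
    \forall t \near F, dot (p a) (f t) = dot (p a) x -> dot (q b) (f t) = dot (q b) x -> f t = x.
  move=> cf ux uf.
  have : (fun t => det3 (p a) (q b) (f t)) @ F --> det3 (p a) (q b) x.
    by apply: cvg_det3 => //; exact: cvg_cst.
  move/near_sqr_eq; apply: filterS => t h ha hb; apply: (frame_eq G0) => //; apply: h.
  rewrite !expr2 !det3_mul /det9 ux uf ha hb (dotC (f t) (p a)) (dotC (f t) (q b)) ha hb.
  by rewrite (dotC x (p a)) (dotC x (q b)).
apply: (@germ_classification R F FF m n P' Q') => //; split=> //.
move=> hF.
have nP : \forall t \near F, forall i, dot (p a) (P' i t) = dot (p a) (p i) ->
    dot (q b) (P' i t) = dot (q b) (p i) -> P' i t = p i.
  by apply: filter_forall => i; apply: near_frame.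
have nQ : \forall t \near F, forall j, dot (p a) (Q' j t) = dot (p a) (q j) ->
    dot (q b) (Q' j t) = dot (q b) (q j) -> Q' j t = q j.
  by apply: filter_forall => j; apply: near_frame.
have : F [set t | still t].
  apply: filterS3 (filterI FI hF) nP nQ => t /= [It [gP gQ]] {}nP {}nQ.
  split=> [i|j].
    have : P' i t = P i t by rewrite /P' It.
    by move=> <-; apply: nP; [have := gP a i; rewrite fixP|
      have := d' i b t; rewrite fixQ dotC (dotC (p i))].
  have : Q' j t = Q j t by rewrite /Q' It.
  by move=> <-; apply: nQ; [have := d' a j t; rewrite fixP|have := gQ b j; rewrite fixQ].
(* Rest on a neighbourhood of [t1] contradicts that times of [M] lie arbitrarily close to their
   infimum. *)
move=> /ballF[e e0 he].
have [x Mx xe] := inf_adherent e0 infM.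
have := t1_lb x Mx; case: Mx => Ix nx xl; apply: nx; apply: he => //.
by rewrite distrC ger0_norm; rewrite /t1 in xl *; lra.
Qed.
End GermTheorem.

(** * Motions *)

Section Motions.
Variable R : realType.
Implicit Types x y z : 'rV[R]_3.

(* The isometry carrying the frame of [a], [b] to that of [pa], [qb]. *)
Definition carry (pa qb a b x : 'rV[R]_3) : 'rV[R]_3 :=
  ((dot a x - dot pa qb * dot b x) / (1 - dot pa qb ^+ 2)) *: pa
  + ((dot b x - dot pa qb * dot a x) / (1 - dot pa qb ^+ 2)) *: qb
  + (det3 a b x / (1 - dot pa qb ^+ 2)) *: cross pa qb.

Section Carry.
Variables (pa qb a b : 'rV[R]_3).
Hypotheses (upa : dot pa pa = 1) (uqb : dot qb qb = 1) (g1 : 1 - dot pa qb ^+ 2 != 0).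
Hypotheses (ua : dot a a = 1) (ub : dot b b = 1) (ab : dot a b = dot pa qb).

Lemma dot_carry x y : dot (carry pa qb a b x) (carry pa qb a b y) = dot x y.
Proof.
have c1 : dot pa (cross pa qb) = 0 by rewrite dotC cross_dot /det3; ring.
have c2 : dot qb (cross pa qb) = 0 by rewrite dotC cross_dot /det3; ring.
have cc : dot (cross pa qb) (cross pa qb) = 1 - dot pa qb ^+ 2.
  have -> : dot (cross pa qb) (cross pa qb) = dot pa pa * dot qb qb - dot pa qb ^+ 2.
    by rewrite /cross !dotE !vecE; ring.
  by rewrite upa uqb mul1r.
have := dot_frame a b x y; rewrite ua ub ab mul1r => /(canRL (mulKf g1)) ->.
rewrite /carry !dot_lin ![dot (cross _ _) _]dotC !(dotC qb pa) c1 c2 cc upa uqb.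
by field.
Qed.

Lemma carry_a : carry pa qb a b a = pa.
Proof.
rewrite /carry ua (dotC b a) ab (_ : det3 a b a = 0); last by rewrite /det3; ring.
by rewrite mulr1 subrr !mul0r !scale0r !addr0 -expr2 divff // scale1r.
Qed.

Lemma carry_b : carry pa qb a b b = qb.
Proof.
rewrite /carry ub ab (_ : det3 a b b = 0); last by rewrite /det3; ring.
by rewrite mulr1 subrr !mul0r !scale0r !addr0 add0r -expr2 divff // scale1r.
Qed.

Lemma carry_id x : carry pa qb pa qb x = x.
Proof.
apply: (@frame_eq _ pa qb); rewrite ?upa ?uqb ?mul1r //.
- rewrite /carry !dot_lin upa (dotC pa (cross _ _)) cross_dot.
  by rewrite (_ : det3 pa qb pa = 0) ?mulr0; [field|rewrite /det3; ring].
- rewrite /carry !dot_lin uqb (dotC qb pa) (dotC qb (cross _ _)) cross_dot.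
  by rewrite (_ : det3 pa qb qb = 0) ?mulr0; [field|rewrite /det3; ring].
- rewrite -!cross_dot /carry !dot_lin !cross_dot.
  rewrite (_ : det3 pa qb pa = 0) ?mulr0; last by rewrite /det3; ring.
  rewrite (_ : det3 pa qb qb = 0) ?mulr0; last by rewrite /det3; ring.
  rewrite (_ : det3 pa qb (cross pa qb) = dot pa pa * dot qb qb - dot pa qb ^+ 2); last first.
    by rewrite /det3 /cross !dotE !vecE; ring.
  by rewrite upa uqb mul1r !add0r divfK.
Qed.
End Carry.

(** [carry] preserves all scalar products, and if every carried joint were back at time 1, the
    products inside both parts would be unchanged. *)
Lemma flexible_of_motion (m n : nat) (p : 'I_m -> 'rV[R]_3) (q : 'I_n -> 'rV[R]_3)
    (P : 'I_m -> R -> 'rV[R]_3) (Q : 'I_n -> R -> 'rV[R]_3) (a : 'I_m) (b : 'I_n) :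
  spherical_framework p q ->
  (forall i, P i 0 = p i) -> (forall j, Q j 0 = q j) ->
  (forall i (t : R), 0 <= t <= 1 -> P i @ t --> P i t) ->
  (forall j (t : R), 0 <= t <= 1 -> Q j @ t --> Q j t) ->
  (forall t : R, 0 <= t <= 1 -> [/\ forall i, dot (P i t) (P i t) = 1,
     forall j, dot (Q j t) (Q j t) = 1 & forall i j, dot (P i t) (Q j t) = dot (p i) (q j)]) ->
  ~ same_gram P Q p q 1 -> flexible p q.
Proof.
move=> [sp sq spq] P0 Q0 cP cQ inv nsame.
have up i : dot (p i) (p i) = 1 by apply: sp.
have uq j : dot (q j) (q j) = 1 by apply: sq.
have g1 : 1 - dot (p a) (q b) ^+ 2 != 0.
  by have [h1 h2] := spq a b; rewrite subr_eq0 gt_eqF // unit_dot_lt1.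
pose N (f : R -> 'rV[R]_3) t := carry (p a) (q b) (P a t) (Q b t) (f t).
have I01 (t : R) : t \in `[0, 1] -> 0 <= t <= 1 by rewrite in_itv.
have contN (f : R -> 'rV[R]_3) : (forall t : R, 0 <= t <= 1 -> f @ t --> f t) ->
    {within `[0, 1], continuous (N f)}.
  move=> cf; apply: continuous_in_subspaceT => t; rewrite inE /= => /I01 It.
  apply: cvgD; [apply: cvgD|]; apply: cvgZr_tmp; (apply: cvgM; last exact: cvg_cst).
  - apply: cvgB; first by apply: cvg_dot; [exact: cP|exact: cf].
    by apply: cvgM; [exact: cvg_cst|apply: cvg_dot; [exact: cQ|exact: cf]].
  - apply: cvgB; first by apply: cvg_dot; [exact: cQ|exact: cf].
    by apply: cvgM; [exact: cvg_cst|apply: cvg_dot; [exact: cP|exact: cf]].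
  - by apply: cvg_det3; [exact: cP|exact: cQ|exact: cf].
have N0 (f : R -> 'rV[R]_3) : N f 0 = f 0 by rewrite /N P0 Q0 carry_id.
have dotN (f g : R -> 'rV[R]_3) t : 0 <= t <= 1 -> dot (N f t) (N g t) = dot (f t) (g t).
  by move=> /inv[h1 h2 h3]; rewrite /N dot_carry.
exists (fun i => N (P i)), (fun j => N (Q j)); split.
- by split=> [i|j]; apply: contN => t; [exact: cP|exact: cQ].
- move=> t /I01 It; have [h1 h2 h3] := inv t It.
  by split=> [i|j]; rewrite /S2 /= dotN.
- by split=> [i|j]; rewrite N0.
- move=> i j t /I01 It; rewrite /dS dotN // dotN ?lexx ?ler01 // P0 Q0.
  by have [_ _ ->] := inv t It.
- have fixed t : 0 <= t <= 1 -> N (P a) t = p a /\ N (Q b) t = q b.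
    by move=> It; have [h1 h2 h3] := inv t It; rewrite /N carry_a // carry_b.
  split.
    by exists a, b => t /I01 /fixed[-> ->]; rewrite !N0 P0 Q0.
  have I1 : 0 <= (1 : R) <= 1 by rewrite ler01 lexx.
  exists 1; first by rewrite in_itv.
  apply: contrapT => /not_orP[/forallNP nP /forallNP nQ]; apply: nsame; split=> [i k|j l].
    rewrite -dotN //.
    by rewrite (contrapT (nP i)) (contrapT (nP k)) !N0 !P0.
  by rewrite -dotN // (contrapT (nQ j)) (contrapT (nQ l)) !N0 !Q0.
Qed.

Lemma flexible_swap (m n : nat) (p : 'I_m -> 'rV[R]_3) (q : 'I_n -> 'rV[R]_3) :
  flexible q p -> flexible p q.
Proof.
move=> [Q [P [[cQ cP] hS [Q0 P0] hd [[j [i fixed]] [t It mv]]]]].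
exists P, Q; split=> //.
- by move=> s /hS[].
- by move=> k l s Is; rewrite /dS dotC -/(dS _ _) hd // /dS dotC.
- split; first by exists i, j => s /fixed[].
  by exists t => //; case: mv; [right|left].
Qed.

Definition orthonormal (f1 f2 f3 : 'rV[R]_3) :=
  [/\ dot f1 f1 = 1, dot f2 f2 = 1, dot f3 f3 = 1 &
   [/\ dot f1 f2 = 0, dot f1 f3 = 0 & dot f2 f3 = 0]].

Definition comb (f1 f2 f3 : 'rV[R]_3) (u v w : R) := u *: f1 + v *: f2 + w *: f3.

Section Frame.
Variables (f1 f2 f3 : 'rV[R]_3).
Hypothesis hf : orthonormal f1 f2 f3.

Lemma unit_neq0 x : dot x x = 1 -> x != 0.
Proof. by move=> h; apply/eqP => x0; move/eqP: h; rewrite x0 dot0l eq_sym oner_eq0. Qed.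

Lemma orthonormal_expand x : x = comb f1 f2 f3 (dot x f1) (dot x f2) (dot x f3).
Proof.
case: hf => u1 u2 u3 [h12 h13 h23].
rewrite {1}(orth_expand x h12 h13 h23 (unit_neq0 u1) (unit_neq0 u2) (unit_neq0 u3)).
by rewrite u1 u2 u3 !divr1.
Qed.

Lemma dot_comb u v w u' v' w' :
  dot (comb f1 f2 f3 u v w) (comb f1 f2 f3 u' v' w') = u * u' + v * v' + w * w'.
Proof.
case: hf => u1 u2 u3 [h12 h13 h23].
by rewrite /comb !dot_lin u1 u2 u3 (dotC f2 f1) (dotC f3 f1) (dotC f3 f2) h12 h13 h23; ring.
Qed.

Lemma dot_expand x y : dot x y = dot x f1 * dot y f1 + dot x f2 * dot y f2 + dot x f3 * dot y f3.
Proof. by rewrite {1}(orthonormal_expand x) {1}(orthonormal_expand y) dot_comb. Qed.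

End Frame.

Lemma cvg_comb (f1 f2 f3 : 'rV[R]_3) (u v w : R -> R) (t : R) :
  u @ t --> u t -> v @ t --> v t -> w @ t --> w t ->
  (fun t => comb f1 f2 f3 (u t) (v t) (w t)) @ t --> comb f1 f2 f3 (u t) (v t) (w t).
Proof.
by move=> hu hv hw; apply: cvgD; [apply: cvgD|]; apply: cvgZr_tmp.
Qed.

Lemma orthonormal_cross (f1 f2 : 'rV[R]_3) : dot f1 f1 = 1 -> dot f2 f2 = 1 -> dot f1 f2 = 0 ->
  orthonormal (cross f1 f2) f1 f2.
Proof.
move=> u1 u2 h; split=> //; last split=> //.
- have -> : dot (cross f1 f2) (cross f1 f2) = dot f1 f1 * dot f2 f2 - dot f1 f2 ^+ 2.
    by rewrite /cross !dotE !vecE; ring.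
  by rewrite u1 u2 h; ring.
- by rewrite cross_dot /det3; ring.
- by rewrite cross_dot /det3; ring.
Qed.

Definition normalize x := (Num.sqrt (dot x x))^-1 *: x.

Lemma dot_normalize x y : dot (normalize x) y = dot x y / Num.sqrt (dot x x).
Proof. by rewrite dotZl mulrC. Qed.

Lemma sqrt_dot_gt0 x : x != 0 -> 0 < Num.sqrt (dot x x).
Proof. by move=> x0; rewrite sqrtr_gt0 dot_gt0. Qed.

Lemma normalize_unit x : x != 0 -> dot (normalize x) (normalize x) = 1.
Proof.
move=> x0; rewrite dot_normalize dotC dot_normalize -mulrA -invfM -expr2.
by rewrite sqr_sqrtr ?dot_ge0 // divff // gt_eqF // dot_gt0.
Qed.

(* Unlike [Num.sg], a sign that is never [0]. *)
Definition sg1 (y : R) : R := if y < 0 then -1 else 1.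

Lemma sg1K (y : R) : sg1 y * Num.sqrt (y ^+ 2) = y.
Proof.
rewrite sqrtr_sqr /sg1; case: ltP => h; first by rewrite ltr0_norm // mulN1r opprK.
by rewrite ger0_norm // mul1r.
Qed.

Lemma sg1_sqr (y : R) : sg1 y ^+ 2 = 1.
Proof. by rewrite /sg1; case: ifP => _; rewrite ?sqrrN expr1n. Qed.

Lemma sg1_sqrt (y d : R) : 0 <= d -> (sg1 y * Num.sqrt d) * (sg1 y * Num.sqrt d) = d.
Proof. by move=> d0; rewrite mulrACA -!expr2 sg1_sqr mul1r sqr_sqrtr. Qed.

Lemma cvg_sqrt (u : R -> R) (t : R) : u @ t --> u t -> (fun t => Num.sqrt (u t)) @ t --> Num.sqrt (u t).
Proof. by move=> hu; apply: (cvg_comp u Num.sqrt hu); exact: sqrt_continuous. Qed.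

Lemma small_parameter (B : set R) : (\forall t \near (0 : R), B t) ->
  exists2 d : R, 0 < d & forall t, 0 <= t <= d -> B t.
Proof.
move=> /nbhs_ballP[e /= e0 h]; exists (e / 2); first by rewrite divr_gt0.
move=> t /andP[t0 te]; apply: h; rewrite /ball /= sub0r normrN ger0_norm //.
by apply: le_lt_trans te _; lra.
Qed.

End Motions.

(** * Flexibility under (SD1) *)

Section Dixon1.
Variable R : realType.

(** The coordinates along [f1] are multiplied by [s] for the [p i] and divided by [s] for the [q j].
    With [s >= 1] the roots for the [q j] stay real, and the strict bound on the [p i] leaves room
    for [s] to grow. *)
Lemma orthogonal_circles_flexible (m n : nat) (p : 'I_m -> 'rV[R]_3) (q : 'I_n -> 'rV[R]_3)
    (f1 f2 f3 : 'rV[R]_3) (i1 i2 : 'I_m) (b : 'I_n) :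
  orthonormal f1 f2 f3 -> spherical_framework p q ->
  (forall i, dot (p i) f3 = 0) -> (forall j, dot (q j) f2 = 0) ->
  (forall i, dot (p i) f1 ^+ 2 < 1) -> dot (p i1) (p i2) ^+ 2 < 1 ->
  flexible p q.
Proof.
move=> hf fw p3 q2 px g12.
have [sp sq _] := fw.
pose x i := dot (p i) f1; pose y i := dot (p i) f2.
pose X j := dot (q j) f1; pose Z j := dot (q j) f3.
have pxy i : x i ^+ 2 + y i ^+ 2 = 1.
  have : dot (p i) (p i) = 1 by apply: sp.
  by rewrite (dot_expand hf) p3 mulr0 addr0 -!expr2.
have qxz j : X j ^+ 2 + Z j ^+ 2 = 1.
  have : dot (q j) (q j) = 1 by apply: sq.
  by rewrite (dot_expand hf) q2 mulr0 addr0 -!expr2.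
have [d d0 hd] : exists2 d : R, 0 < d & forall t, 0 <= t <= d -> forall i, (1 + t) ^+ 2 * x i ^+ 2 < 1.
  suff : \forall t \near (0 : R), forall i, (1 + t) ^+ 2 * x i ^+ 2 < 1 by move/small_parameter.
  apply: (@filter_forall R _ (fun i (t : R) => (1 + t) ^+ 2 * x i ^+ 2 < 1) (nbhs (0 : R))) => i.
  have cv : (fun t : R => (1 + t) ^+ 2 * x i ^+ 2) @ (0 : R) --> (1 + 0) ^+ 2 * x i ^+ 2.
    apply: cvgM; last exact: cvg_cst.
    rewrite expr2; under eq_fun do rewrite expr2.
    by apply: cvgM; apply: cvgD; [exact: cvg_cst|exact: cvg_id|exact: cvg_cst|exact: cvg_id].
  by apply: (cvgr_lt _ cv); rewrite addr0 expr1n mul1r; apply: px.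
pose s (t : R) := 1 + d * t.
have s1 t : 0 <= t <= 1 -> 1 <= s t.
  by move=> /andP[t0 t1]; rewrite /s lerDl mulr_ge0 // ltW.
have s0 t : 0 <= t <= 1 -> s t != 0 by move=> /s1 h; rewrite gt_eqF // (lt_le_trans ltr01).
have sx t i : 0 <= t <= 1 -> 0 <= 1 - s t ^+ 2 * x i ^+ 2.
  move=> /andP[t0 t1]; rewrite subr_ge0 ltW //; apply: hd.
  by apply/andP; split; [rewrite mulr_ge0 // ltW|rewrite ler_piMr // ltW].
have sX t j : 0 <= t <= 1 -> 0 <= 1 - (X j / s t) ^+ 2.
  move=> /s1 h; rewrite subr_ge0 expr_div_n.
  have h2 : 1 <= s t ^+ 2 by rewrite exprn_ege1.
  rewrite ler_pdivrMr ?(lt_le_trans ltr01) // mul1r (le_trans _ h2) //.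
  by have := qxz j; have := sqr_ge0 (Z j); lra.
pose P i t := comb f1 f2 f3 (s t * x i) (sg1 (y i) * Num.sqrt (1 - s t ^+ 2 * x i ^+ 2)) 0.
pose Q j t := comb f1 f2 f3 (X j / s t) 0 (sg1 (Z j) * Num.sqrt (1 - (X j / s t) ^+ 2)).
have cs (t : R) : s @ t --> s t.
  by apply: cvgD; [exact: cvg_cst|apply: cvgM; [exact: cvg_cst|exact: cvg_id]].
apply: (@flexible_of_motion R m n p q P Q i1 b fw).
- move=> i; rewrite /P /s mulr0 addr0 expr1n !mul1r.
  have -> : 1 - x i ^+ 2 = y i ^+ 2 by rewrite -(pxy i); ring.
  by rewrite sg1K -(p3 i) -(orthonormal_expand hf).
- move=> j; rewrite /Q /s mulr0 addr0 divr1.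
  have -> : 1 - X j ^+ 2 = Z j ^+ 2 by rewrite -(qxz j); ring.
  by rewrite sg1K -(q2 j) -(orthonormal_expand hf).
- move=> i t It; apply: cvg_comb; last exact: cvg_cst.
    by apply: cvgM; [exact: cs|exact: cvg_cst].
  apply: cvgM; first exact: cvg_cst.
  apply: cvg_sqrt; apply: cvgB; first exact: cvg_cst.
  by apply: cvgM; [rewrite expr2; under eq_fun do rewrite expr2; apply: cvgM; exact: cs|exact: cvg_cst].
- move=> j t It.
  have cX : (fun t => X j / s t) @ t --> X j / s t.
    by apply: cvgM; [exact: cvg_cst|apply: cvgV; [exact: s0|exact: cs]].
  apply: cvg_comb; [exact: cX|exact: cvg_cst|].
  apply: cvgM; first exact: cvg_cst.
  apply: cvg_sqrt; apply: cvgB; first exact: cvg_cst.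
  by rewrite expr2; under eq_fun do rewrite expr2; apply: cvgM.
- move=> t It; split.
  + by move=> i; rewrite /P (dot_comb hf) sg1_sqrt ?sx //; ring.
  + by move=> j; rewrite /Q (dot_comb hf) sg1_sqrt ?sX //; ring.
  + move=> i j; rewrite /P /Q (dot_comb hf) (dot_expand hf) p3 q2 -/(x i) -/(X j).
    by have := s0 t It => st; field.
move=> [/(_ i1 i2) same _]; have I1 : 0 <= (1 : R) <= 1 by rewrite ler01 lexx.
have h1 := sg1_sqrt (y i1) (sx 1 i1 I1); have h2 := sg1_sqrt (y i2) (sx 1 i2 I1).
move: same; rewrite /P (dot_comb hf); set Y1 := sg1 (y i1) * _ in h1 *; set Y2 := sg1 (y i2) * _ in h2 *.
set g := dot (p i1) (p i2) in g12 * => same.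
have gE : g = x i1 * x i2 + y i1 * y i2 by rewrite /g (dot_expand hf) !p3 mulr0 addr0.
have e1 : (g - s 1 ^+ 2 * (x i1 * x i2)) ^+ 2 = (1 - s 1 ^+ 2 * x i1 ^+ 2) * (1 - s 1 ^+ 2 * x i2 ^+ 2).
  by rewrite -h1 -h2 -same; ring.
have e2 : (g - x i1 * x i2) ^+ 2 = (1 - x i1 ^+ 2) * (1 - x i2 ^+ 2).
  have hy i : 1 - x i ^+ 2 = y i ^+ 2 by rewrite -(pxy i); ring.
  by rewrite gE !hy; ring.
have ss : 0 < s 1 ^+ 2 - 1.
  by rewrite subr_gt0 exprn_egt1 // /s mulr1 ltrDl.
(* Subtracting [e2] from [e1] leaves [s 1 ^+ 2 - 1] times this positive definite form. Both [x] then
   vanish, and [e2] gives [g ^+ 2 = 1]. *)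
have e3 : (x i1 - g * x i2) ^+ 2 + (1 - g ^+ 2) * x i2 ^+ 2 = 0.
  by apply: (mulf_eq0_right _ (lt0r_neq0 ss)); move: e1 e2; clear; lra.
have g0 : 0 <= 1 - g ^+ 2 by rewrite subr_ge0 ltW.
move/eqP: e3; rewrite (paddr_eq0 (sqr_ge0 _) (mulr_ge0 g0 (sqr_ge0 _))).
rewrite sqrf_eq0 mulf_eq0 sqrf_eq0 => /andP[/eqP z1 /orP[/eqP z2|/eqP z2]].
  by move: g12; rewrite -subr_gt0 z2 ltxx.
have z1' : x i1 = 0 by rewrite z2 in z1; lra.
by move: e2 g12; rewrite z1' z2; lra.
Qed.

Lemma SD1_flexible (m n : nat) (p : 'I_m -> 'rV[R]_3) (q : 'I_n -> 'rV[R]_3) :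
  (2 < m)%N -> (2 < n)%N -> spherical_framework p q -> P2_non_overlapping p q ->
  SD1 p q -> flexible p q.
Proof.
move=> hm hn fw [n1 n2] [u [v [[u0 v0 uv] hp hq]]].
have [sp sq spq] := fw.
have up i : dot (p i) (p i) = 1 by apply: sp.
have uq j : dot (q j) (q j) = 1 by apply: sq.
have nu : u != 0 by apply/eqP. have nv : v != 0 by apply/eqP.
pose f2 := normalize v; pose f3 := normalize u; pose f1 := cross f2 f3.
have [w1 w2 w3 [w12 w13 w23]] : orthonormal f1 f2 f3.
  apply: orthonormal_cross; [exact: normalize_unit|exact: normalize_unit|].
  by rewrite dot_normalize dotC dot_normalize uv !mul0r.
have p3 i : dot (p i) f3 = 0 by rewrite dotC dot_normalize (hp i) mul0r.
have q2 j : dot (q j) f2 = 0 by rewrite dotC dot_normalize (hq j) mul0r.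
pose i1 : 'I_m := Ordinal (ltn_trans (ltn_trans (ltn0Sn 0) (ltnSn 1)) hm).
pose i2 : 'I_m := Ordinal (ltn_trans (ltnSn 1) hm).
pose j1 : 'I_n := Ordinal (ltn_trans (ltn_trans (ltn0Sn 0) (ltnSn 1)) hn).
pose j2 : 'I_n := Ordinal (ltn_trans (ltnSn 1) hn).
have [pl|] := pselect (forall i, dot (p i) f1 ^+ 2 < 1).
  apply: (@orthogonal_circles_flexible m n p q f1 f2 f3 i1 i2 j1) => //.
  by have [] := n1 i1 i2 _ => // h1 h2; apply: unit_dot_lt1.
(* A joint [p i] on the common axis blocks the scaling; then no [q j] lies on that axis, and the
   roles of the parts are exchanged. *)
move=> /existsNP[i hi]; apply: flexible_swap.
have pf : p i = f1 \/ p i = - f1.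
  apply: contrapT => /not_orP[h1 h2]; apply: hi; exact: unit_dot_lt1.
apply: (@orthogonal_circles_flexible n m q p f1 f3 f2 j1 j2 i1) => //.
- by split=> //; split=> //; rewrite dotC.
- split=> // j k; have [h1 h2] := spq k j; split=> [e|e]; [exact: h1|apply: h2].
  by rewrite e opprK.
- move=> j; have [h1 h2] := spq i j; apply: unit_dot_lt1 => // e.
    by case: pf => pe; [apply: h1|apply: h2]; rewrite e pe.
  by case: pf => pe; [apply: h2|apply: h1]; rewrite e pe ?opprK.
- by have [] := n2 j1 j2 _ => // h1 h2; apply: unit_dot_lt1.
Qed.

End Dixon1.

(** * Flexibility under (CDA) *)

Section CDAMotion.
Variable R : realType.

Lemma ordinal3_cases n (i0 i1 i2 i : 'I_n) : n = 3 -> uniq [:: i0; i1; i2] ->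
  [\/ i = i0, i = i1 | i = i2].
Proof.
move=> n3 u.
have sub : {subset [:: i0; i1; i2] <= enum 'I_n} by move=> x _; rewrite mem_enum.
have le : (size (enum 'I_n) <= size [:: i0; i1; i2])%N by rewrite size_enum_ord; apply: eq_leq.
have [_ /(_ i)] := uniq_min_size u sub le.
rewrite mem_enum => /eqP; rewrite eqb_id !inE => /or3P[]/eqP; by [constructor 1|constructor 2|constructor 3].
Qed.

(* In the frame with third axis [p i0] and first two axes along [q j1 + q j2], [q j1 - q j2] the joints
   [q j1], [q j2] are [(al, be, 0)], [(al, - be, 0)], and the other joints are determined by
   [be ^ 2], which serves as the parameter. *)
Lemma cda_motion (m n : nat) (p : 'I_m -> 'rV[R]_3) (q : 'I_n -> 'rV[R]_3)
    (i0 i1 i2 : 'I_m) (j0 j1 j2 : 'I_n) (f1 f2 f3 : 'rV[R]_3)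
    (al be c e z1 z2 ka : R) :
  m = 3 -> n = 3 -> uniq [:: i0; i1; i2] -> uniq [:: j0; j1; j2] ->
  orthonormal f1 f2 f3 -> spherical_framework p q ->
  0 < al -> 0 < be -> al ^+ 2 + be ^+ 2 = 1 -> c != 0 ->
  p i0 = comb f1 f2 f3 0 0 1 -> p i1 = comb f1 f2 f3 0 (c / be) z1 -> p i2 = comb f1 f2 f3 (c / al) 0 z2 ->
  q j0 = comb f1 f2 f3 (- e * al * z2 / c) (- e * be * z1 / c) e ->
  q j1 = comb f1 f2 f3 al be 0 -> q j2 = comb f1 f2 f3 al (- be) 0 ->
  c ^+ 2 <= be ^+ 2 + ka <= 1 - c ^+ 2 -> ka != 0 ->
  flexible p q.
Proof.
move=> m3 n3 ui uj hf fw al0 be0 albe c0 p0E p1E p2E q0E q1E q2E hka ka0.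
have [sp sq spq] := fw.
have up i : dot (p i) (p i) = 1 by apply: sp.
have uq j : dot (q j) (q j) = 1 by apply: sq.
have c2 : 0 < c ^+ 2 by rewrite lt_neqAle sqr_ge0 andbT eq_sym sqrf_eq0.
have u1 : c ^+ 2 / be ^+ 2 + z1 ^+ 2 = 1.
  by have := up i1; rewrite p1E (dot_comb hf) -expr_div_n => <-; ring.
have u2 : c ^+ 2 / al ^+ 2 + z2 ^+ 2 = 1.
  by have := up i2; rewrite p2E (dot_comb hf) -expr_div_n => <-; ring.
have cbe : c ^+ 2 <= be ^+ 2.
  have : c ^+ 2 / be ^+ 2 <= 1 by rewrite -u1 lerDl sqr_ge0.
  by rewrite ler_pdivrMr ?mul1r // exprn_gt0.
have cal : c ^+ 2 <= al ^+ 2.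
  have : c ^+ 2 / al ^+ 2 <= 1 by rewrite -u2 lerDl sqr_ge0.
  by rewrite ler_pdivrMr ?mul1r // exprn_gt0.
(* The unit norm of [q j0] in a form free of [al] and [be]; hence it persists when these vary. *)
have u0 : e ^+ 2 * (c ^+ 2)^-1 = 1 + e ^+ 2.
  have := uq j0; rewrite q0E (dot_comb hf) => h.
  have h1 : z1 ^+ 2 = 1 - c ^+ 2 / be ^+ 2 by rewrite -u1; ring.
  have h2 : z2 ^+ 2 = 1 - c ^+ 2 / al ^+ 2 by rewrite -u2; ring.
  have : 1 = e ^+ 2 / c ^+ 2 * (al ^+ 2 * z2 ^+ 2 + be ^+ 2 * z1 ^+ 2) + e ^+ 2.
    by rewrite -{1}h; field.
  rewrite h1 h2; have -> : al ^+ 2 * (1 - c ^+ 2 / al ^+ 2) + be ^+ 2 * (1 - c ^+ 2 / be ^+ 2)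
     = al ^+ 2 + be ^+ 2 - 2 * c ^+ 2.
    by field; rewrite !gt_eqF.
  rewrite albe => h3.
  have : e ^+ 2 / c ^+ 2 = e ^+ 2 / c ^+ 2 * (1 - 2 * c ^+ 2) + 2 * e ^+ 2 by field.
  by lra.
(* The segment from [be ^+ 2] to [be ^+ 2 + ka] stays between [c ^+ 2] and [1 - c ^+ 2], which is
   where [Z1] and [Z2] are real. *)
pose si (t : R) := be ^+ 2 + ka * t.
have siI t : 0 <= t <= 1 -> c ^+ 2 <= si t /\ c ^+ 2 <= 1 - si t.
  move=> /andP[t0 t1]; move/andP: hka => [k1 k2].
  have t1' : 0 <= 1 - t by lra.
  rewrite /si; split.
    have : 0 <= t * (be ^+ 2 + ka - c ^+ 2) by rewrite mulr_ge0 // subr_ge0.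
    have : 0 <= (1 - t) * (be ^+ 2 - c ^+ 2) by rewrite mulr_ge0 // subr_ge0.
    lra.
  have : 0 <= t * (1 - c ^+ 2 - (be ^+ 2 + ka)) by rewrite mulr_ge0 // subr_ge0.
  have : 0 <= (1 - t) * (al ^+ 2 - c ^+ 2) by rewrite mulr_ge0 // subr_ge0.
  have -> : al ^+ 2 = 1 - be ^+ 2 by lra.
  lra.
pose B t := Num.sqrt (si t); pose A t := Num.sqrt (1 - si t).
pose Z1 t := sg1 z1 * Num.sqrt (1 - c ^+ 2 / si t).
pose Z2 t := sg1 z2 * Num.sqrt (1 - c ^+ 2 / (1 - si t)).
have B2 t : 0 <= t <= 1 -> B t ^+ 2 = si t.
  by move=> /siI[h _]; rewrite sqr_sqrtr // (le_trans _ h) // ltW.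
have A2 t : 0 <= t <= 1 -> A t ^+ 2 = 1 - si t.
  by move=> /siI[_ h]; rewrite sqr_sqrtr // (le_trans _ h) // ltW.
have s0 t : 0 <= t <= 1 -> si t != 0.
  by move=> /siI[h _]; rewrite gt_eqF // (lt_le_trans c2).
have s1 t : 0 <= t <= 1 -> 1 - si t != 0.
  by move=> /siI[_ h]; rewrite gt_eqF // (lt_le_trans c2).
have B0 t : 0 <= t <= 1 -> B t != 0.
  by move=> It; rewrite -sqrf_eq0 B2 // s0.
have A0 t : 0 <= t <= 1 -> A t != 0.
  by move=> It; rewrite -sqrf_eq0 A2 // s1.
have Z1s t : 0 <= t <= 1 -> Z1 t * Z1 t = 1 - c ^+ 2 / si t.
  move=> /siI[h _]; rewrite sg1_sqrt // subr_ge0 ler_pdivrMr ?mul1r //.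
  exact: lt_le_trans c2 h.
have Z2s t : 0 <= t <= 1 -> Z2 t * Z2 t = 1 - c ^+ 2 / (1 - si t).
  move=> /siI[_ h]; rewrite sg1_sqrt // subr_ge0 ler_pdivrMr ?mul1r //.
  exact: lt_le_trans c2 h.
pose P i t := if i == i0 then comb f1 f2 f3 0 0 1 else if i == i1 then comb f1 f2 f3 0 (c / B t) (Z1 t)
  else comb f1 f2 f3 (c / A t) 0 (Z2 t).
pose Q j t := if j == j0 then comb f1 f2 f3 (- e * A t * Z2 t / c) (- e * B t * Z1 t / c) e
  else if j == j1 then comb f1 f2 f3 (A t) (B t) 0 else comb f1 f2 f3 (A t) (- B t) 0.
have [i10 i20 i21] : [/\ i1 == i0 = false, i2 == i0 = false & i2 == i1 = false].
  move: ui; rewrite /= !inE negb_or !andbT -andbA => /and3P[h1 h2 h3].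
  by split; apply/negbTE; rewrite eq_sym.
have [j10 j20 j21] : [/\ j1 == j0 = false, j2 == j0 = false & j2 == j1 = false].
  move: uj; rewrite /= !inE negb_or !andbT -andbA => /and3P[h1 h2 h3].
  by split; apply/negbTE; rewrite eq_sym.
have PE0 t : P i0 t = comb f1 f2 f3 0 0 1 by rewrite /P eqxx.
have PE1 t : P i1 t = comb f1 f2 f3 0 (c / B t) (Z1 t) by rewrite /P i10 eqxx.
have PE2 t : P i2 t = comb f1 f2 f3 (c / A t) 0 (Z2 t) by rewrite /P i20 i21.
have QE0 t : Q j0 t = comb f1 f2 f3 (- e * A t * Z2 t / c) (- e * B t * Z1 t / c) e.
  by rewrite /Q eqxx.
have QE1 t : Q j1 t = comb f1 f2 f3 (A t) (B t) 0 by rewrite /Q j10 eqxx.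
have QE2 t : Q j2 t = comb f1 f2 f3 (A t) (- B t) 0 by rewrite /Q j20 j21.
have p_cases i := ordinal3_cases i m3 ui.
have q_cases j := ordinal3_cases j n3 uj.
have BE : B 0 = be by rewrite /B /si mulr0 addr0 sqrtr_sqr gtr0_norm.
have AE : A 0 = al.
  rewrite /A /si mulr0 addr0; have -> : 1 - be ^+ 2 = al ^+ 2 by lra.
  by rewrite sqrtr_sqr gtr0_norm.
have Z1E : Z1 0 = z1.
  rewrite /Z1 /si mulr0 addr0; have -> : 1 - c ^+ 2 / be ^+ 2 = z1 ^+ 2 by lra.
  exact: sg1K.
have Z2E : Z2 0 = z2.
  rewrite /Z2 /si mulr0 addr0; have -> : 1 - be ^+ 2 = al ^+ 2 by lra.
  have -> : 1 - c ^+ 2 / al ^+ 2 = z2 ^+ 2 by lra.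
  exact: sg1K.
have csi (t : R) : si @ t --> si t.
  by apply: cvgD; [exact: cvg_cst|apply: cvgM; [exact: cvg_cst|exact: cvg_id]].
have cB (t : R) : B @ t --> B t by apply: cvg_sqrt.
have csi1 (t : R) : (fun t => 1 - si t) @ t --> 1 - si t by apply: cvgB; [exact: cvg_cst|exact: csi].
have cA (t : R) : A @ t --> A t by apply: cvg_sqrt.
have cZ1 (t : R) : 0 <= t <= 1 -> Z1 @ t --> Z1 t.
  move=> It; apply: cvgM; first exact: cvg_cst.
  apply: cvg_sqrt; apply: cvgB; first exact: cvg_cst.
  by apply: cvgM; [exact: cvg_cst|apply: cvgV; [exact: s0|exact: csi]].
have cZ2 (t : R) : 0 <= t <= 1 -> Z2 @ t --> Z2 t.
  move=> It; apply: cvgM; first exact: cvg_cst.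
  apply: cvg_sqrt; apply: cvgB; first exact: cvg_cst.
  by apply: cvgM; [exact: cvg_cst|apply: cvgV; [exact: s1|exact: csi1]].
apply: (@flexible_of_motion R m n p q P Q i0 j0 fw).
- by move=> i; case: (p_cases i) => ->; rewrite ?PE0 ?PE1 ?PE2 ?BE ?AE ?Z1E ?Z2E.
- by move=> j; case: (q_cases j) => ->; rewrite ?QE0 ?QE1 ?QE2 ?BE ?AE ?Z1E ?Z2E.
- move=> i t It; rewrite /P; case: ifP => _; first exact: cvg_cst.
  case: ifP => _; apply: cvg_comb; try exact: cvg_cst; try exact: cZ1; try exact: cZ2.
    by apply: cvgM; [exact: cvg_cst|apply: cvgV; [exact: B0|exact: cB]].
  by apply: cvgM; [exact: cvg_cst|apply: cvgV; [exact: A0|exact: cA]].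
- move=> j t It; rewrite /Q; case: ifP => _.
    apply: cvg_comb; last exact: cvg_cst; (apply: cvgM; last exact: cvg_cst).
      by apply: cvgM; [apply: cvgM; [exact: cvg_cst|exact: cA]|exact: cZ2].
    by apply: cvgM; [apply: cvgM; [exact: cvg_cst|exact: cB]|exact: cZ1].
  case: ifP => _; apply: cvg_comb; try exact: cvg_cst; try exact: cA; try exact: cB.
  by apply: cvgN; exact: cB.
- move=> t It; have b0 := B0 t It; have a0 := A0 t It.
  have b2 := B2 t It; have a2 := A2 t It; have y1 := Z1s t It; have y2 := Z2s t It.
  rewrite -a2 in y2; rewrite -b2 in y1.
  have ab : A t ^+ 2 + B t ^+ 2 = 1 by rewrite a2 b2; ring.
  have y1' : B t ^+ 2 * (Z1 t * Z1 t) = B t ^+ 2 - c ^+ 2 by rewrite y1; field.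
  have y2' : A t ^+ 2 * (Z2 t * Z2 t) = A t ^+ 2 - c ^+ 2 by rewrite y2; field.
  split.
  + move=> i; case: (p_cases i) => ->; rewrite ?PE0 ?PE1 ?PE2.
    * by rewrite -p0E.
    * by rewrite (dot_comb hf) y1; field.
    * by rewrite (dot_comb hf) y2; field.
  + move=> j; case: (q_cases j) => ->; rewrite ?QE0 ?QE1 ?QE2 (dot_comb hf).
    * have -> : - e * A t * Z2 t / c * (- e * A t * Z2 t / c)
       + - e * B t * Z1 t / c * (- e * B t * Z1 t / c) + e * e
       = e ^+ 2 / c ^+ 2 * (A t ^+ 2 * (Z2 t * Z2 t) + B t ^+ 2 * (Z1 t * Z1 t)) + e ^+ 2.
        by field.
      rewrite y1' y2' addrACA ab.
      have -> : e ^+ 2 / c ^+ 2 * (1 + (- c ^+ 2 - c ^+ 2)) = e ^+ 2 / c ^+ 2 - 2 * e ^+ 2.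
        by field.
      by rewrite u0; ring.
    * by rewrite mulr0 addr0 -!expr2.
    * by rewrite mulr0 addr0 mulrNN -!expr2.
  + have ala : al != 0 by rewrite gt_eqF. have bea : be != 0 by rewrite gt_eqF.
    move=> i j; case: (p_cases i) => ->; case: (q_cases j) => ->;
      rewrite ?PE0 ?PE1 ?PE2 ?QE0 ?QE1 ?QE2 ?p0E ?p1E ?p2E ?q0E ?q1E ?q2E !(dot_comb hf);
      field; do ?[apply/andP; split] => //.
- move=> [_ /(_ j1 j2)]; rewrite QE1 QE2 q1E q2E !(dot_comb hf).
  have I1 : 0 <= (1 : R) <= 1 by rewrite ler01 lexx.
  have -> : A 1 * A 1 + B 1 * - B 1 + 0 * 0 = A 1 ^+ 2 - B 1 ^+ 2 by ring.
  rewrite A2 // B2 // /si mulr1 => h.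
  by move/eqP: ka0; apply; lra.
Qed.

End CDAMotion.

Section CDAFlexible.
Variable R : realType.

Lemma CDA_flexible (m n : nat) (p : 'I_m -> 'rV[R]_3) (q : 'I_n -> 'rV[R]_3) :
  spherical_framework p q -> P2_non_overlapping p q -> CDA p q -> flexible p q.
Proof.
move=> fw nov [m3 n3 [i0 [i1 [i2 [j0 [j1 [j2 [ui uj [c1 c2 c3] [h01 h10] [h02 h20]]]]]]]]].
have [sp sq spq] := fw; have [n1 n2] := nov.
have up i : dot (p i) (p i) = 1 by apply: sp.
have uq j : dot (q j) (q j) = 1 by apply: sq.
have p_cases i := ordinal3_cases i m3 ui.
have q_cases j := ordinal3_cases j n3 uj.
have [i01 j12] : i0 <> i1 /\ j1 <> j2.
  move: ui uj; rewrite /= !inE !negb_or !andbT -andbA => /and3P[/eqP a _ _] /andP[_ /eqP b].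
  by split.
set c := dot (p i1) (q j1) in c1.
have c21 : dot (p i2) (q j1) = c by rewrite dotC.
have c22 : dot (p i2) (q j2) = c by rewrite -c2 dotC.
have c12 : dot (p i1) (q j2) = - c by rewrite dotC -[LHS]opprK -c3 c22.
rewrite dotC in h10; rewrite dotC in h20.
pose e := dot (p i0) (q j0).
(* If [p i0] and [q j0] are orthogonal, they are normals of two planes as in (SD1). *)
have [e0|e0] := eqVneq e 0.
  apply: SD1_flexible => //; rewrite ?m3 ?n3 //.
  exists (q j0), (p i0); split.
  - split; last by rewrite dotC.
      by apply/eqP; exact: unit_neq0.
    by apply/eqP; exact: unit_neq0.
  - by move=> i; rewrite /plane /= dotC; case: (p_cases i) => ->.
  - by move=> j; rewrite /plane /=; case: (q_cases j) => ->.
have [q12 q12'] := n2 _ _ j12.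
pose d1 := q j1 + q j2; pose d2 := q j1 - q j2; pose g := dot (q j1) (q j2).
have d10 : d1 != 0 by rewrite addr_eq0; apply/eqP.
have d20 : d2 != 0 by rewrite subr_eq0; apply/eqP.
have l1 := sqrt_dot_gt0 d10; have l2 := sqrt_dot_gt0 d20.
pose al := Num.sqrt (dot d1 d1) / 2; pose be := Num.sqrt (dot d2 d2) / 2.
have al0 : 0 < al by rewrite divr_gt0.
have be0 : 0 < be by rewrite divr_gt0.
have al2 : al ^+ 2 = (1 + g) / 2.
  by rewrite expr_div_n sqr_sqrtr ?dot_ge0 // /d1 !dot_lin !uq (dotC (q j2)) -/g; field.
have be2 : be ^+ 2 = (1 - g) / 2.
  by rewrite expr_div_n sqr_sqrtr ?dot_ge0 // /d2 !dot_lin !uq (dotC (q j2)) -/g; field.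
have s1 : Num.sqrt (dot d1 d1) = 2 * al by rewrite /al; field.
have s2 : Num.sqrt (dot d2 d2) = 2 * be by rewrite /be; field.
have ala : al != 0 by rewrite gt_eqF.
have bea : be != 0 by rewrite gt_eqF.
pose f1 := normalize d1; pose f2 := normalize d2; pose f3 := p i0.
have f1E x : dot x f1 = (dot x (q j1) + dot x (q j2)) / (2 * al).
  by rewrite dotC dot_normalize s1 /d1 dot_lin !(dotC _ x).
have f2E x : dot x f2 = (dot x (q j1) - dot x (q j2)) / (2 * be).
  by rewrite dotC dot_normalize s2 /d2 !dot_lin !(dotC _ x).
have hf : orthonormal f1 f2 f3.
  split; [exact: normalize_unit|exact: normalize_unit|exact: up|].
  split.
  - have d12 : dot d2 d1 = 0 by rewrite /d1 /d2 !dot_lin !uq (dotC (q j2)); ring.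
    by rewrite dot_normalize dotC dot_normalize d12 !mul0r.
  - by rewrite dotC f1E h01 h02; field.
  - by rewrite dotC f2E h01 h02; field.
have p0E : p i0 = comb f1 f2 f3 0 0 1 by rewrite /comb !scale0r !add0r scale1r.
pose z1 := dot (p i1) f3; pose z2 := dot (p i2) f3.
have p1E : p i1 = comb f1 f2 f3 0 (c / be) z1.
  rewrite [LHS](orthonormal_expand hf) f1E f2E c12 -/c -/z1.
  by congr (comb _ _ _ _ _ _); field.
have p2E : p i2 = comb f1 f2 f3 (c / al) 0 z2.
  rewrite [LHS](orthonormal_expand hf) f1E f2E c21 c22 -/z2.
  by congr (comb _ _ _ _ _ _); field.
have q1E : q j1 = comb f1 f2 f3 al be 0.
  rewrite [LHS](orthonormal_expand hf) f1E f2E uq -/g [dot _ f3]dotC h01.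
  have -> : 1 + g = 2 * al ^+ 2 by rewrite al2; field.
  have -> : 1 - g = 2 * be ^+ 2 by rewrite be2; field.
  by congr (comb _ _ _ _ _ _); field.
have q2E : q j2 = comb f1 f2 f3 al (- be) 0.
  rewrite [LHS](orthonormal_expand hf) f1E f2E uq (dotC (q j2) (q j1)) -/g [dot _ f3]dotC h02.
  have -> : g + 1 = 2 * al ^+ 2 by rewrite al2; field.
  have -> : g - 1 = - (2 * be ^+ 2) by rewrite be2; field.
  by congr (comb _ _ _ _ _ _); field.
have c0 : c != 0.
  apply/eqP => c0; have [n01 n01'] := n1 _ _ i01.
  have pz : p i1 = z1 *: p i0 by rewrite p1E c0 mul0r /comb !scale0r !add0r.
  have [h|h] := collinear_unit (up i1) (up i0) pz; first by apply: n01.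
  by apply: n01'; rewrite h opprK.
pose X := dot (q j0) f1; pose Y := dot (q j0) f2.
have q0E' : q j0 = comb f1 f2 f3 X Y e.
  by rewrite [LHS](orthonormal_expand hf) -/X -/Y [dot _ f3]dotC.
have YE : Y = - e * be * z1 / c.
  have : dot (p i1) (q j0) = 0 by [].
  rewrite p1E q0E' (dot_comb hf) mul0r add0r => h.
  have : c / be * Y = - z1 * e by lra.
  move/(congr1 ( *%R (be / c))).
  have -> : be / c * (c / be * Y) = Y by field; rewrite bea.
  by move=> ->; field.
have XE : X = - e * al * z2 / c.
  have : dot (p i2) (q j0) = 0 by [].
  rewrite p2E q0E' (dot_comb hf) mul0r addr0 => h.
  have : c / al * X = - z2 * e by lra.
  move/(congr1 ( *%R (al / c))).
  have -> : al / c * (c / al * X) = X by field; rewrite ala.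
  by move=> ->; field.
have q0E : q j0 = comb f1 f2 f3 (- e * al * z2 / c) (- e * be * z1 / c) e by rewrite -XE -YE.
have albe : al ^+ 2 + be ^+ 2 = 1 by rewrite al2 be2; field.
have u1 : c ^+ 2 + z1 ^+ 2 * be ^+ 2 = be ^+ 2.
  have := up i1; rewrite p1E (dot_comb hf) => /(congr1 ( *%R (be ^+ 2))); rewrite mulr1 => h.
  by rewrite -[RHS]h; field.
have u2 : c ^+ 2 + z2 ^+ 2 * al ^+ 2 = al ^+ 2.
  have := up i2; rewrite p2E (dot_comb hf) => /(congr1 ( *%R (al ^+ 2))); rewrite mulr1 => h.
  by rewrite -[RHS]h; field.
have k1 : c ^+ 2 <= be ^+ 2 by rewrite -u1 lerDl mulr_ge0 ?sqr_ge0.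
have k2 : c ^+ 2 <= al ^+ 2 by rewrite -u2 lerDl mulr_ge0 ?sqr_ge0.
have go ka : c ^+ 2 <= be ^+ 2 + ka <= 1 - c ^+ 2 -> ka != 0 -> flexible p q.
  exact: (cda_motion m3 n3 ui uj hf fw al0 be0 albe c0 p0E p1E p2E q0E q1E q2E).
(* The parameter [be ^+ 2] moves to one end of the interval from [c ^+ 2] to [1 - c ^+ 2]. If both
   ends coincide with its initial value, then [z1 = z2 = 0] and [q j0] equals [p i0] up to sign. *)
have [b1|b1] := eqVneq (c ^+ 2) (be ^+ 2); last first.
  apply: (go (c ^+ 2 - be ^+ 2)); last by rewrite subr_eq0.
  by apply/andP; split; lra.
have [b2|b2] := eqVneq (c ^+ 2) (al ^+ 2); last first.
  apply: (go (al ^+ 2 - c ^+ 2)); last by rewrite subr_eq0 eq_sym.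
  by apply/andP; split; lra.
have z10 : z1 = 0.
  have : z1 ^+ 2 * be ^+ 2 = 0 by lra.
  by move/eqP; rewrite mulf_eq0 !sqrf_eq0 (negbTE bea) orbF => /eqP.
have z20 : z2 = 0.
  have : z2 ^+ 2 * al ^+ 2 = 0 by lra.
  by move/eqP; rewrite mulf_eq0 !sqrf_eq0 (negbTE ala) orbF => /eqP.
have h : q j0 = e *: p i0.
  by rewrite q0E z10 z20 !(mulr0, mul0r) /comb !scale0r !add0r.
have [s1' s2'] := spq i0 j0.
have [h'|h'] := collinear_unit (uq j0) (up i0) h; first by case: s1'.
by case: s2'; rewrite h' opprK.
Qed.
End CDAFlexible.

(** * Diagonal motions of a box configuration *)

Section Dixon2.
Variable R : realType.

Lemma small_parameter1 (B : set R) : (\forall l \near (1 : R), B l) ->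
  exists2 d : R, 0 < d & forall t, 0 <= t <= 1 -> B (1 + d * t).
Proof.
move=> /nbhs_ballP[e /= e0 h]; exists (e / 2); first by rewrite divr_gt0.
move=> t /andP[t0 t1]; apply: h; rewrite /ball /= opprD addrA subrr sub0r normrN.
rewrite ger0_norm; last by rewrite mulr_ge0 // divr_ge0 // ltW.
have : e / 2 * t <= e / 2 by rewrite ler_piMr // divr_ge0 // ltW.
lra.
Qed.

(** Up to sign there are four sign vectors, the diagonals of a cube, and any three of them are
    independent. *)
Lemma sign_rows_independent (s1 s2 s3 r1 r2 r3 x y z : R) :
  s1 * s1 = 1 -> s2 * s2 = 1 -> s3 * s3 = 1 -> r1 * r1 = 1 -> r2 * r2 = 1 -> r3 * r3 = 1 ->
  ~ (s1 = s3 /\ s2 = s3) -> ~ (r1 = r3 /\ r2 = r3) ->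
  ~ (r1 * s1 = r3 * s3 /\ r2 * s2 = r3 * s3) ->
  x + y + z = 0 -> s1 * x + s2 * y + s3 * z = 0 -> r1 * x + r2 * y + r3 * z = 0 ->
  x = 0 /\ z = 0.
Proof.
move=> /sign_cases[] -> /sign_cases[] -> /sign_cases[] -> /sign_cases[] ->
  /sign_cases[] -> /sign_cases[] -> h12 h13 h23 g0 g1 g2;
  first [by case: h12 | by case: h13 | by case: h23 | by split; lra].
Qed.

Section BoxMotion.
Variables (A1 A2 A3 B1 B2 B3 : R).
Hypotheses (a1 : 0 < A1) (a2 : 0 < A2) (a3 : 0 < A3) (sA : A1 + A2 + A3 = 1).
Hypotheses (b1 : 0 < B1) (b2 : 0 < B2) (b3 : 0 < B3) (sB : B1 + B2 + B3 = 1).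
Hypothesis AB : A2 != B2.

(* Scaling the squared coordinates by [psi l * l], [psi l * mid l], [psi l] preserves
   both unit spheres; [mid l] is the root near [1] of a quadratic equation. *)
Let M l := A1 * l + A3.
Let N l := B1 / l + B3.
Let S l := 1 - M l * N l - A2 * B2.
Let D l := S l ^+ 2 - 4 * A2 * B2 * (M l * N l).
(** At [l = 1] the discriminant is [(A2 - B2) ^+ 2]; the sign [sg1 (A2 - B2)] selects the root equal
    to 1, and [A2 != B2] keeps the discriminant positive nearby. *)
Let mid l := (S l + sg1 (A2 - B2) * Num.sqrt (D l)) / (2 * A2 * N l).
Let psi l := N l + B2 / mid l.

Let good l := [/\ 0 < l, 0 <= D l & 0 < mid l].

Let N_gt0 l : 0 < l -> 0 < N l.
Proof. by move=> l0; rewrite addr_gt0 // divr_gt0. Qed.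

(** [psi] is chosen to normalise the [Q j]; the unit norm of the [P i] then reads
    [(M + A2 mid) (N + B2 / mid) = 1], which is the quadratic equation solved by [mid]. *)
Let mid_eq l : good l -> (M l + A2 * mid l) * psi l = 1.
Proof.
move=> [l0 D0 m0]; have n0 := lt0r_neq0 (N_gt0 l0).
have a20 := lt0r_neq0 a2; have m0' := lt0r_neq0 m0.
have rr : (sg1 (A2 - B2) * Num.sqrt (D l)) * (sg1 (A2 - B2) * Num.sqrt (D l)) = D l.
  exact: sg1_sqrt.
have e : A2 * N l * mid l ^+ 2 - S l * mid l + M l * B2 = 0.
  rewrite /mid; move: rr; set r := sg1 _ * _ => rr.
  have -> : A2 * N l * ((S l + r) / (2 * A2 * N l)) ^+ 2 - S l * ((S l + r) / (2 * A2 * N l))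
     + M l * B2 = (r * r - S l ^+ 2 + 4 * A2 * B2 * (M l * N l)) / (4 * A2 * N l).
    by field; rewrite n0.
  by rewrite rr /D (_ : _ + _ = 0) ?mul0r //; ring.
apply: (mulfI m0'); rewrite mulr1 /psi.
have -> : mid l * ((M l + A2 * mid l) * (N l + B2 / mid l)) =
  (A2 * N l * mid l ^+ 2 - S l * mid l + M l * B2) + mid l * (S l + M l * N l + A2 * B2).
  by field.
by rewrite e /S; ring.
Qed.

Let cvg_M (l : R) : M @ l --> M l.
Proof. by apply: cvgD; [apply: cvgM; [exact: cvg_cst|exact: cvg_id]|exact: cvg_cst]. Qed.

Let cvg_N (l : R) : l != 0 -> N @ l --> N l.
Proof.
move=> l0; apply: cvgD; last exact: cvg_cst.
by apply: cvgM; [exact: cvg_cst|apply: cvgV; [exact: l0|exact: cvg_id]].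
Qed.

Let cvg_S (l : R) : l != 0 -> S @ l --> S l.
Proof.
move=> l0; apply: cvgB; last exact: cvg_cst.
by apply: cvgB; [exact: cvg_cst|apply: cvgM; [exact: cvg_M|exact: cvg_N]].
Qed.

Let cvg_D (l : R) : l != 0 -> D @ l --> D l.
Proof.
move=> l0; rewrite /D; apply: cvgB.
  by rewrite expr2; under eq_fun do rewrite expr2; apply: cvgM; exact: cvg_S.
by apply: cvgM; [exact: cvg_cst|apply: cvgM; [exact: cvg_M|exact: cvg_N]].
Qed.

Let cvg_mid (l : R) : 0 < l -> mid @ l --> mid l.
Proof.
move=> l0; have l0' := lt0r_neq0 l0; rewrite /mid; apply: cvgM.
  apply: cvgD; first exact: cvg_S.
  by apply: cvgM; [exact: cvg_cst|apply: cvg_sqrt; exact: cvg_D].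
apply: cvgV; first by rewrite !mulf_neq0 ?pnatr_eq0 // lt0r_neq0 // N_gt0.
by apply: cvgM; [exact: cvg_cst|exact: cvg_N].
Qed.

Let cvg_psi (l : R) : good l -> psi @ l --> psi l.
Proof.
move=> [l0 _ m0]; apply: cvgD; first by apply: cvg_N; exact: lt0r_neq0.
by apply: cvgM; [exact: cvg_cst|apply: cvgV; [exact: lt0r_neq0|exact: cvg_mid]].
Qed.

Let M1 : M 1 = 1 - A2. Proof. by rewrite /M mulr1 -sA; ring. Qed.
Let N1 : N 1 = 1 - B2. Proof. by rewrite /N divr1 -sB; ring. Qed.
Let D1 : D 1 = (A2 - B2) ^+ 2.
Proof. by rewrite /D /S M1 N1; ring. Qed.

Let mid1 : mid 1 = 1.
Proof.
have n0 := lt0r_neq0 (N_gt0 ltr01).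
rewrite /mid D1 sg1K /S M1 N1; rewrite N1 in n0.
by field; rewrite n0 lt0r_neq0.
Qed.

Let psi1 : psi 1 = 1.
Proof. by rewrite /psi mid1 N1 divr1; ring. Qed.

Let near_good : \forall l \near (1 : R), good l.
Proof.
have h1 : \forall l \near (1 : R), 0 < l by exact: (@cvgr_gt _ _ (nbhs (1 : R)) _ id 1 cvg_id 0 ltr01).
have h2 : \forall l \near (1 : R), 0 < D l.
  apply: (cvgr_gt _ (cvg_D (oner_neq0 _))).
  by rewrite D1 exprn_even_gt0 // subr_eq0.
have h3 : \forall l \near (1 : R), 0 < mid l.
  by apply: (cvgr_gt _ (cvg_mid ltr01)); rewrite mid1.
by apply: filterS3 h1 h2 h3 => l g1 g2 g3; split=> //; exact: ltW.
Qed.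

Variables (m n : nat) (p : 'I_m -> 'rV[R]_3) (q : 'I_n -> 'rV[R]_3).
Variables (f1 f2 f3 : 'rV[R]_3).
Hypotheses (hf : orthonormal f1 f2 f3) (fw : spherical_framework p q).
Hypotheses (p1 : forall i, dot (p i) f1 ^+ 2 = A1) (p2 : forall i, dot (p i) f2 ^+ 2 = A2)
  (p3 : forall i, dot (p i) f3 ^+ 2 = A3).
Hypotheses (q1 : forall j, dot (q j) f1 ^+ 2 = B1) (q2 : forall j, dot (q j) f2 ^+ 2 = B2)
  (q3 : forall j, dot (q j) f3 ^+ 2 = B3).
Variables (i1 i2 i3 : 'I_m) (b : 'I_n).
Hypotheses (n12 : p i2 <> p i1 /\ p i2 <> - p i1) (n13 : p i3 <> p i1 /\ p i3 <> - p i1)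
  (n23 : p i3 <> p i2 /\ p i3 <> - p i2).

Lemma box_flexible : flexible p q.
Proof.
have [d d0 hd] := small_parameter1 near_good.
have [sp sq spq] := fw.
have up i : dot (p i) (p i) = 1 by apply: sp.
pose l t := 1 + d * t.
pose L1 t := psi (l t) * l t; pose L2 t := psi (l t) * mid (l t); pose L3 t := psi (l t).
have pos t : 0 <= t <= 1 -> [/\ 0 < L1 t, 0 < L2 t & 0 < L3 t].
  move=> /hd g; have [l0 _ m0] := g.
  have p0 : 0 < psi (l t) by rewrite addr_gt0 ?N_gt0 // divr_gt0.
  by split=> //; rewrite mulr_gt0.
have eA t : 0 <= t <= 1 -> A1 * L1 t + A2 * L2 t + A3 * L3 t = 1.
  by move=> /hd g; rewrite -(mid_eq g) /L1 /L2 /L3 /M -/(l t); ring.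
have eB t : 0 <= t <= 1 -> B1 / L1 t + B2 / L2 t + B3 / L3 t = 1.
  move=> It; have [/lt0r_neq0 l1 /lt0r_neq0 l2 /lt0r_neq0 l3] := pos t It.
  have [/lt0r_neq0 z1 _ /lt0r_neq0 z2] := hd t It.
  have -> : B1 / L1 t + B2 / L2 t + B3 / L3 t = (N (l t) + B2 / mid (l t)) / psi (l t).
    by rewrite /L1 /L2 /L3 /N; field; rewrite z1 z2 l3.
  by rewrite -/(psi (l t)) divff.
have cl (t : R) : l @ t --> l t.
  by apply: cvgD; [exact: cvg_cst|apply: cvgM; [exact: cvg_cst|exact: cvg_id]].
have cL3 (t : R) : 0 <= t <= 1 -> L3 @ t --> L3 t.
  by move=> It; exact: (cvg_comp l psi (cl t) (cvg_psi (hd t It))).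
have cL1 (t : R) : 0 <= t <= 1 -> L1 @ t --> L1 t.
  by move=> It; apply: cvgM; [exact: cL3|exact: cl].
have cL2 (t : R) : 0 <= t <= 1 -> L2 @ t --> L2 t.
  move=> It; have [l0 _ _] := hd t It.
  by apply: cvgM; [exact: cL3|exact: (cvg_comp l mid (cl t) (cvg_mid l0))].
pose P i t := comb f1 f2 f3 (Num.sqrt (L1 t) * dot (p i) f1) (Num.sqrt (L2 t) * dot (p i) f2)
  (Num.sqrt (L3 t) * dot (p i) f3).
pose Q j t := comb f1 f2 f3 (dot (q j) f1 / Num.sqrt (L1 t)) (dot (q j) f2 / Num.sqrt (L2 t))
  (dot (q j) f3 / Num.sqrt (L3 t)).
have L0 : [/\ L1 0 = 1, L2 0 = 1 & L3 0 = 1].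
  by rewrite /L1 /L2 /L3 /l mulr0 addr0 psi1 mid1 mulr1.
have sqr0 t : 0 <= t <= 1 -> [/\ Num.sqrt (L1 t) != 0, Num.sqrt (L2 t) != 0 & Num.sqrt (L3 t) != 0].
  by move=> /pos[h1 h2 h3]; split; rewrite lt0r_neq0 // sqrtr_gt0.
have sqK t : 0 <= t <= 1 -> [/\ Num.sqrt (L1 t) ^+ 2 = L1 t, Num.sqrt (L2 t) ^+ 2 = L2 t
    & Num.sqrt (L3 t) ^+ 2 = L3 t].
  by move=> /pos[h1 h2 h3]; split; rewrite sqr_sqrtr // ltW.
apply: (@flexible_of_motion R m n p q P Q i1 b fw).
- by move=> i; rewrite /P; have [-> -> ->] := L0; rewrite sqrtr1 !mul1r -(orthonormal_expand hf).
- by move=> j; rewrite /Q; have [-> -> ->] := L0; rewrite sqrtr1 !divr1 -(orthonormal_expand hf).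
- move=> i t It; apply: cvg_comb; (apply: cvgM; last exact: cvg_cst); apply: cvg_sqrt;
    by [exact: cL1|exact: cL2|exact: cL3].
- move=> j t It; have [z1 z2 z3] := sqr0 t It.
  apply: cvg_comb; (apply: cvgM; first exact: cvg_cst).
  + by apply: cvgV; [exact: z1|apply: cvg_sqrt; exact: cL1].
  + by apply: cvgV; [exact: z2|apply: cvg_sqrt; exact: cL2].
  + by apply: cvgV; [exact: z3|apply: cvg_sqrt; exact: cL3].
- move=> t It; have [z1 z2 z3] := sqr0 t It; have [k1 k2 k3] := sqK t It; split.
  + move=> i; rewrite /P (dot_comb hf).
    have sq2 (u v : R) : u * v * (u * v) = u ^+ 2 * v ^+ 2 by ring.
    by rewrite !sq2 k1 k2 k3 p1 p2 p3 -(eA t It); ring.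
  + move=> j; rewrite /Q (dot_comb hf).
    have sq2 (u v : R) : u / v * (u / v) = u ^+ 2 / v ^+ 2 by rewrite -expr2 expr_div_n.
    by rewrite !sq2 k1 k2 k3 q1 q2 q3 eB.
  + by move=> i j; rewrite /P /Q (dot_comb hf) (dot_expand hf (p i) (q j)); field; rewrite z1 z2 z3.
move=> [same _].
have [s1 ss1 e21] := sqr_eq_sign (etrans (p1 i2) (esym (p1 i1))).
have [s2 ss2 e22] := sqr_eq_sign (etrans (p2 i2) (esym (p2 i1))).
have [s3 ss3 e23] := sqr_eq_sign (etrans (p3 i2) (esym (p3 i1))).
have [r1 rr1 e31] := sqr_eq_sign (etrans (p1 i3) (esym (p1 i1))).
have [r2 rr2 e32] := sqr_eq_sign (etrans (p2 i3) (esym (p2 i1))).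
have [r3 rr3 e33] := sqr_eq_sign (etrans (p3 i3) (esym (p3 i1))).
have I1 : 0 <= (1 : R) <= 1 by rewrite ler01 lexx.
have [k1 k2 k3] := sqK 1 I1.
have scal i k (s : R) : dot (p i) f1 = s * dot (p k) f1 -> dot (p i) f2 = s * dot (p k) f2 ->
    dot (p i) f3 = s * dot (p k) f3 -> p i = p k \/ p i = - p k.
  move=> h1 h2 h3; apply: (@collinear_unit R (p i) (p k) s (up i) (up k)).
  rewrite (orthonormal_expand hf (p i)) h1 h2 h3 {4}(orthonormal_expand hf (p k)).
  by rewrite /comb !scalerDr !scalerA.
have h12 : ~ (s1 = s3 /\ s2 = s3).
  by move=> [x y]; rewrite x in e21; rewrite y in e22; have [] := scal _ _ _ e21 e22 e23; case: n12.
have h13 : ~ (r1 = r3 /\ r2 = r3).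
  by move=> [x y]; rewrite x in e31; rewrite y in e32; have [] := scal _ _ _ e31 e32 e33; case: n13.
have h23 : ~ (r1 * s1 = r3 * s3 /\ r2 * s2 = r3 * s3).
  move=> [x y].
  have x1 : dot (p i3) f1 = r3 * s3 * dot (p i2) f1 by rewrite -x e21 e31 -mulrA [s1 * (s1 * _)]mulrA ss1 mul1r.
  have x2 : dot (p i3) f2 = r3 * s3 * dot (p i2) f2 by rewrite -y e22 e32 -mulrA [s2 * (s2 * _)]mulrA ss2 mul1r.
  have x3 : dot (p i3) f3 = r3 * s3 * dot (p i2) f3 by rewrite e23 e33 -mulrA [s3 * (s3 * _)]mulrA ss3 mul1r.
  by have [] := scal _ _ _ x1 x2 x3; case: n23.
(* Unchanged products of [p i1] with itself, [p i2] and [p i3] are three linear equations for these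
   increments, with independent sign rows as coefficients. *)
pose D1' := A1 * (L1 1 - 1); pose D2' := A2 * (L2 1 - 1); pose D3' := A3 * (L3 1 - 1).
have g0 : D1' + D2' + D3' = 0 by have := eA 1 I1; have := sA; rewrite /D1' /D2' /D3'; lra.
have gram (i : 'I_m) (u1 u2 u3 : R) : dot (p i) f1 = u1 * dot (p i1) f1 ->
   dot (p i) f2 = u2 * dot (p i1) f2 -> dot (p i) f3 = u3 * dot (p i1) f3 ->
   u1 * D1' + u2 * D2' + u3 * D3' = 0.
  move=> h1 h2 h3; have := same i i1; rewrite /P (dot_comb hf) (dot_expand hf (p i) (p i1)) h1 h2 h3 => h.
  rewrite /D1' /D2' /D3' -(p1 i1) -(p2 i1) -(p3 i1) -k1 -k2 -k3; lra.
have g1 := gram i2 s1 s2 s3 e21 e22 e23.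
have g2 := gram i3 r1 r2 r3 e31 e32 e33.
have [z1 z3] : D1' = 0 /\ D3' = 0.
  exact: (sign_rows_independent ss1 ss2 ss3 rr1 rr2 rr3 h12 h13 h23 g0 g1 g2).
have w1 : L1 1 = 1 by move/mulf_eq0_right: z1 => /(_ (lt0r_neq0 a1)); lra.
have w3 : L3 1 = 1 by move/mulf_eq0_right: z3 => /(_ (lt0r_neq0 a3)); lra.
(* [L1] is [L3] multiplied by [l], and [l 1 = 1 + d] exceeds 1. *)
move: w1 w3; rewrite /L1 /L3 => + h; rewrite h /l mul1r mulr1; lra.
Qed.
End BoxMotion.
End Dixon2.

(** * Flexibility under (PD2) *)

Section PD2Flexible.
Variable R : realType.
Implicit Types x y : 'rV[R]_3.

Lemma dot_reflection (u x : 'rV[R]_3) : u != 0 -> dot u (reflection u x) = - dot u x.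
Proof.
move=> u0; rewrite /reflection dotDr dotNr dotZr divfK; last by rewrite gt_eqF // dot_gt0.
by ring.
Qed.

Lemma dot_reflection_orth (u v x : 'rV[R]_3) : dot v u = 0 -> dot v (reflection u x) = dot v x.
Proof. by move=> vu; rewrite /reflection dotDr dotNr dotZr vu mulr0 oppr0 addr0. Qed.

Lemma neq_opp (x : R) : x != 0 -> x != - x.
Proof. by move=> x0; rewrite -subr_eq0 opprK -mulr2n mulrn_eq0. Qed.

(** Off both planes the two reflections give four distinct images of [x]; a rectangle has no room
    for a fifth vertex. *)
Lemma symmetric_rectangle_orbit (u v : 'rV[R]_3) V x y : orthogonal_planes u v ->
  symmetric_rectangle u v V -> V x -> V y ->
  y \in [:: x; reflection u x; reflection v x; reflection u (reflection v x)].
Proof.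
move=> [/eqP u0 /eqP v0 uv] [[a [b [c [d [VE _ _ _ _]]]]] Vu Vv npl] Vx Vy.
have vu : dot v u = 0 by rewrite dotC.
have [/eqP x1 /eqP x2] := npl x Vx.
set xs := [:: _; _; _; _].
have Ru z : V z -> V (reflection u z) by move=> Vz; rewrite -Vu; exists z.
have Rv z : V z -> V (reflection v z) by move=> Vz; rewrite -Vv; exists z.
have uxs : uniq xs.
  apply: (@map_uniq _ _ (fun z => (dot u z, dot v z))); rewrite /xs /= !inE.
  rewrite !(dot_reflection _ u0) !(dot_reflection_orth _ vu) !(dot_reflection _ v0).
  rewrite !(dot_reflection_orth _ uv).
  rewrite /= !xpair_eqE [- dot u x == _]eq_sym ![_ == - dot u x](negbTE (neq_opp x1)).
  by rewrite ![_ == - dot v x](negbTE (neq_opp x2)) !andbF.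
apply: contraT => yxs.
have sub : {subset y :: xs <= [:: a; b; c; d]}.
  have inV z : V z -> z \in [:: a; b; c; d].
    by rewrite VE => -[[[|]|]|] -> ; rewrite !inE eqxx ?orbT.
  move=> z; rewrite in_cons => /orP[/eqP ->|zx]; first exact: (inV _ Vy).
  apply: inV; move: zx; rewrite /xs !inE => /or4P[]/eqP -> //.
  - exact: Ru.
  - exact: Rv.
  - by apply: Ru; apply: Rv.
have ux : uniq (y :: xs) by rewrite cons_uniq yxs.
by have := uniq_leq_size ux sub.
Qed.

Lemma symmetric_rectangle_sqr (u v : 'rV[R]_3) V x y : orthogonal_planes u v ->
  symmetric_rectangle u v V -> V x -> V y ->
  [/\ dot u x != 0, dot v x != 0, dot u y ^+ 2 = dot u x ^+ 2 & dot v y ^+ 2 = dot v x ^+ 2].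
Proof.
move=> op sr Vx Vy; have := symmetric_rectangle_orbit op sr Vx Vy.
case: op sr => [/eqP u0 /eqP v0 uv] [_ _ _ /(_ x Vx)[/eqP x1 /eqP x2]] yx.
have vu : dot v u = 0 by rewrite dotC.
split=> //; move: yx; rewrite !inE => /or4P[]/eqP -> //;
  by rewrite ?(dot_reflection _ u0) ?(dot_reflection_orth _ vu) ?(dot_reflection _ v0)
    ?(dot_reflection_orth _ uv) ?(dot_reflection _ v0) ?(dot_reflection_orth _ vu) ?sqrrN.
Qed.

Section Classes.
Variables (f1 f2 f3 : 'rV[R]_3).
Hypothesis hf : orthonormal f1 f2 f3.

(* The class of [x] modulo [x |-> - x] when the squares of its coordinates are given. *)
Definition octant x : bool * bool :=
  (0 < dot x f1 * dot x f3, 0 < dot x f2 * dot x f3).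

Definition same_sqr x y := [/\ dot y f1 ^+ 2 = dot x f1 ^+ 2, dot y f2 ^+ 2 = dot x f2 ^+ 2 &
  dot y f3 ^+ 2 = dot x f3 ^+ 2].

Lemma octant_eq x y : same_sqr x y -> dot x f2 != 0 -> dot x f3 != 0 ->
  octant x = octant y -> y = x \/ y = - x.
Proof.
move=> [/sqr_eq_sign[s1 ss1 e1] /sqr_eq_sign[s2 ss2 e2] /sqr_eq_sign[s3 ss3 e3]] x2 x3.
rewrite /octant e1 e2 e3; case=> o1 o2.
have sgn (u v s t : R) : s * s = 1 -> t * t = 1 -> v != 0 ->
    (0 < u * v) = (0 < s * u * (t * v)) -> s * u = t * u.
  move=> ss tt v0; have [->|u0] := eqVneq u 0; first by rewrite !mulr0.
  have uv0 : u * v != 0 by rewrite mulf_neq0.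
  have N : 0 < u * v <> (0 < - (u * v)).
    by rewrite oppr_gt0; move: uv0; rewrite neq_lt => /orP[h|h]; rewrite h lt_gtF.
  move: ss tt => /sign_cases[] -> /sign_cases[] -> // h; case: N;
    by move: h; rewrite ?mul1r ?mulN1r ?mulrN ?mulNr.
have E1 := sgn _ _ _ _ ss1 ss3 x3 o1; have E2 := sgn _ _ _ _ ss2 ss3 x3 o2.
have -> : y = s3 *: x.
  rewrite [LHS](orthonormal_expand hf) e1 e2 e3 E1 E2 [in RHS](orthonormal_expand hf x).
  by rewrite /comb !scalerDr !scalerA.
by have [->|->] := sign_cases ss3; [left; rewrite scale1r|right; rewrite scaleN1r].
Qed.

(** With vanishing first coordinates only two classes of [octant] remain for three vectors that are
    distinct up to sign. *)
Lemma first_coord_neq0 x y z : same_sqr x y -> same_sqr x z ->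
  dot x f2 != 0 -> dot x f3 != 0 ->
  (y <> x /\ y <> - x) -> (z <> x /\ z <> - x) -> (z <> y /\ z <> - y) -> dot x f1 != 0.
Proof.
move=> xy xz x2 x3 nxy nxz nyz; apply/eqP => x1.
have [y1 z1] : dot y f1 = 0 /\ dot z f1 = 0.
  by split; apply/eqP; rewrite -sqrf_eq0; [case: xy => -> _ _|case: xz => -> _ _];
    rewrite x1 expr0n.
have yz : same_sqr y z by case: xy xz => h1 h2 h3 [g1 g2 g3]; split; rewrite ?h1 ?h2 ?h3.
have y2 : dot y f2 != 0 by rewrite -sqrf_eq0; case: xy => _ -> _; rewrite sqrf_eq0.
have y3 : dot y f3 != 0 by rewrite -sqrf_eq0; case: xy => _ _ ->; rewrite sqrf_eq0.
have k1 : octant x <> octant y by move/(octant_eq xy x2 x3) => [] h; case: nxy.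
have k2 : octant x <> octant z by move/(octant_eq xz x2 x3) => [] h; case: nxz.
have k3 : octant y <> octant z by move/(octant_eq yz y2 y3) => [] h; case: nyz.
move: k1 k2 k3; rewrite /octant x1 y1 z1 !mul0r ltxx.
by case: (0 < _ * _) => //; case: (0 < _ * _) => //; case: (0 < _ * _).
Qed.

(* Five vectors fall into four classes. *)
Lemma five_vectors (x y z v w : 'rV[R]_3) :
  same_sqr x y -> same_sqr x z -> same_sqr x v -> same_sqr x w ->
  dot x f2 != 0 -> dot x f3 != 0 ->
  (y <> x /\ y <> - x) -> (z <> x /\ z <> - x) -> (z <> y /\ z <> - y) ->
  (w <> v /\ w <> - v) ->
  (v <> x /\ v <> - x) -> (v <> y /\ v <> - y) -> (v <> z /\ v <> - z) ->
  (w <> x /\ w <> - x) -> (w <> y /\ w <> - y) -> (w <> z /\ w <> - z) -> False.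
Proof.
move=> xy xz xv xw x2 x3 n1 n2 n3 n4 n5 n6 n7 n8 n9 n10.
have key (a b : 'rV[R]_3) : same_sqr x a -> same_sqr x b -> (b <> a /\ b <> - a) ->
    octant a != octant b.
  move=> xa xb [ab ab']; apply/eqP => h.
  have ab2 : same_sqr a b by case: xa xb => h1 h2 h3 [g1 g2 g3]; split; rewrite ?h1 ?h2 ?h3.
  have a2 : dot a f2 != 0 by rewrite -sqrf_eq0; case: xa => _ -> _; rewrite sqrf_eq0.
  have a3 : dot a f3 != 0 by rewrite -sqrf_eq0; case: xa => _ _ ->; rewrite sqrf_eq0.
  by have [] := octant_eq ab2 a2 a3 h.
have xx : same_sqr x x by [].
have u : uniq [:: octant x; octant y; octant z; octant v; octant w].
  by rewrite /= !inE !negb_or !key.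
have := max_card (mem [:: octant x; octant y; octant z; octant v; octant w]).
by rewrite (card_uniqP u) card_prod card_bool.
Qed.
End Classes.

(** The diagonal motion needs a coordinate, along [f2] or [f3], whose squares differ on the two
    parts. If neither does, all joints have the same squared coordinates, and three [p i] with two
    [q j] contradict [five_vectors]. *)
Lemma PD2_flexible (m n : nat) (p : 'I_m -> 'rV[R]_3) (q : 'I_n -> 'rV[R]_3) :
  (2 < m)%N -> (2 < n)%N -> spherical_framework p q -> P2_non_overlapping p q ->
  PD2 p q -> flexible p q.
Proof.
move=> hm hn fw nov [s [t [u [v [V [W [op rV rW hV hW]]]]]]].
have [sp sq spq] := fw; have [n1 n2] := nov.
have up i : dot (p i) (p i) = 1 by apply: sp.
have uq j : dot (q j) (q j) = 1 by apply: sq.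
pose i1 : 'I_m := Ordinal (ltn_trans (ltn_trans (ltn0Sn 0) (ltnSn 1)) hm).
pose i2 : 'I_m := Ordinal (ltn_trans (ltnSn 1) hm). pose i3 : 'I_m := Ordinal hm.
pose j1 : 'I_n := Ordinal (ltn_trans (ltn_trans (ltn0Sn 0) (ltnSn 1)) hn).
pose j2 : 'I_n := Ordinal (ltn_trans (ltnSn 1) hn). pose j3 : 'I_n := Ordinal hn.
have [/eqP u0 /eqP v0 uv] := op.
pose f2 := normalize u; pose f3 := normalize v; pose f1 := cross f2 f3.
have hf : orthonormal f1 f2 f3.
  apply: orthonormal_cross; [exact: normalize_unit|exact: normalize_unit|].
  by rewrite dot_normalize dotC dot_normalize dotC uv !mul0r.
have dots (x : 'rV[R]_3) : dot x f2 = dot u x / Num.sqrt (dot u u) /\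
    dot x f3 = dot v x / Num.sqrt (dot v v).
  by split; rewrite dotC dot_normalize.
have anti k (b : 'I_k -> bool) (f : 'I_k -> 'rV[R]_3) i w :
    dot w (antipode_some b f i) ^+ 2 = dot w (f i) ^+ 2.
  by rewrite /antipode_some; case: (b i); rewrite ?dotNr ?sqrrN.
have coords k (b : 'I_k -> bool) (f : 'I_k -> 'rV[R]_3) U i0 :
    symmetric_rectangle u v U -> (forall i, U (antipode_some b f i)) ->
    (forall i, dot (f i) (f i) = 1) ->
    [/\ dot (f i0) f2 != 0, dot (f i0) f3 != 0 & forall i, same_sqr f1 f2 f3 (f i0) (f i)].
  move=> rU hU uf.
  have sqr w i : dot w (f i) != 0 = (dot w (antipode_some b f i) != 0).
    by rewrite -sqrf_eq0 -(anti k b) sqrf_eq0.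
  have [x2 x3 _ _] := symmetric_rectangle_sqr op rU (hU i0) (hU i0).
  rewrite -!sqr in x2 x3.
  have su := sqrt_dot_gt0 u0; have sv := sqrt_dot_gt0 v0.
  split.
  - by rewrite (dots _).1 mulf_neq0 // invr_eq0 gt_eqF.
  - by rewrite (dots _).2 mulf_neq0 // invr_eq0 gt_eqF.
  move=> i; have [_ _ e2 e3] := symmetric_rectangle_sqr op rU (hU i0) (hU i).
  rewrite !anti in e2 e3.
  have E2 : dot (f i) f2 ^+ 2 = dot (f i0) f2 ^+ 2.
    by rewrite !(dots _).1 !expr_div_n e2.
  have E3 : dot (f i) f3 ^+ 2 = dot (f i0) f3 ^+ 2.
    by rewrite !(dots _).2 !expr_div_n e3.
  split=> //; have := uf i; have := uf i0.
  by rewrite !(dot_expand hf (f _) (f _)) -!expr2 E2 E3; lra.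
have [p2 p3 pS] := coords m s p V i1 rV hV up.
have [q2 q3 qS] := coords n t q W j1 rW hW uq.
have pn i k : i != k -> p i <> p k /\ p i <> - p k by move/eqP/n1.
have qn j k : j != k -> q j <> q k /\ q j <> - q k by move/eqP/n2.
have qp j i : q j <> p i /\ q j <> - p i.
  have [h1 h2] := spq i j; split=> h; first by apply: h1.
  by apply: h2; rewrite h opprK.
have p1 : dot (p i1) f1 != 0.
  by apply: (first_coord_neq0 hf (pS i2) (pS i3)) => //; apply: pn.
have q1 : dot (q j1) f1 != 0.
  by apply: (first_coord_neq0 hf (qS j2) (qS j3)) => //; apply: qn.
have sq0 (x : R) : x != 0 -> 0 < x ^+ 2 by move=> x0; rewrite exprn_even_gt0.
have sumsq x : dot x x = 1 -> dot x f1 ^+ 2 + dot x f2 ^+ 2 + dot x f3 ^+ 2 = 1.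
  by rewrite (dot_expand hf) -!expr2.
have sumsq' x : dot x x = 1 -> dot x f1 ^+ 2 + dot x f3 ^+ 2 + dot x f2 ^+ 2 = 1.
  by move=> /sumsq <-; ring.
have [AB2|AB2] := eqVneq (dot (p i1) f2 ^+ 2) (dot (q j1) f2 ^+ 2); last first.
  apply: (@box_flexible R _ _ _ _ _ _ (sq0 _ p1) (sq0 _ p2) (sq0 _ p3) (sumsq _ (up i1))
    (sq0 _ q1) (sq0 _ q2) (sq0 _ q3) (sumsq _ (uq j1)) AB2 m n p q f1 f2 f3 hf fw
    _ _ _ _ _ _ i1 i2 i3 j1); try (by apply: pn);
    by move=> k; first [by case: (pS k) | by case: (qS k)].
have [AB3|AB3] := eqVneq (dot (p i1) f3 ^+ 2) (dot (q j1) f3 ^+ 2); last first.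
  have hf' : orthonormal f1 f3 f2 by case: hf => ? ? ? [? ? ?]; split=> //; split=> //; rewrite dotC.
  apply: (@box_flexible R _ _ _ _ _ _ (sq0 _ p1) (sq0 _ p3) (sq0 _ p2) (sumsq' _ (up i1))
    (sq0 _ q1) (sq0 _ q3) (sq0 _ q2) (sumsq' _ (uq j1)) AB3 m n p q f1 f3 f2 hf' fw
    _ _ _ _ _ _ i1 i2 i3 j1); try (by apply: pn);
    by move=> k; first [by case: (pS k) | by case: (qS k)].
exfalso.
have pq : same_sqr f1 f2 f3 (p i1) (q j1).
  by split=> //; have := sumsq _ (up i1); have := sumsq _ (uq j1); rewrite AB2 AB3; lra.
have pq2 : same_sqr f1 f2 f3 (p i1) (q j2).
  by case: pq (qS j2) => h1 h2 h3 [g1 g2 g3]; split; rewrite ?g1 ?g2 ?g3.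
by apply: (five_vectors hf (pS i2) (pS i3) pq pq2) => //; try (by apply: pn); try (by apply: qn);
  apply: qp.
Qed.

End PD2Flexible.

Theorem theorem3 (R : realType) (m n : nat)
    (p : 'I_m -> 'rV[R]_3) (q : 'I_n -> 'rV[R]_3)
    (hmn : (3 <= minn m n)%N)
    (hframe : spherical_framework p q)
    (hnonover : P2_non_overlapping p q) :
  flexible p q <-> SD1 p q \/ PD2 p q \/ CDA p q.
Proof.
have [hm hn] : (2 < m)%N /\ (2 < n)%N by move: hmn; rewrite leq_min => /andP[].
split; first exact: flexible_classification.
move=> [|[]]; [exact: SD1_flexible|exact: PD2_flexible|exact: CDA_flexible].
Qed.
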